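(* Let $k$ be a field, let $D$ be a $k$-algebra, let $\sigma$ be a $k$-algebra automorphism of $D$, let $a$ be a central element of $D$, and let $A=D(\sigma,a)$ be the generalized Weyl algebra. Consider the statements: (a) $\operatorname{GKdim}(A)=\operatorname{GKdim}(D)+1$; (b) $\sigma$ is locally algebraic; (c) $\sigma$ has finite order, i.e. $\sigma^m=\mathrm{id}_D$ for some integer $m\geq 1$; (d) $A$ is not simple. (1) If $P_n\subseteq D\subseteq Q_n$, where $P_n=k[z_1,\dots,z_n]$ is the polynomial algebra in $n$ indeterminates and $Q_n$ is its field of fractions, then (a) and (b) are equivalent. (2) If $k$ is algebraically closed, $D$ is a field which is finitely generated as a field over $k$, and $a\neq 0$, then (a), (b), (c) and (d) are all equivalent.
   Context: All algebras are associative unital $k$-algebras and automorphisms are $k$-algebra automorphisms. For an algebra $D$, an automorphism $\sigma$ of $D$ and a central element $a\in D$, the generalized Weyl algebra $D(\sigma,a)$ is the algebra generated by $D$ and two indeterminates $x,y$ subject to $xd=\sigma(d)x$, $yd=\sigma^{-1}(d)y$ for all $d\in D$, $yx=a$, $xy=\sigma(a)$. The Gelfand–Kirillov dimension of an algebra $B$ is $\operatorname{GKdim}(B)=\sup_V\limsup_{n\to\infty}\log_n\dim_k\big(\sum_{i=0}^n V^i\big)$, the supremum over all finite-dimensional subspaces $V$ of $B$ (with $V^0=k$). An automorphism $\sigma$ of $D$ is locally algebraic if every finite-dimensional subspace of $D$ is contained in a finite-dimensional subspace $U$ of $D$ with $\sigma(U)=U$. *)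

(* Defs.v *)
From HB Require Import structures.
From mathcomp Require Import all_boot all_order all_algebra.
From mathcomp Require Import fraction.
From mathcomp Require mpoly.

(* P_n = k[z_1,...,z_n] (multinomials' {mpoly k[n]}) and its field of fractions Q_n.
   mpoly is imported only inside this module, because its notations clash with
   those of MathComp-Analysis. *)
Module MP.
Import mpoly.
Definition Pn (k : fieldType) (n : nat) : idomainType := {mpoly k[n]}.
Definition Qn (k : fieldType) (n : nat) : fieldType := {fraction {mpoly k[n]}}.
Definition PtoQ (k : fieldType) (n : nat) (p : {mpoly k[n]}) : Qn k n := tofrac p.
Definition cst (k : fieldType) (n : nat) (c : k) : Qn k n := tofrac (c%:MP).
End MP.

From mathcomp Require Import all_classical all_reals all_analysis.
From mathcomp Require Import Rstruct.

Set Implicit Arguments.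
Unset Strict Implicit.
Unset Printing Implicit Defensive.

Import Order.TTheory GRing.Theory Num.Theory.
Local Open Scope ring_scope.

Section Defs.
Variable k : fieldType.

Definition lin_free (V : lmodType k) (t : seq V) : Prop :=
  forall c : 'I_(size t) -> k,
    \sum_(i < size t) c i *: t`_i = 0 -> forall i, c i = 0.

Definition in_span (V : lmodType k) (s : seq V) (v : V) : Prop :=
  exists c : 'I_(size s) -> k, v = \sum_(i < size s) c i *: s`_i.

Definition span_dim (V : lmodType k) (s : seq V) : nat :=
  \max_(m : (size s).-tuple bool | `[< lin_free (mask m s) >]) size (mask m s).

Fixpoint words (A : algType k) (vs : seq A) (n : nat) : seq A :=
  if n is n'.+1 then [seq v * w | v <- vs, w <- words vs n'] else [:: 1].

(* a spanning family of  V^0 + V^1 + ... + V^n, where V = span vs *)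
Definition words_upto (A : algType k) (vs : seq A) (n : nat) : seq A :=
  flatten [seq words vs i | i <- iota 0 n.+1].

Definition GK_growth (A : algType k) (vs : seq A) (n : nat) : \bar Rdefinitions.R :=
  ((ln (span_dim (words_upto vs n))%:R) / (ln n%:R))%:E.

(* GKdim A = sup_V limsup_n log_n dim (sum_{i<=n} V^i); every finite-dimensional
   subspace V of A is the span of a finite family vs, and conversely. *)
Definition GKdim (A : algType k) : \bar Rdefinitions.R :=
  ereal_sup (range (fun vs : seq A => limn_esup (GK_growth vs))).

Definition is_alg_automorphism (D : algType k) (sigma : {lrmorphism D -> D}) : Prop :=
  bijective sigma.

Definition central (D : algType k) (a : D) : Prop := forall d : D, a * d = d * a.

(* every finite-dimensional subspace (= span of a finite family vs) is contained in a
   finite-dimensional subspace U = span us with sigma(U) = U *)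
Definition locally_algebraic (D : algType k) (sigma : D -> D) : Prop :=
  forall vs : seq D, exists us : seq D,
    (forall v, v \in vs -> in_span us v) /\
    (forall u, in_span us u -> in_span us (sigma u)) /\
    (forall u, in_span us u -> exists u', in_span us u' /\ sigma u' = u).

Definition finite_order (D : Type) (sigma : D -> D) : Prop :=
  exists m : nat, (1 <= m)%N /\ forall d, iter m sigma d = d.

Definition two_sided_ideal (A : algType k) (I : A -> Prop) : Prop :=
  [/\ I 0, (forall u v, I u -> I v -> I (u + v)) &
      (forall r u, I u -> I (r * u) /\ I (u * r))].

Definition simple_algebra (A : algType k) : Prop :=
  (1 : A) != 0 /\
  forall I : A -> Prop, two_sided_ideal I -> (forall u, I u -> u = 0) \/ (forall u, I u).

(* ---------- the generalized Weyl algebra D(sigma,a), by generators and relations: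
   (A, iota, x, y) is D(sigma,a) iff iota : D -> A is a k-algebra map and x, y satisfy
   the defining relations, and (A, iota, x, y) is universal with these properties. *)

Definition GWA_relations (D A : algType k) (sigma : D -> D) (a : D)
    (iota : D -> A) (x y : A) : Prop :=
  [/\ forall d, x * iota d = iota (sigma d) * x,
      (* y d = sigma^{-1}(d) y, written with d := sigma e (sigma is bijective) *)
      forall e, y * iota (sigma e) = iota e * y,
      y * x = iota a &
      x * y = iota (sigma a)].

Definition is_GWA (D : algType k) (sigma : D -> D) (a : D)
    (A : algType k) (iota : {lrmorphism D -> A}) (x y : A) : Prop :=
  GWA_relations sigma a iota x y /\
  forall (C : algType k) (f : {lrmorphism D -> C}) (X Y : C),
    GWA_relations sigma a f X Y ->
    exists g : {lrmorphism A -> C},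
      [/\ forall d, g (iota d) = f d, g x = X, g y = Y &
          forall g' : {lrmorphism A -> C},
            (forall d, g' (iota d) = f d) -> g' x = X -> g' y = Y ->
            forall u, g' u = g u].

Definition is_field (D : algType k) : Prop :=
  (forall d e : D, d * e = e * d) /\
  (forall d : D, d != 0 -> exists e, d * e = 1).

Definition subfield_k (D : algType k) (S : D -> Prop) : Prop :=
  [/\ forall c : k, S (c%:A),
      (forall u v, S u -> S v -> S (u + v)),
      (forall u v, S u -> S v -> S (u * v)) &
      (forall u e, S u -> u * e = 1 -> S e)].

Definition fg_field_over_k (D : algType k) : Prop :=
  exists gs : seq D, forall S : D -> Prop,
    subfield_k S -> (forall g, g \in gs -> S g) -> forall d, S d.

End Defs.

Definition between_poly_and_fractions (k : fieldType) (n : nat) (D : algType k) : Prop :=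
  exists iota : {rmorphism D -> MP.Qn k n},
    [/\ injective iota,
        (forall (c : k) (d : D), iota (c *: d) = @MP.cst k n c * iota d) &
        forall p : MP.Pn k n, exists d : D, iota d = @MP.PtoQ k n p].

(* Main.v *)
Require Import Defs.
From HB Require Import structures.
From mathcomp Require Import all_boot all_order all_algebra fraction.
From mathcomp Require Import boolp classical_sets functions.
From mathcomp Require mpoly.
From mathcomp Require Import zify ring.

Set Implicit Arguments.
Unset Strict Implicit.
Unset Printing Implicit Defensive.

Import Order.TTheory GRing.Theory Num.Theory.
Local Open Scope ring_scope.

(* Both kinds of D embed in a field F of transcendence degree d = GKdim D over k, with
   d algebraically independent elements z_1, ..., z_d in D.  The monomial order on
   k[z_1, ..., z_d] extends, by Chevalley's theorem, to a valuation v of F with residue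
   field k for which the monomials have distinct values, so that the dimension of a
   finite-dimensional subspace is the number of values taken on it.

   If sigma is locally algebraic, a sigma-stable U of finite dimension gives words of
   length n inside the span of U^(cn) x^i and U^(cn) y^i with i <= cn, so
   GKdim A <= d + 1.  The monomials z^b x^i show GKdim A >= d + 1 in all cases.

   If sigma is not locally algebraic, U_n = V + sigma(V) + ... + sigma^(n-1)(V) has
   dimension at least n for some V.  Take n = h (2h+1)^d elements of U_n with distinct
   values.  Either they meet h classes modulo the group Z^d of values of monomials, or
   some class contains u, w with v(u) = v(w) + v(z^alpha) and |alpha_t| > h.  Then the
   u_i z^b, respectively the u^q w^(n-q) z^b, take at least h n^d values, and multiplying
   by the x^l with n <= l < 2n yields GKdim A >= d + 1 + 1/(d+1).

   For D a field and k algebraically closed, fractions 1/(e - c) with distinct c in k are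
   independent; applied to eigenvectors and to Jordan blocks this shows that a locally
   algebraic sigma has finite order.  Here A = D[x, x^-1; sigma]: it is simple if sigma
   has infinite order, and x^m - 1 generates a proper ideal if sigma^m = 1. *)

Lemma directed_bound (T : eqType) (B : Type) (P : T -> B -> Prop) (b0 : B) (s : seq T) :
  (forall b b', exists c, forall v, P v b \/ P v b' -> P v c) ->
  {in s, forall v, exists b, P v b} -> exists b, {in s, forall v, P v b}.
Proof.
move=> dir; elim: s => [|v s IH] Ps; first by exists b0.
have [b vb] := Ps v (mem_head _ _).
have [|b' sb'] := IH; first by move=> w ws; apply: Ps; rewrite inE ws orbT.
have [c cP] := dir b b'; exists c => w; rewrite inE => /predU1P [->|/sb' wb'].
  by apply: cP; left.
by apply: cP; right.
Qed.

Lemma nat_bound (T : eqType) (P : T -> nat -> Prop) (s : seq T) :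
  (forall v m n, (m <= n)%N -> P v m -> P v n) ->
  {in s, forall v, exists n, P v n} -> exists n, {in s, forall v, P v n}.
Proof.
move=> mono; apply: (directed_bound 0%N) => m n; exists (maxn m n) => v.
by case; apply: mono; rewrite ?leq_maxl ?leq_maxr.
Qed.

Lemma injective_of_ltn (T : Type) (f : nat -> T) :
  (forall i l, (i < l)%N -> f i <> f l) -> injective f.
Proof. by move=> fP i l fil; case: (ltngtP i l) => // /fP; rewrite fil. Qed.

(** * Morphisms *)

Lemma rmorphism_of (R S : nzRingType) (f : R -> S) : zmod_morphism f -> monoid_morphism f ->
  exists g : {rmorphism R -> S}, g =1 f.
Proof.
move=> fB fM; pose m1 := GRing.isZmodMorphism.Build R S f fB.
pose m2 := GRing.isMonoidMorphism.Build R S f fM.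
by exists (HB.pack f m1 m2 : {rmorphism R -> S}).
Qed.

Lemma lrmorphism_of (k : fieldType) (A B : algType k) (f : A -> B) :
  linear f -> monoid_morphism f -> exists g : {lrmorphism A -> B}, g =1 f.
Proof.
move=> fL fM; pose m1 := GRing.isLinear.Build k A B *:%R f fL.
pose m2 := GRing.isMonoidMorphism.Build A B f fM.
by exists (HB.pack f m1 m2 : {lrmorphism A -> B}).
Qed.

Section IteratedMorphisms.

Lemma iter_is_zmod_morphism (V : zmodType) (f : {additive V -> V}) n :
  zmod_morphism (iter n f).
Proof. by move=> u v; elim: n => //= n ->; rewrite raddfB. Qed.

HB.instance Definition _ (V : zmodType) (f : {additive V -> V}) n :=
  GRing.isZmodMorphism.Build V V (iter n f) (iter_is_zmod_morphism f n).

Lemma iter_is_monoid_morphism (R : nzRingType) (f : {rmorphism R -> R}) n :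
  monoid_morphism (iter n f).
Proof. by split=> [|u v]; elim: n => //= n ->; rewrite ?rmorph1 ?rmorphM. Qed.

HB.instance Definition _ (R : nzRingType) (f : {rmorphism R -> R}) n :=
  GRing.isMonoidMorphism.Build R R (iter n f) (iter_is_monoid_morphism f n).

Lemma iter_is_scalable (k : fieldType) (V : lmodType k) (f : {linear V -> V}) n :
  scalable (iter n f).
Proof. by move=> c u; elim: n => //= n ->; rewrite linearZ. Qed.

HB.instance Definition _ (k : fieldType) (V : lmodType k) (f : {linear V -> V}) n :=
  GRing.isScalable.Build k V V *:%R (iter n f) (iter_is_scalable f n).

HB.instance Definition _ (k : fieldType) (A : algType k) (f : {lrmorphism A -> A}) n :=
  GRing.isScalable.Build k A A *:%R (iter n f) (iter_is_scalable f n).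

End IteratedMorphisms.

Lemma linear_mull (k : fieldType) (V : lmodType k) (A : algType k) (f : V -> A) (d : A) :
  linear f -> linear (fun u => d * f u).
Proof. by move=> fL c u v; rewrite fL mulrDr -scalerAr. Qed.

Lemma linear_mulr (k : fieldType) (V : lmodType k) (A : algType k) (f : V -> A) (d : A) :
  linear f -> linear (fun u => f u * d).
Proof. by move=> fL c u v; rewrite fL mulrDl -scalerAl. Qed.

(** * Linear algebra of finite families *)

Section Families.
Variables (k : fieldType) (V : lmodType k).

(* For the family of the entries of a sequence [s] this is convertible to [lin_free s]. *)
Definition indep_family (J : finType) (f : J -> V) :=
  forall c : J -> k, \sum_i c i *: f i = 0 -> forall i, c i = 0.

Lemma exists_linear_relation (I J : finType) (f : I -> J -> k) : (#|J| < #|I|)%N ->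
  exists2 c : I -> k, (exists i, c i != 0) & forall l, \sum_i c i * f i l = 0.
Proof.
move=> ltJI; pose M := \matrix_(i < #|I|, l < #|J|) f (enum_val i) (enum_val l).
have : kermx M != 0.
  by rewrite kermx_eq0 /row_free neq_ltn (leq_ltn_trans (rank_leq_col _)).
case/rowV0Pn => r /sub_kermxP rM /rV0Pn [i ri].
exists (fun i => r 0 (enum_rank i)); first by exists (enum_val i); rewrite enum_valK.
move=> l; transitivity ((r *m M) 0 (enum_rank l)); last by rewrite rM mxE.
rewrite mxE [RHS](reindex enum_rank) /=; last exact: (onW_bij _ (enum_rank_bij _)).
by apply: eq_bigr => i' _; rewrite mxE !enum_rankK.
Qed.

Lemma steinitz_semilinear (F : nzRingType) (W : lmodType F) (kappa : {rmorphism k -> F})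
    (phi : {additive V -> W}) (I J : finType) (f : I -> V) (g : J -> W) :
  injective phi -> (forall c v, phi (c *: v) = kappa c *: phi v) -> indep_family f ->
  (forall i, exists c : J -> k, phi (f i) = \sum_l kappa (c l) *: g l) ->
  (#|I| <= #|J|)%N.
Proof.
move=> phi_inj phiZ ind /choice [m mP]; rewrite leqNgt; apply/negP.
case/(exists_linear_relation m) => c [i ci] c0; case/negP: ci; apply/eqP/ind/phi_inj.
rewrite raddf0 raddf_sum; under eq_bigr do rewrite /= phiZ mP scaler_sumr.
rewrite exchange_big big1 // => l _ /=; under eq_bigr do rewrite scalerA -rmorphM.
by rewrite -scaler_suml -rmorph_sum c0 rmorph0 scale0r.
Qed.

Lemma steinitz (I J : finType) (f : I -> V) (g : J -> V) : indep_family f ->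
  (forall i, exists c : J -> k, f i = \sum_l c l *: g l) -> (#|I| <= #|J|)%N.
Proof. exact: (@steinitz_semilinear k V idfun idfun). Qed.

End Families.

Section Subspaces.
Variables (k : fieldType) (V : lmodType k).
Implicit Types (s t : seq V) (u v w : V) (S : V -> Prop).

Definition subspace S := S 0 /\ forall (c : k) u v, S u -> S v -> S (c *: u + v).

Lemma subspaceD S u v : subspace S -> S u -> S v -> S (u + v).
Proof. by case=> _ SL Su Sv; rewrite -[u]scale1r; apply: SL. Qed.

Lemma subspaceZ S (c : k) u : subspace S -> S u -> S (c *: u).
Proof. by case=> S0 SL Su; rewrite -[_ *: _]addr0; apply: SL. Qed.

Lemma subspaceB S u v : subspace S -> S u -> S v -> S (u - v).
Proof.
by move=> sS Su Sv; apply: (subspaceD sS Su); rewrite -scaleN1r; apply: subspaceZ.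
Qed.

Lemma subspace_sum S (T : Type) (r : seq T) (P : pred T) (f : T -> V) :
  subspace S -> (forall i, P i -> S (f i)) -> S (\sum_(i <- r | P i) f i).
Proof.
move=> sS Sf; apply: (big_ind S) => //; first by case: sS.
by move=> u v; apply: subspaceD.
Qed.

End Subspaces.

Lemma subspace_preim (k : fieldType) (V W : lmodType k) (f : V -> W) (S : W -> Prop) :
  linear f -> subspace S -> subspace (fun v => S (f v)).
Proof.
move=> fL [S0 SL]; split=> [|c u v Su Sv]; last by rewrite fL; apply: SL.
by have := fL (-1) 0 0; rewrite scaler0 addr0 scaleN1r addNr => ->.
Qed.

Lemma subspace_image (k : fieldType) (V W : lmodType k) (f : {linear V -> W})
    (S : V -> Prop) :
  subspace S -> subspace (fun w => exists2 u, S u & f u = w).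
Proof.
move=> [S0 SL]; split; first by exists 0; rewrite ?raddf0 //.
by move=> c _ _ [u Su <-] [v Sv <-]; exists (c *: u + v); [apply: SL|rewrite linearP].
Qed.

Section Spans.
Variables (k : fieldType) (V : lmodType k).
Implicit Types (s t : seq V) (u v w : V) (S : V -> Prop).

Lemma ext_ord (n : nat) (c : 'I_n -> k) : exists c' : nat -> k, forall i : 'I_n, c' i = c i.
Proof. by exists (fun i => oapp c 0 (insub i)) => i; rewrite valK. Qed.

Lemma in_spanP s v :
  in_span s v <-> exists c : nat -> k, v = \sum_(i < size s) c i *: s`_i.
Proof.
split=> [[c ->]|[c ->]]; last by exists (fun i => c i).
have [c' c'E] := ext_ord c.
by exists c'; apply: eq_bigr => i _; rewrite c'E.
Qed.

Lemma lin_freeP t : lin_free t <-> forall c : nat -> k,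
  \sum_(i < size t) c i *: t`_i = 0 -> forall i, (i < size t)%N -> c i = 0.
Proof.
split=> [fr c c0 i ilt|fr c c0 i]; first exact: (fr (fun i => c i) c0 (Ordinal ilt)).
have [c' c'E] := ext_ord c; rewrite -c'E; apply: fr => //.
by rewrite -[RHS]c0; apply: eq_bigr => j _; rewrite c'E.
Qed.

Lemma in_span_subspace s : subspace (in_span s).
Proof.
split; first by exists (fun=> 0); rewrite big1 // => i _; rewrite scale0r.
move=> c u v [a ->] [b ->]; exists (fun i => c * a i + b i).
rewrite scaler_sumr -big_split; apply: eq_bigr => i _.
by rewrite scalerDl scalerA.
Qed.

Lemma in_span_mem s v : v \in s -> in_span s v.
Proof.
move=> vs; apply/in_spanP; exists (fun i => (i == index v s)%:R).
have ilt : (index v s < size s)%N by rewrite index_mem.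
rewrite (bigD1 (Ordinal ilt)) //= eqxx scale1r nth_index // big1 ?addr0 // => i ne.
by move: ne; rewrite -val_eqE /= => /negbTE ->; rewrite scale0r.
Qed.

Lemma in_span_min s S v : subspace S -> {in s, forall w, S w} -> in_span s v -> S v.
Proof.
move=> sS sub [c ->]; apply: subspace_sum => // i _.
by apply: subspaceZ => //; apply: sub; rewrite mem_nth.
Qed.

Lemma in_span_preim (W : lmodType k) (f : V -> W) (S : W -> Prop) s v :
  linear f -> subspace S -> {in s, forall w, S (f w)} -> in_span s v -> S (f v).
Proof.
by move=> fL sS; apply: (in_span_min (S := fun v => S (f v))); apply: subspace_preim.
Qed.

Lemma in_span_trans s t v : {in s, forall w, in_span t w} -> in_span s v -> in_span t v.
Proof. by apply: in_span_min; apply: in_span_subspace. Qed.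

Lemma in_span_sub s t v : {subset s <= t} -> in_span s v -> in_span t v.
Proof. by move=> st; apply: in_span_trans => w /st; apply: in_span_mem. Qed.

Lemma lin_free_nil : lin_free ([::] : seq V).
Proof. by move=> c _ []. Qed.

Lemma lin_free_cons u s : lin_free (u :: s) <-> ~ in_span s u /\ lin_free s.
Proof.
split=> [/lin_freeP fr|[nu /lin_freeP fr]].
  split=> [/in_spanP [c uE]|].
    have := fr (fun i => if i is i'.+1 then c i' else -1).
    rewrite /= big_ord_recl /= {1}uE scaleN1r addNr => /(_ erefl 0%N isT) /eqP.
    by rewrite oppr_eq0 oner_eq0.
  apply/lin_freeP => c c0 i ilt.
  have := fr (fun i => if i is i'.+1 then c i' else 0).
  by rewrite /= big_ord_recl /= scale0r add0r => /(_ c0 i.+1 ilt).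
apply/lin_freeP => c; rewrite /= big_ord_recl /= => c0.
have c00 : c 0%N = 0.
  apply/eqP; apply: contra_notT nu => cn0; apply/in_spanP.
  exists (fun i => - (c 0%N)^-1 * c i.+1).
  transitivity (- (c 0%N)^-1 *: \sum_(i < size s) c i.+1 *: s`_i).
    move/eqP: c0; rewrite addrC addr_eq0 => /eqP ->.
    by rewrite scaleNr scalerN opprK scalerA mulVf ?scale1r.
  by rewrite scaler_sumr; apply: eq_bigr => i _; rewrite scalerA.
move: c0; rewrite c00 scale0r add0r => c0 [|i] // ilt.
exact: (fr (fun i => c i.+1) c0).
Qed.

Lemma lin_free_neq0 u s : lin_free s -> u \in s -> u != 0.
Proof.
elim: s => // v s IH /lin_free_cons [nv fs]; rewrite inE => /predU1P [->|/(IH fs)//].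
by apply/eqP => v0; apply: nv; rewrite v0; case: (in_span_subspace s).
Qed.

Lemma lin_free_swap u v s : lin_free (u :: v :: s) -> lin_free (v :: u :: s).
Proof.
move/lin_freeP => fr; apply/lin_freeP => c; rewrite /= !big_ord_recl /= => c0 i ilt.
pose c' i := if i is i'.+1 then if i' is i''.+1 then c i else c 0%N else c 1%N.
have := fr c'; rewrite /= !big_ord_recl /= addrCA => /(_ c0) c'0.
by case: i ilt => [|[|i]] ilt; [apply: (c'0 1%N)|apply: (c'0 0%N)|apply: (c'0 i.+2)].
Qed.

Lemma lin_free_rem u s : u \in s -> lin_free s -> lin_free (u :: rem u s).
Proof.
elim: s => // v s IH; rewrite inE /=; case: (eqVneq v u) => [<-//|ne].
move=> us /lin_free_cons [nv fs].
apply/lin_free_swap/lin_free_cons; split; last by apply: IH.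
move=> sv; apply: nv; apply: in_span_sub sv => w; rewrite inE => /predU1P [->//|].
exact: mem_rem.
Qed.

Lemma lin_free_eliminate u s (c : V -> k) :
  lin_free (u :: s) -> lin_free [seq v - c v *: u | v <- s].
Proof.
move/lin_freeP => fr; apply/lin_freeP => a; rewrite size_map => a0 i ilt.
pose b i := if i is i'.+1 then a i' else - \sum_(i < size s) a i * c s`_i.
have := fr b; rewrite /= big_ord_recl /= => {}fr; apply: (fr _ i.+1) => //.
rewrite -[RHS]a0 scaleNr scaler_suml addrC -sumrB; apply: eq_bigr => l _.
by rewrite (nth_map 0) // scalerBr scalerA.
Qed.

Lemma indep_family_size_le (J : finType) (f : J -> V) s :
  indep_family f -> (forall i, in_span s (f i)) -> (#|J| <= size s)%N.
Proof.
move=> ind fs; rewrite -[size s]card_ord.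
exact: (steinitz ind (g := fun i : 'I_(size s) => s`_i)).
Qed.

Lemma lin_free_size_le s t :
  lin_free t -> {in t, forall v, in_span s v} -> (size t <= size s)%N.
Proof.
move=> ft ts; rewrite -[size t]card_ord.
apply: (@indep_family_size_le _ (fun i : 'I_(size t) => t`_i)) => // i.
by apply: ts; rewrite mem_nth.
Qed.

Lemma span_dim_basis s : exists b : seq V,
  [/\ lin_free b, size b = span_dim s, {subset b <= s} & {in s, forall v, in_span b v}].
Proof.
have [b [fb /subseqP [m sm bE] sb]] : exists b : seq V,
    [/\ lin_free b, subseq b s & {in s, forall v, in_span b v}].
  elim: s => [|u s [b [fb sub sb]]]; first by exists [::]; split=> //; apply: lin_free_nil.
  have [bu|nbu] := pselect (in_span b u).
    exists b; split=> //; first exact: subseq_trans (subseq_cons _ _).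
    by move=> v; rewrite inE => /predU1P [->|/sb].
  exists (u :: b); split=> //; first exact/lin_free_cons; first by rewrite /= eqxx.
  move=> v; rewrite inE => /predU1P [->|/sb].
    by apply: in_span_mem; rewrite mem_head.
  by apply: in_span_sub => w bw; rewrite inE bw orbT.
exists b; split=> //; last by move=> v; rewrite bE; apply: mem_mask.
apply/eqP; rewrite eqn_leq; apply/andP; split.
  move/eqP: sm => sm; rewrite bE.
  apply: (leq_bigmax_cond (F := fun m : (size s).-tuple bool => size (mask m s)) (Tuple sm)).
  by rewrite /= -bE; apply/asboolP.
apply/bigmax_leqP => m' /asboolP fm'; apply: lin_free_size_le => // v /mem_mask; exact: sb.
Qed.

Lemma indep_family_span_dim (J : finType) (f : J -> V) s :
  indep_family f -> (forall i, in_span s (f i)) -> (#|J| <= span_dim s)%N.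
Proof.
move=> ind fs; have [b [_ <- _ sb]] := span_dim_basis s.
by apply: indep_family_size_le ind _ => i; apply: in_span_trans sb (fs i).
Qed.

Lemma span_dim_le s t : {in s, forall v, in_span t v} -> (span_dim s <= size t)%N.
Proof.
have [b [fb <- bs _]] := span_dim_basis s.
by move=> st; apply: lin_free_size_le => // v /bs; apply: st.
Qed.

End Spans.

Lemma lin_free_map (k : fieldType) (V W : lmodType k) (f : {linear V -> W}) (s : seq V) :
  injective f -> lin_free s -> lin_free (map f s).
Proof.
move=> f_inj /lin_freeP fr; apply/lin_freeP => c; rewrite size_map => c0 i ilt.
apply: fr => //; apply: f_inj; rewrite raddf0 -[RHS]c0 raddf_sum.
by apply: eq_bigr => l _; rewrite /= linearZ (nth_map 0).
Qed.

Lemma stable_span_surj (k : fieldType) (V : lmodType k) (f : {linear V -> V}) (s : seq V) :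
  injective f -> (forall u, in_span s u -> in_span s (f u)) ->
  forall u, in_span s u -> exists2 u', in_span s u' & f u' = u.
Proof.
move=> f_inj st u su; have [b [fb _ bs sb]] := span_dim_basis s.
have : in_span (map f b) u.
  apply: contrapT => nu.
  suff: (size (u :: map f b) <= size b)%N by rewrite /= size_map ltnn.
  apply: lin_free_size_le; first exact/lin_free_cons/(conj nu)/lin_free_map.
  move=> v; rewrite inE => /predU1P [->|/mapP [w wb ->]]; apply: in_span_trans sb _ => //.
  exact/st/in_span_mem/bs.
apply: (in_span_min (S := fun w => exists2 u', in_span s u' & f u' = w)).
  exact/subspace_image/in_span_subspace.
by move=> _ /mapP [w wb ->]; exists w => //; apply/in_span_mem/bs.
Qed.

(** * Valuation rings *)

Section Chevalley.
Variable F : fieldType.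
Implicit Types (R I O : F -> Prop) (u v w : F) (p q : {poly F}) (X Y : (F -> Prop) * (F -> Prop)).

Definition subring R :=
  [/\ R 1, forall u v, R u -> R v -> R (u - v) & forall u v, R u -> R v -> R (u * v)].

Lemma subring0 R : subring R -> R 0.
Proof. by case=> R1 RB _; rewrite -(subrr 1); apply: RB. Qed.

Lemma subringN R u : subring R -> R u -> R (- u).
Proof. by move=> sR Ru; rewrite -sub0r; case: (sR) => _ + _; apply; first exact: subring0. Qed.

Lemma subringD R u v : subring R -> R u -> R v -> R (u + v).
Proof.
by move=> sR Ru Rv; rewrite -[v]opprK; case: (sR) => _ + _; apply; last exact: subringN.
Qed.

Lemma subringX R u n : subring R -> R u -> R (u ^+ n).
Proof.
move=> [R1 _ RM] Ru; elim: n => [|n IH]; first by rewrite expr0.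
by rewrite exprS; apply: RM.
Qed.

Definition proper_ideal_in R I :=
  [/\ subring R, forall u, I u -> R u, (forall u v, I u -> I v -> I (u + v)) /\ I 0,
      forall u v, R u -> I v -> I (u * v) & ~ I 1].

Definition valuation_ring O := subring O /\ forall u, O u \/ O u^-1.

Definition adjoin I u w := exists2 p : {poly F}, (forall i, I p`_i) & w = p.[u].

Lemma adjoin_sub I u w : I 0 -> I w -> adjoin I u w.
Proof.
move=> I0 Iw; exists w%:P; last by rewrite hornerC.
by move=> i; rewrite coefC; case: ifP.
Qed.

Lemma adjoin_proper R I u :
  proper_ideal_in R I -> ~ adjoin I u 1 -> proper_ideal_in (adjoin R u) (adjoin I u).
Proof.
move=> [sR IR [ID I0] IM _] n1; have R0 := subring0 sR; have RD := @subringD R _ _ sR.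
case: sR => R1 RB RM; split=> //.
- split; first exact: adjoin_sub.
  + move=> _ _ [p Rp ->] [q Rq ->]; exists (p - q); last by rewrite !hornerE.
    by move=> i; rewrite coefB; apply: RB.
  + move=> _ _ [p Rp ->] [q Rq ->]; exists (p * q); last by rewrite !hornerE.
    by move=> i; rewrite coefM; apply: (big_ind R) => // j _; apply: RM.
- by move=> _ [p Ip ->]; exists p => // i; apply: IR.
- split; last exact: adjoin_sub.
  move=> _ _ [p Rp ->] [q Rq ->]; exists (p + q); last by rewrite !hornerE.
  by move=> i; rewrite coefD; apply: ID.
- move=> _ _ [p Rp ->] [q Rq ->]; exists (p * q); last by rewrite !hornerE.
  by move=> i; rewrite coefM; apply: (big_ind I) => // j _; apply: IM.
Qed.

Definition unit_relation I u n :=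
  exists p : {poly F}, [/\ (size p <= n)%N, forall i, I p`_i & p.[u] = 1].

(* With [p.[u] = 1] and [q.[u^-1] = 1], the relation
   [u ^+ n.+1 * (1 - q`_0) = \sum_(i < n.+1) q`_(n.+1 - i) * u ^+ i] removes the leading
   term of [(1 - q`_0) * p]. *)
Lemma unit_relation_shorten R I u n : proper_ideal_in R I -> u != 0 ->
  unit_relation I u n.+2 -> unit_relation I u^-1 n.+2 -> unit_relation I u n.+1.
Proof.
move=> [sR IR [ID I0] IM _] u0 [p [sp Ip p1]] [q [sq Iq q1]].
pose r := \poly_(i < n.+1) ((1 - q`_0) * p`_i + p`_n.+1 * q`_(n.+1 - i)).
exists (r + (q`_0)%:P); split.
- apply: leq_trans (size_polyD _ _) _; rewrite geq_max size_poly /=.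
  exact: leq_trans (size_polyC_leq1 _) _.
- move=> i; rewrite coefD coefC coef_poly; apply/ID; last by case: ifP.
  case: ifP => // _; apply/ID; apply: (IM) => //; last exact: IR.
  by case: (sR) => R1 + _; apply=> //; apply: IR.
have qE : \sum_(i < n.+1) q`_(n.+1 - i) * u ^+ i = u ^+ n.+1 * (1 - q`_0).
  rewrite -q1 (horner_coef_wide _ sq) [in RHS]big_ord_recl mulr1 addrAC subrr add0r mulr_sumr.
  rewrite (reindex_inj rev_ord_inj); apply: eq_bigr => i _ /=.
  rewrite subKn // mulrCA exprVn expfB_cond // (negbTE u0); exact: ltn_ord.
rewrite hornerD hornerC horner_poly; under eq_bigr do rewrite mulrDl -!mulrA.
rewrite big_split /= -!mulr_sumr qE.
have := p1; rewrite (horner_coef_wide _ sp) big_ord_recr /= => /(canRL (addrK _)) ->.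
by ring.
Qed.

Lemma unit_relation_contra R I u n : proper_ideal_in R I -> u != 0 ->
  unit_relation I u n -> unit_relation I u^-1 n -> False.
Proof.
move=> pI u0; elim: n => [|[|n] IH] ru rv.
- have [p [sp _ p1]] := ru; move: sp p1; rewrite leqn0 size_poly_eq0 => /eqP ->.
  by rewrite horner0 => /eqP; rewrite eq_sym oner_eq0.
- have [p [sp Ip p1]] := ru; case: pI => _ _ _ _; apply.
  by have := Ip 0%N; rewrite -p1 [in p.[_]](size1_polyC sp) hornerC.
- apply: IH; first exact: unit_relation_shorten pI u0 ru rv.
  by apply: (unit_relation_shorten pI) rv _; rewrite ?invr_eq0 // invrK.
Qed.

Lemma adjoin_inv_contra R I u : proper_ideal_in R I -> u != 0 ->
  adjoin I u 1 -> adjoin I u^-1 1 -> False.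
Proof.
move=> pI u0 [p Ip p1] [q Iq q1].
apply: (unit_relation_contra (n := maxn (size p) (size q)) pI u0).
  by exists p; rewrite leq_maxl.
by exists q; rewrite leq_maxr.
Qed.

Definition dominated X Y := (forall u, X.1 u -> Y.1 u) /\ (forall u, X.2 u -> Y.2 u).

Lemma proper_ideal_chain_union (C : set ((F -> Prop) * (F -> Prop))) :
  (exists X, C X) -> (forall X, C X -> proper_ideal_in X.1 X.2) -> total_on C dominated ->
  proper_ideal_in (fun u => exists2 X, C X & X.1 u) (fun u => exists2 X, C X & X.2 u).
Proof.
move=> [X0 CX0] pC totC.
have join X Y : C X -> C Y -> exists2 Z, C Z & dominated X Z /\ dominated Y Z.
  by move=> CX CY; have [XY|YX] := totC _ _ CX CY; [exists Y|exists X].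
split.
- split.
  + by exists X0 => //; case: (pC _ CX0) => [[]].
  + move=> u v [X CX Xu] [Y CY Yv]; have [Z CZ [[XZ _] [YZ _]]] := join _ _ CX CY.
    by exists Z => //; case: (pC _ CZ) => -[_ + _ _ _ _ _]; apply; [apply: XZ|apply: YZ].
  + move=> u v [X CX Xu] [Y CY Yv]; have [Z CZ [[XZ _] [YZ _]]] := join _ _ CX CY.
    by exists Z => //; case: (pC _ CZ) => -[_ _ + _ _ _ _]; apply; [apply: XZ|apply: YZ].
- by move=> u [X CX Xu]; exists X => //; case: (pC _ CX) => _ + _ _ _; apply.
- split; last by exists X0 => //; case: (pC _ CX0) => _ _ [].
  move=> u v [X CX Xu] [Y CY Yv]; have [Z CZ [[_ XZ] [_ YZ]]] := join _ _ CX CY.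
  by exists Z => //; case: (pC _ CZ) => _ _ [+ _] _ _; apply; [apply: XZ|apply: YZ].
- move=> u v [X CX Xu] [Y CY Yv]; have [Z CZ [[XZ _] [_ YZ]]] := join _ _ CX CY.
  by exists Z => //; case: (pC _ CZ) => _ _ _ + _; apply; [apply: XZ|apply: YZ].
- by case=> X CX X1; case: (pC _ CX) => _ _ _ _; apply.
Qed.

Lemma exists_maximal_proper_ideal X : proper_ideal_in X.1 X.2 -> exists Y,
  [/\ proper_ideal_in Y.1 Y.2, dominated X Y &
      forall Z, proper_ideal_in Z.1 Z.2 -> dominated Y Z -> dominated Z Y].
Proof.
move=> pX; pose T := {Y | proper_ideal_in Y.1 Y.2 /\ dominated X Y}.
pose x0 : T := exist _ X (conj pX (conj (fun _ => id) (fun _ => id))).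
pose R (s t : T) := `[< dominated (sval s) (sval t) >].
have domtrans X1 X2 X3 : dominated X1 X2 -> dominated X2 X3 -> dominated X1 X3.
  by move=> [h1 h2] [h3 h4]; split=> u; [move/h1/h3|move/h2/h4].
have [||A totA|[Y [pY XY]] maxY] := ZL_preorder x0 (R := R).
- by move=> s; apply/asboolP.
- by move=> s t r /asboolP st /asboolP tr; apply/asboolP; apply: domtrans st tr.
- have [[s0 As0]|nA] := pselect (exists s, A s); last first.
    by exists x0 => s As; case: nA; exists s.
  pose C Y := exists2 s : T, A s & sval s = Y.
  have pU : proper_ideal_in (fun u => exists2 Y, C Y & Y.1 u) (fun u => exists2 Y, C Y & Y.2 u).
    apply: proper_ideal_chain_union; first by exists (sval s0), s0.
      by move=> _ [s _ <-]; case: (svalP s).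
    by move=> _ _ [s As <-] [t At <-]; have [/asboolP|/asboolP] := totA _ _ As At; [left|right].
  have ub s : A s -> dominated (sval s) ((fun u => exists2 Y, C Y & Y.1 u),
      (fun u => exists2 Y, C Y & Y.2 u)).
    by move=> As; split=> u su; exists (sval s) => //; exists s.
  have Xub := domtrans _ _ _ (proj2 (svalP s0)) (ub _ As0).
  by exists (exist _ (_, _) (conj pU Xub)) => s As; apply/asboolP/ub.
exists Y; split=> // Z pZ YZ.
have := maxY (exist _ Z (conj pZ (domtrans _ _ _ XY YZ))).
by rewrite /R /= => /(_ (asboolT YZ)) /asboolP.
Qed.

Theorem chevalley R I : proper_ideal_in R I ->
  exists O, [/\ valuation_ring O, forall u, R u -> O u &
                forall u, u != 0 -> I u -> ~ O u^-1].
Proof.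
move=> pI; have [[O J] /= [pJ [RO IJ] maxJ]] := exists_maximal_proper_ideal (X := (R, I)) pI.
have O_adjoin u : ~ adjoin J u 1 -> O u.
  move=> nu; have [sO _ [_ J0] _ _] := pJ.
  have sub : dominated (O, J) (adjoin O u, adjoin J u).
    by split=> w; apply: adjoin_sub => //; apply: subring0.
  have [/(_ u) + _] := maxJ (_, _) (adjoin_proper pJ nu) sub; apply.
  by exists 'X; rewrite ?hornerX // => i; rewrite coefX; case: sO (subring0 sO); case: eqP.
exists O; split=> [|//|u u0 /IJ Ju Ou]; last first.
  by case: pJ => _ _ _ JM; apply; rewrite -(mulVf u0); apply: JM.
split=> [|u]; first by case: pJ.
have [->|u0] := eqVneq u 0; first by left; case: pJ => /subring0.
have [ru|/O_adjoin] := pselect (adjoin J u 1); last by left.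
by right; apply/O_adjoin/(adjoin_inv_contra pJ u0 ru).
Qed.

End Chevalley.

Section ValuationTheory.
Variables (F : fieldType) (O : F -> Prop).
Hypothesis vO : valuation_ring O.
Implicit Types u v w : F.

Let sO : subring O. Proof. by case: vO. Qed.

Lemma valuation_ringM u v : O u -> O v -> O (u * v).
Proof. by case: sO => _ _; apply. Qed.

Lemma valuation_ring1 : O 1. Proof. by case: sO. Qed.

Definition max_ideal u := u = 0 \/ ~ O u^-1.

Lemma max_idealM u v : O u -> max_ideal v -> max_ideal (u * v).
Proof.
move=> Ou [->|nv]; first by left; rewrite mulr0.
have [->|u0] := eqVneq u 0; first by left; rewrite mul0r.
right; rewrite invfM mulrC => Ouv; apply: nv.
by rewrite -[v^-1]mulr1 -(mulVf u0) mulrA; apply: valuation_ringM.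
Qed.

Lemma max_idealD u v : max_ideal u -> max_ideal v -> max_ideal (u + v).
Proof.
have [->|u0] := eqVneq u 0; first by rewrite add0r.
have [->|v0] := eqVneq v 0; first by rewrite addr0.
move=> mu mv; have [_ /(_ (u / v))] := vO; rewrite invf_div => -[Ouv|Ovu].
  have -> : u + v = (u / v + 1) * v by rewrite mulrDl mul1r divfK.
  by apply: max_idealM => //; apply: subringD => //; apply: valuation_ring1.
have -> : u + v = (v / u + 1) * u by rewrite mulrDl mul1r divfK // addrC.
by apply: max_idealM => //; apply: subringD => //; apply: valuation_ring1.
Qed.

Lemma max_idealN u : max_ideal u -> max_ideal (- u).
Proof. by rewrite -mulN1r; apply/max_idealM/(subringN sO)/valuation_ring1. Qed.

Lemma max_ideal_sum (T : Type) (r : seq T) (P : pred T) (f : T -> F) :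
  (forall i, P i -> max_ideal (f i)) -> max_ideal (\sum_(i <- r | P i) f i).
Proof. by move=> mf; apply: (big_ind max_ideal) => //; [left|apply: max_idealD]. Qed.

Lemma max_ideal_prime u v : max_ideal (u * v) -> max_ideal u \/ max_ideal v.
Proof.
have [mu|/not_orP [u0 /contrapT Ou]] := pselect (max_ideal u); first by left.
have [mv|/not_orP [v0 /contrapT Ov]] := pselect (max_ideal v); first by right.
case=> [/eqP|]; last by rewrite invfM => /(_ (valuation_ringM Ou Ov)).
by rewrite mulf_eq0 => /orP [] /eqP.
Qed.

Definition val_eq u v := O (u / v) /\ O (v / u).

Lemma val_eq_refl u : u != 0 -> val_eq u u.
Proof. by move=> u0; split; rewrite divff //; apply: valuation_ring1. Qed.

Lemma val_eq_sym u v : val_eq u v -> val_eq v u.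
Proof. by case. Qed.

Lemma val_eqM u v u' v' : val_eq u v -> val_eq u' v' -> val_eq (u * u') (v * v').
Proof.
by move=> [o1 o2] [o3 o4]; split; rewrite invfM mulrACA; apply: valuation_ringM.
Qed.

Lemma val_eqMr w u v : w != 0 -> val_eq u v -> val_eq (u * w) (v * w).
Proof. by move=> w0 uv; apply: val_eqM (val_eq_refl w0). Qed.

Lemma val_eqX u v n : val_eq u v -> val_eq (u ^+ n) (v ^+ n).
Proof.
move=> s; elim: n => [|n IH]; first by rewrite !expr0; apply/val_eq_refl/oner_neq0.
by rewrite !exprS; apply: val_eqM.
Qed.

Lemma val_eq_trans v u w : v != 0 -> val_eq u v -> val_eq v w -> val_eq u w.
Proof.
have divE (s t : F) : v != 0 -> s / t = (s / v) * (v / t) by move=> v0; rewrite mulrA divfK.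
by move=> v0 [o1 o2] [o3 o4]; split; rewrite divE //; apply: valuation_ringM.
Qed.

Lemma val_eq_cancelr w u v : w != 0 -> val_eq (u * w) (v * w) -> val_eq u v.
Proof.
move=> w0 []; rewrite !invfM mulrACA divff // mulr1 => ?.
by rewrite mulrACA divff // mulr1.
Qed.

Lemma not_val_eq_max_ideal u v : O (u / v) -> ~ val_eq u v -> max_ideal (u / v).
Proof.
by move=> Ouv ns; right; rewrite invf_div => Ovu; apply: ns.
Qed.

Lemma max_ideal_not_val_eq u v : u != 0 -> v != 0 -> max_ideal (u / v) -> ~ val_eq u v.
Proof.
move=> u0 v0 [/eqP|]; first by rewrite mulf_eq0 invr_eq0 (negbTE u0) (negbTE v0).
by rewrite invf_div => nO [].
Qed.

Definition distinct_values (T : Type) (f : T -> F) :=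
  (forall i, f i != 0) /\ forall i l, val_eq (f i) (f l) -> i = l.

Lemma exists_max_value (T : eqType) (f : T -> F) (s : seq T) : s != [::] ->
  {in s, forall i, f i != 0} ->
  exists2 i, i \in s & {in s, forall l, O (f l / f i)}.
Proof.
elim: s => // i s IH _ nz; have [->|sn0] := eqVneq s [::].
  exists i; rewrite ?mem_head // => l; rewrite inE => /eqP ->.
  by rewrite divff; [apply: valuation_ring1|apply: nz; rewrite mem_head].
have fi : f i != 0 by apply: nz; rewrite mem_head.
case: (IH sn0) => [l ls|l ls max]; first by apply: nz; rewrite inE ls orbT.
have fl : f l != 0 by apply: nz; rewrite inE ls orbT.
have [_ /(_ (f i / f l))] := vO; rewrite invf_div => -[o|o].
  by exists l; [rewrite inE ls orbT|move=> m; rewrite inE => /predU1P [->|/max]].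
exists i; rewrite ?mem_head // => m; rewrite inE => /predU1P [->|/max om].
  by rewrite divff //; apply: valuation_ring1.
have -> : f m / f i = (f m / f l) * (f l / f i) by rewrite mulrA divfK.
exact: valuation_ringM.
Qed.

End ValuationTheory.

Definition insert_at (T : Type) (n : nat) (h : 'I_n.+1) (u : T) (f : 'I_n -> T) :
    'I_n.+1 -> T :=
  fun i => oapp f u (unlift h i).

Lemma insert_at_comp (T U : Type) (g : T -> U) n (h : 'I_n.+1) u (f : 'I_n -> T) :
  (fun i => g (insert_at h u f i)) = insert_at h (g u) (fun i => g (f i)).
Proof. by apply/funext => i; rewrite /insert_at; case: unlift. Qed.

Lemma distinct_values_insert (F : fieldType) (O : F -> Prop) n (h : 'I_n.+1) u
    (f : 'I_n -> F) :
  u != 0 -> distinct_values O f -> (forall i, max_ideal O (f i / u)) ->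
  distinct_values O (insert_at h u f).
Proof.
move=> u0 [f0 f_inj] fu; have nfu i := max_ideal_not_val_eq (f0 i) u0 (fu i).
split=> [i|i l]; rewrite /insert_at; first by case: unlift => /=.
case: unliftP => [i'|] ->; case: unliftP => [l'|] -> //=.
- by move=> /f_inj ->.
- by move/nfu.
- by move=> uf; case: (nfu l'); apply: val_eq_sym.
Qed.

Section CoefficientField.
Variables (k F : fieldType) (kappa : {rmorphism k -> F}) (O : F -> Prop).

Definition coefficient_field :=
  (forall c, O (kappa c)) /\ forall u, O u -> exists c, max_ideal O (u - kappa c).

Hypothesis vO : valuation_ring O.
Hypothesis cO : coefficient_field.

Lemma max_ideal_const c : max_ideal O (kappa c) -> c = 0.
Proof.
case=> [/eqP|]; first by rewrite fmorph_eq0 => /eqP.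
by rewrite -fmorphV => n; case: cO => /(_ c^-1) /n.
Qed.

Variables (D : lmodType k) (j : {additive D -> F}).
Hypothesis jZ : forall c d, j (c *: d) = kappa c * j d.

Lemma distinct_values_indep (T : finType) (f : T -> D) :
  distinct_values O (fun i => j (f i)) -> indep_family f.
Proof.
move=> [f0 f_inj] c c0 i0; apply/eqP; apply: contraT => ci0.
have [|i|i is_ max] := exists_max_value vO (f := fun i => j (f i)) (s := enum [pred i | c i != 0]).
- by apply/eqP => e; have := mem_enum [pred i | c i != 0] i0; rewrite e !inE ci0.
- by [].
move: is_; rewrite mem_enum inE => ci; case/negP: ci; apply/eqP/max_ideal_const.
have -> : kappa (c i) = - \sum_(l | l != i) kappa (c l) * (j (f l) / j (f i)).
  move/(congr1 (fun u => j u / j (f i))): c0; rewrite raddf0 mul0r raddf_sum (bigD1 i) //=.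
  rewrite jZ mulrDl mulfK // mulr_suml => /eqP; rewrite addr_eq0 => /eqP ->.
  by congr (- _); apply: eq_bigr => l _; rewrite jZ mulrA.
apply/(max_idealN vO)/(max_ideal_sum vO) => l li.
have [->|cl] := eqVneq (c l) 0; first by left; rewrite rmorph0 mul0r.
apply: (max_idealM vO); first by case: cO.
apply: not_val_eq_max_ideal; first by apply: max; rewrite mem_enum.
by move=> /f_inj e; rewrite e eqxx in li.
Qed.

Hypothesis j_inj : injective j.

(* Subtracting suitable multiples of an element of largest value from the others lowers
   their values. *)
Lemma exists_distinct_values n (S : D -> Prop) (s : seq D) :
  subspace S -> lin_free s -> {in s, forall d, S d} -> size s = n ->
  exists2 f : 'I_n -> D, forall i, S (f i) & distinct_values O (fun i => j (f i)).
Proof.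
elim: n S s => [|n IH] S s sS fs sub sz; first by exists (fun=> 0); [case|split; case].
have nz0 : {in s, forall d, j d != 0}.
  by move=> d ds; rewrite raddf_eq0 // (lin_free_neq0 fs).
have sn0 : s != [::] by case: (s) sz.
have [u us max] := exists_max_value vO sn0 nz0; have ju := nz0 _ us.
have /choice [c cP] : forall d : D, exists c : k, O (j d / j u) ->
    max_ideal O (j d / j u - kappa c).
  move=> d; case: cO => _ res.
  by have [/res [c]|nO] := pselect (O (j d / j u)); [exists c|exists 0].
pose S' d := S d /\ max_ideal O (j d / j u).
have sS' : subspace S'.
  split; first by split; [case: sS|left; rewrite raddf0 mul0r].
  move=> a d e [Sd md] [Se me]; split; first by case: sS => _; apply.
  rewrite raddfD jZ mulrDl -mulrA; apply: (max_idealD vO) => //.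
  by apply: (max_idealM vO) => //; case: cO.
have [||f /all_and2 [Sf fu] df] := IH S' _ sS' (lin_free_eliminate (c := c) (lin_free_rem us fs)).
- move=> _ /mapP [d /mem_rem ds ->]; split.
    by apply: subspaceB => //; [apply: sub|apply: subspaceZ => //; apply: sub].
  by rewrite raddfB jZ mulrBl mulfK //; apply/cP/max.
- by rewrite size_map size_rem // sz.
exists (insert_at ord0 u f).
  by move=> i; rewrite /insert_at; case: unlift => //=; apply: sub.
by rewrite insert_at_comp; apply: distinct_values_insert.
Qed.

End CoefficientField.

Definition splits (k : fieldType) (p : {poly k}) :=
  exists r : seq k, p = lead_coef p *: \prod_(x <- r) ('X - x%:P).

Lemma splits_size2 (k : fieldType) (p : {poly k}) : (size p <= 2)%N -> splits p.
Proof.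
move=> sp; have [p1|p1] := eqVneq (size p) 2; last first.
  have {}sp : (size p <= 1)%N by rewrite -ltnS ltn_neqAle p1.
  by exists [::]; rewrite big_nil (size1_polyC sp) lead_coefC alg_polyC.
exists [:: - (p`_1)^-1 * p`_0]; rewrite big_seq1.
have lc0 : p`_1 != 0 by have := lead_coef_eq0 p; rewrite lead_coefE p1 -size_poly_eq0 p1 => ->.
rewrite lead_coefE p1; apply/polyP => -[|[|i]]; rewrite coefZ coefB coefX coefC /=.
- by rewrite sub0r mulNr opprK mulVKf.
- by rewrite subr0 mulr1.
- by rewrite subr0 mulr0 nth_default // p1.
Qed.

Lemma splits_root_prime (k F : fieldType) (kappa : {rmorphism k -> F}) (P : F -> Prop)
    (p : {poly k}) u :
  (forall c, P (kappa c) -> c = 0) -> (forall v w, P (v * w) -> P v \/ P w) ->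
  splits p -> p != 0 -> P (map_poly kappa p).[u] -> exists c, P (u - kappa c).
Proof.
move=> Pconst Pprime [r ->]; move: (lead_coef p) => l lr0.
have {lr0} l0 : l != 0 by apply: contraNneq lr0 => ->; rewrite scale0r.
rewrite map_polyZ hornerZ => /Pprime [/Pconst l_0|]; first by rewrite l_0 eqxx in l0.
elim: r => [|x r IH].
  rewrite big_nil rmorph1 hornerC -(rmorph1 kappa) => /Pconst /eqP.
  by rewrite oner_eq0.
rewrite big_cons rmorphM hornerM rmorphB /= map_polyX map_polyC hornerXsubC.
by move/Pprime => [Px|/IH //]; exists x.
Qed.

(** * Words and growth *)

Section Words.
Variables (k : fieldType) (B : algType k).
Implicit Types (vs l : seq B) (u v : B).

Lemma wordsP vs n v : reflect
  (exists l, [/\ size l = n, {subset l <= vs} & v = \prod_(w <- l) w]) (v \in words vs n).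
Proof.
elim: n v => [|n IH] v.
  rewrite inE; apply: (iffP eqP) => [->|[l [/size0nil -> _ ->]]]; last by rewrite big_nil.
  by exists [::]; rewrite big_nil.
apply: (iffP allpairsP) => [[[u w] /= [uvs /IH [l [sl lvs ->]] ->]]|].
  exists (u :: l); rewrite big_cons /= sl; split=> // t; rewrite inE.
  by case/predU1P => [->|/lvs].
case=> -[|u l] [] // [sl] lvs ->; exists (u, \prod_(w <- l) w); split; rewrite ?big_cons //=.
  by apply: lvs; rewrite mem_head.
by apply/IH; exists l; split=> // t tl; apply: lvs; rewrite inE tl orbT.
Qed.

Lemma words_uptoP vs n v : reflect
  (exists l, [/\ (size l <= n)%N, {subset l <= vs} & v = \prod_(w <- l) w])
  (v \in words_upto vs n).
Proof.
apply: (iffP flatten_mapP) => [[i]|[l [sl lvs ->]]].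
  rewrite mem_iota add0n ltnS => ilt /wordsP [l [sl lvs ->]].
  by exists l; rewrite sl.
exists (size l); first by rewrite mem_iota add0n ltnS.
by apply/wordsP; exists l.
Qed.

Definition word_span vs n := in_span (words_upto vs n).

Lemma word_span_subspace vs n : subspace (word_span vs n).
Proof. exact: in_span_subspace. Qed.

Lemma word_span_prod vs n l : {subset l <= vs} -> (size l <= n)%N ->
  word_span vs n (\prod_(w <- l) w).
Proof. by move=> lvs sl; apply/in_span_mem/words_uptoP; exists l. Qed.

Lemma word_span_mono vs n m u : (n <= m)%N -> word_span vs n u -> word_span vs m u.
Proof.
move=> nm; apply: in_span_sub => v /words_uptoP [l [sl lvs ->]].
by apply/words_uptoP; exists l; split=> //; apply: leq_trans nm.
Qed.

Lemma word_spanM vs n m u v :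
  word_span vs n u -> word_span vs m v -> word_span vs (n + m) (u * v).
Proof.
have sW := word_span_subspace vs (n + m) => nu mv.
apply: (in_span_preim (f := fun u => u * v) _ sW) nu; first exact/linear_mulr/(linearP idfun).
move=> _ /words_uptoP [l [sl lvs ->]].
apply: (in_span_preim (f := fun v => _ * v) _ sW) mv; first exact/linear_mull/(linearP idfun).
move=> _ /words_uptoP [l' [sl' lvs' ->]]; rewrite -big_cat; apply: word_span_prod.
  by move=> t; rewrite mem_cat => /orP [/lvs|/lvs'].
by rewrite size_cat leq_add.
Qed.

Lemma word_span1 vs n : word_span vs n 1.
Proof. by have := @word_span_prod vs n [::]; rewrite big_nil; apply. Qed.

Lemma word_span_gen vs u : in_span vs u -> word_span vs 1 u.
Proof.
apply: in_span_min; first exact: word_span_subspace.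
move=> v vvs; have := @word_span_prod vs 1 [:: v]; rewrite big_seq1; apply=> // t.
by rewrite inE => /eqP ->.
Qed.

Lemma word_span_mem vs u : u \in vs -> word_span vs 1 u.
Proof. by move=> uvs; apply/word_span_gen/in_span_mem. Qed.

Lemma word_spanX vs n u i : word_span vs n u -> word_span vs (i * n) (u ^+ i).
Proof.
move=> nu; elim: i => [|i IH]; first by rewrite expr0; apply: word_span1.
by rewrite exprS mulSn; apply: word_spanM.
Qed.

Lemma word_span_memX vs u i : u \in vs -> word_span vs i (u ^+ i).
Proof. by move=> uvs; rewrite -[i in word_span _ i]muln1; apply/word_spanX/word_span_mem. Qed.

Lemma word_span_stable vs (f : {lrmorphism B -> B}) n u :
  (forall v, in_span vs v -> in_span vs (f v)) -> word_span vs n u -> word_span vs n (f u).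
Proof.
move=> st; apply: in_span_preim; [exact: linearP|exact: word_span_subspace|].
move=> _ /words_uptoP [l [sl lvs ->]]; apply: (word_span_mono sl).
elim: l lvs {sl} => [|v l IH] lvs; first by rewrite big_nil rmorph1; apply: word_span1.
rewrite big_cons rmorphM /= -add1n; apply: word_spanM.
  by apply/word_span_gen/st/in_span_mem/lvs; rewrite mem_head.
by apply: IH => t tl; apply: lvs; rewrite inE tl orbT.
Qed.

End Words.

Definition growth_le (k : fieldType) (B : algType k) (e : nat) := forall vs : seq B,
  exists C : nat, forall n, (span_dim (words_upto vs n) <= C * n.+1 ^ e)%N.

Lemma leq_expn_base (m n e : nat) : (m <= n)%N -> (m ^ e <= n ^ e)%N.
Proof. by case: e => [|e] h; rewrite ?expn0 // leq_exp2r. Qed.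

(** * Algebraic elements over an integral domain *)

Lemma fractionP (R : idomainType) (x : {fraction R}) :
  exists p q : R, q != 0 /\ x = tofrac p / tofrac q.
Proof.
elim/quotW: x => r; exists r.1, r.2; split; first exact: denom_ratioP.
have d0 : tofrac r.2 != 0 by rewrite tofrac_eq0 denom_ratioP.
apply: (canRL (mulfK d0)); unlock FracField.tofrac.
rewrite -[LHS]FracField.pi_mul; apply/eqmodP.
rewrite /= FracField.equivfE /FracField.mulf !numden_Ratio ?mulf_neq0 ?oner_neq0 //.
- by rewrite !mulr1 mulrC.
- exact: denom_ratioP.
- exact: denom_ratioP.
Qed.

Lemma clear_denominators (R : idomainType) (P : {poly {fraction R}}) :
  exists2 c : R, c != 0 & exists Q : {poly R}, map_poly (@tofrac R) Q = tofrac c *: P.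
Proof.
have /choice [n /choice [m nmP]] := @fractionP R.
exists (\prod_(i < size P) m P`_i); first by apply/prodf_neq0 => i _; case: (nmP P`_i).
exists (\poly_(i < size P) (n P`_i * \prod_(l < size P | l != i :> nat) m P`_l)).
apply/polyP => i; rewrite coef_map coefZ coef_poly /=.
case: ltnP => [lt|ge]; last by rewrite nth_default // mulr0 tofrac0.
have [m0 xE] := nmP P`_i; rewrite [X in _ = _ * X]xE [in RHS](bigD1 (Ordinal lt)) //= !rmorphM /=.
by rewrite [RHS]mulrC mulrA divfK ?tofrac_eq0.
Qed.

Section AlgebraicElements.
Variables (R : idomainType) (F : fieldType) (f : {rmorphism R -> F}).
Hypothesis f_inj : injective f.
Implicit Types (p q : R) (u v : F).

Let f_eq0 p : (f p == 0) = (p == 0).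
Proof. exact: raddf_eq0. Qed.

Lemma fraction_extension :
  exists g : {rmorphism {fraction R} -> F}, forall p, g (tofrac p) = f p.
Proof.
have /choice [n /choice [m nmP]] := @fractionP R.
pose g x := f (n x) / f (m x).
have gE x p q : q != 0 -> x = tofrac p / tofrac q -> g x = f p / f q.
  have [m0 xE] := nmP x; move=> q0 xE'; move/eqP: (etrans (esym xE) xE').
  rewrite eqr_div ?tofrac_eq0 // -!tofracM tofrac_eq => /eqP e.
  by apply/eqP; rewrite eqr_div ?f_eq0 // -!rmorphM /= e.
have gp p : g (tofrac p) = f p.
  by rewrite (gE _ p 1) ?oner_neq0 // ?tofrac1 ?rmorph1 divr1.
have gB : zmod_morphism g.
  move=> x y; have [x0 xE] := nmP x; have [y0 yE] := nmP y.
  rewrite (gE (x - y) (n x * m y + - n y * m x) (m x * m y)) ?mulf_neq0 //.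
    by rewrite /g rmorphD !rmorphM rmorphN /= -addf_div ?f_eq0 // mulNr.
  rewrite [LHS](congr2 (fun a b => a - b) xE yE) tofracD !tofracM tofracN.
  by rewrite -addf_div ?tofrac_eq0 // mulNr.
have gM : monoid_morphism g.
  split=> [|x y]; first by rewrite -tofrac1 gp rmorph1.
  have [x0 xE] := nmP x; have [y0 yE] := nmP y.
  rewrite (gE (x * y) (n x * n y) (m x * m y)) ?mulf_neq0 //.
    by rewrite /g !rmorphM /= mulf_div.
  by rewrite [LHS](congr2 *%R xE yE) !tofracM mulf_div.
by have [h hE] := rmorphism_of gB gM; exists h => p; rewrite hE.
Qed.

Definition algebraic u := exists2 P : {poly R}, P != 0 & (map_poly f P).[u] = 0.

Lemma algebraic_algebraicOver (g : {rmorphism {fraction R} -> F}) u :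
  (forall p, g (tofrac p) = f p) -> algebraic u <-> algebraicOver g u.
Proof.
move=> gp; have mapE (Q : {poly R}) : map_poly f Q = map_poly g (map_poly (@tofrac R) Q).
  by rewrite -map_poly_comp; apply: eq_map_poly => p /=; rewrite gp.
have map_eq0 (Q : {poly R}) : (map_poly (@tofrac R) Q == 0) = (Q == 0).
  have [->|Q0] := eqVneq Q 0; first by rewrite rmorph0 eqxx.
  by rewrite map_poly_eq0_id0 ?(negbTE Q0) // tofrac_eq0 lead_coef_eq0.
split=> [[P P0 Pu]|[P P0 /rootP Pu]].
  by exists (map_poly (@tofrac R) P); rewrite ?map_eq0 // /root -mapE Pu.
have [c c0 [Q QE]] := clear_denominators P; exists Q.
  by rewrite -map_eq0 QE scaler_eq0 tofrac_eq0 (negbTE c0).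
by rewrite mapE QE map_polyZ hornerZ Pu mulr0.
Qed.

Lemma algebraic_const p : algebraic (f p).
Proof.
exists ('X - p%:P); first by rewrite polyXsubC_eq0.
by rewrite rmorphB /= map_polyX map_polyC hornerXsubC subrr.
Qed.

Lemma algebraicD u v : algebraic u -> algebraic v -> algebraic (u + v).
Proof.
have [g gp] := fraction_extension; rewrite !(algebraic_algebraicOver _ gp).
exact: algebraic_add.
Qed.

Lemma algebraicM u v : algebraic u -> algebraic v -> algebraic (u * v).
Proof.
have [g gp] := fraction_extension; rewrite !(algebraic_algebraicOver _ gp).
exact: algebraic_mul.
Qed.

Lemma algebraicV u : algebraic u -> algebraic u^-1.
Proof.
have [g gp] := fraction_extension; rewrite !(algebraic_algebraicOver _ gp).
exact: algebraic_inv.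
Qed.

Lemma algebraic_integral v : algebraic v ->
  exists q r (m : 'I_r -> R), [/\ q != 0, (0 < r)%N &
    (f q * v) ^+ r = \sum_(i < r) f (m i) * (f q * v) ^+ i].
Proof.
case=> P; rewrite -size_poly_eq0; case sP: (size P) => [|[|r]] // _ Pv.
  have := lead_coef_eq0 P; rewrite -size_poly_eq0 lead_coefE sP /= -f_eq0 -Pv.
  by rewrite [in (map_poly f P).[v]](@size1_polyC _ P) ?sP // map_polyC hornerC eqxx.
pose q := P`_r.+1; exists q, r.+1, (fun i => - (P`_i * q ^+ (r - i))); split=> //.
  by have := lead_coef_eq0 P; rewrite -size_poly_eq0 lead_coefE sP /= => ->.
have szm : (size (map_poly f P) <= r.+2)%N by rewrite -sP size_poly.
move: Pv; rewrite (horner_coef_wide _ szm) big_ord_recr /= coef_map /= -/q => /eqP.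
rewrite addrC addr_eq0 => /eqP qv.
rewrite [LHS]exprMn exprSr -mulrA qv mulrN mulr_sumr -sumrN.
apply: eq_bigr => i _; rewrite coef_map rmorphN rmorphM rmorphXn mulNr exprMn /=.
have -> : f q ^+ r = f q ^+ (r - i) * f q ^+ i by rewrite -exprD subnK // -ltnS.
by congr (- _); ring.
Qed.

Definition gen_module (T : finType) (e : T -> F) v :=
  exists m : T -> R, v = \sum_a f (m a) * e a.

Lemma gen_module_sum (T : finType) (e : T -> F) (J : Type) (r : seq J) (g : J -> F) :
  (forall i, gen_module e (g i)) -> gen_module e (\sum_(i <- r) g i).
Proof.
move=> h; apply: (big_ind (gen_module e)) => //.
  by exists (fun=> 0); rewrite big1 // => a _; rewrite raddf0 mul0r.
move=> _ _ [m ->] [n ->]; exists (fun a => m a + n a); rewrite -big_split.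
by apply: eq_bigr => a _; rewrite rmorphD mulrDl.
Qed.

Lemma gen_moduleZ (T : finType) (e : T -> F) p v :
  gen_module e v -> gen_module e (f p * v).
Proof.
move=> [m ->]; exists (fun a => p * m a); rewrite mulr_sumr.
by apply: eq_bigr => a _; rewrite rmorphM mulrA.
Qed.

Lemma gen_module_gen (T : finType) (e : T -> F) a : gen_module e (e a).
Proof.
exists (fun b => (b == a)%:R); rewrite (bigD1 a) //= eqxx rmorph1 mul1r big1 ?addr0 //.
by move=> b /negbTE ->; rewrite rmorph0 mul0r.
Qed.

Lemma algebraic_gen_module (vs : seq F) : {in vs, forall v, algebraic v} ->
  exists (T : finType) (e : T -> F) q, [/\ q != 0, gen_module e 1 &
    {in vs, forall v a, gen_module e (f q * v * e a)}].
Proof.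
elim: vs => [|v vs IH] alg.
  by exists unit, (fun=> 1), 1; split; rewrite ?oner_neq0 //; apply: (gen_module_gen _ tt).
case: IH => [w wvs|T [e [q [q0 e1 eM]]]]; first by apply: alg; rewrite inE wvs orbT.
have [q' [r [m [q'0 r0 wr]]]] := algebraic_integral (alg v (mem_head _ _)).
pose w := f q' * v; pose e' (x : T * 'I_r) := e x.1 * w ^+ x.2.
have lift x (i : 'I_r) : gen_module e x -> gen_module e' (x * w ^+ i).
  move=> [n ->]; rewrite mulr_suml; apply: gen_module_sum => a.
  by rewrite -mulrA; apply: gen_moduleZ; apply: (gen_module_gen e' (a, i)).
exists (T * 'I_r)%type, e', (q * q'); split; first by rewrite mulf_neq0.
  by have := lift 1 (Ordinal r0) e1; rewrite expr0 mulr1.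
move=> u; rewrite inE => /predU1P [->|uvs] [a i]; last first.
  have -> : f (q * q') * u * e' (a, i) = f q' * (f q * u * e a * w ^+ i).
    by rewrite rmorphM /e' /=; ring.
  by apply/gen_moduleZ/lift/eM.
have -> : f (q * q') * v * e' (a, i) = f q * (e a * w ^+ i.+1).
  by rewrite rmorphM /e' /= exprS /w; ring.
apply: gen_moduleZ; have [lt|ge] := ltnP i.+1 r.
  exact: (gen_module_gen e' (a, Ordinal lt)).
have -> : i.+1 = r by apply/eqP; rewrite eqn_leq ltn_ord.
rewrite wr mulr_sumr; apply: gen_module_sum => l; rewrite mulrCA.
by apply: gen_moduleZ; apply: (gen_module_gen e' (a, l)).
Qed.

End AlgebraicElements.

(** * Algebraic independence *)

Definition monomial (R : comNzRingType) (d : nat) (z : 'I_d -> R) (b : 'I_d -> nat) : R :=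
  \prod_(i < d) z i ^+ b i.

Lemma monomialD (R : comNzRingType) (d : nat) (z : 'I_d -> R) (b b' : 'I_d -> nat) :
  monomial z (fun i => b i + b' i)%N = monomial z b * monomial z b'.
Proof. by rewrite /monomial -big_split; apply: eq_bigr => i _; rewrite exprD. Qed.

Lemma monomialMn (R : comNzRingType) (d : nat) (z : 'I_d -> R) (b : 'I_d -> nat) n :
  monomial z (fun i => n * b i)%N = monomial z b ^+ n.
Proof. by rewrite /monomial -prodrXl; apply: eq_bigr => i _; rewrite mulnC exprM. Qed.

Module AlgebraicIndependence.
Import mpoly.

Section Valuation.
Variables (k F : fieldType) (kappa : {rmorphism k -> F}) (d : nat) (z : 'I_d -> F).
Implicit Types (p q : {mpoly k[d]}) (u v w : F).

Local Notation ev := (mmap kappa z).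

Definition alg_indep := injective ev.

Hypothesis indep : alg_indep.

Let ev_eq0 p : (ev p == 0) = (p == 0).
Proof. exact: raddf_eq0. Qed.

Definition lead_lt p q := p = 0 \/ (mlead p < mlead q)%O.

Definition frac_le u := exists p q,
  [/\ q != 0, (mlead p <= mlead q)%O & u = ev p / ev q].
Definition frac_lt u := exists p q, [/\ q != 0, lead_lt p q & u = ev p / ev q].

Lemma mpolyX_neq0 (m : 'X_{1..d}) : 'X_[k, m] != 0.
Proof. by rewrite -mleadc_eq0 mleadXm mcoeffX eqxx oner_eq0. Qed.

Lemma lead_le_lt p q : (mlead p <= mlead q)%O -> p@_(mlead q) = 0 -> lead_lt p q.
Proof.
move=> pq pq0; have [->|p0] := eqVneq p 0; [by left|right].
rewrite lt_neqAle pq andbT; apply: contra p0 => /eqP e.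
by rewrite -mleadc_eq0 e pq0.
Qed.

Lemma lead_ltM p q r : r != 0 -> lead_lt p q -> q != 0 -> lead_lt (p * r) (q * r).
Proof.
move=> r0 h q0; have [->|p0] := eqVneq p 0; first by left; rewrite mul0r.
case: h => [e|h]; first by rewrite e eqxx in p0.
by right; rewrite !mleadM // ltmc_add2l.
Qed.

Lemma lead_leM p q r : r != 0 -> (mlead p <= mlead q)%O -> q != 0 ->
  (mlead (p * r) <= mlead (q * r))%O.
Proof.
move=> r0 h q0; have [->|p0] := eqVneq p 0; first by rewrite mul0r mlead0 le0x.
by rewrite !mleadM // lem_add.
Qed.

Lemma lead_ltD p p' q : lead_lt p q -> lead_lt p' q -> lead_lt (p + p') q.
Proof.
move=> [->|h]; first by rewrite add0r.
case=> [->|h']; first by rewrite addr0; right.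
by right; apply: le_lt_trans (mleadD_le _ _) _; rewrite ltUx h.
Qed.

Lemma lead_le_ltM p q p' q' : q != 0 -> q' != 0 -> (mlead p <= mlead q)%O ->
  lead_lt p' q' -> lead_lt (p * p') (q * q').
Proof.
move=> q0 q'0 h [->|h']; [by left; rewrite mulr0|right].
apply: le_lt_trans (mleadM_le _ _) _; rewrite mleadM //.
by rewrite [(mlead p + _)%MM]addmC [(mlead q + _)%MM]addmC; apply: ltmc_le_add.
Qed.

Lemma ev_addf p q p' q' : q != 0 -> q' != 0 ->
  ev p / ev q + ev p' / ev q' = ev (p * q' + p' * q) / ev (q * q').
Proof. by move=> q0 q'0; rewrite addf_div ?ev_eq0 // rmorphD !rmorphM. Qed.

Lemma ev_mulf p q p' q' : (ev p / ev q) * (ev p' / ev q') = ev (p * p') / ev (q * q').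
Proof. by rewrite mulf_div !rmorphM. Qed.

Lemma frac_le_subring : subring frac_le.
Proof.
split.
- by exists 1, 1; rewrite oner_eq0 rmorph1 divr1.
- move=> _ _ [p [q [q0 h ->]]] [p' [q' [q'0 h' ->]]].
  exists (p * q' + (- p') * q), (q * q'); split; first by rewrite mulf_neq0.
    apply: le_trans (mleadD_le _ _) _; rewrite leUx lead_leM //=.
    by rewrite [q * q']mulrC lead_leM // mleadN.
  by rewrite -ev_addf // rmorphN mulNr.
- move=> _ _ [p [q [q0 h ->]]] [p' [q' [q'0 h' ->]]].
  exists (p * p'), (q * q'); split; rewrite ?ev_mulf ?mulf_neq0 //.
  by apply: le_trans (mleadM_le _ _) _; rewrite mleadM // lem_add.
Qed.

Lemma frac_ltD u v : frac_lt u -> frac_lt v -> frac_lt (u + v).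
Proof.
move=> [p [q [q0 h ->]]] [p' [q' [q'0 h' ->]]].
exists (p * q' + p' * q), (q * q'); split; rewrite ?ev_addf ?mulf_neq0 //.
by apply: lead_ltD; [|rewrite [q * q']mulrC]; apply: lead_ltM.
Qed.

Lemma frac_lt_not1 : ~ frac_lt 1.
Proof.
move=> [p [q [q0 h pq]]]; have {pq} pq : p = q.
  by apply: indep; rewrite -[RHS]mul1r pq divfK ?ev_eq0.
by case: h => [p0|]; [rewrite -pq p0 eqxx in q0|rewrite pq ltxx].
Qed.

Lemma frac_proper : proper_ideal_in frac_le frac_lt.
Proof.
split; [exact: frac_le_subring| |split=> [|]; first exact: frac_ltD| |exact: frac_lt_not1].
- move=> _ [p [q [q0 h ->]]]; exists p, q; split=> //.
  by case: h => [->|/ltW//]; rewrite mlead0 le0x.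
- by exists 0, 1; rewrite oner_eq0 mmap0 mul0r; split=> //; left.
- move=> _ _ [p [q [q0 h ->]]] [p' [q' [q'0 h' ->]]].
  by exists (p * p'), (q * q'); split; rewrite ?ev_mulf ?mulf_neq0 //; apply: lead_le_ltM.
Qed.

Lemma frac_le_const c : frac_le (kappa c).
Proof.
exists c%:MP, 1; rewrite oner_neq0 mmapC rmorph1 divr1; split=> //.
by rewrite mleadC mlead1.
Qed.

Lemma monomialE (b : 'I_d -> nat) : monomial z b = ev 'X_[[multinom b i | i < d]].
Proof. by rewrite mmapX; apply: eq_bigr => i _; rewrite mnmE. Qed.

Lemma frac_lt_monomial (b b' : 'I_d -> nat) : b <> b' ->
  frac_lt (monomial z b / monomial z b') \/ frac_lt (monomial z b' / monomial z b).
Proof.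
move=> ne; rewrite !monomialE; set m := [multinom b i | i < d].
set m' := [multinom b' i | i < d].
have : m != m'.
  apply/eqP => e; apply: ne; apply/funext => i.
  by have := congr1 (fun m : 'X_{1..d} => m i) e; rewrite !mnmE.
by rewrite neq_lt => /orP [] lt; [left; exists 'X_[m], 'X_[m']|right; exists 'X_[m'], 'X_[m]];
  rewrite mpolyX_neq0; split=> //; right; rewrite !mleadXm.
Qed.

(* The coefficients at the largest leading monomial of a relation [sum_j P_j(z) u^j = 0]
   form a relation over [k] modulo the maximal ideal. *)
Lemma algebraic_residue_relation (O : F -> Prop) (P : {poly {mpoly k[d]}}) u :
  valuation_ring O -> (forall v, frac_lt v -> max_ideal O v) ->
  P != 0 -> (map_poly ev P).[u] = 0 -> O u ->
  exists p : {poly k}, [/\ (size p <= size P)%N, p != 0 & max_ideal O (map_poly kappa p).[u]].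
Proof.
move=> vO ltO P0 Pu Ou.
have lt0 : ((size P).-1 < size P)%N by rewrite ltn_predL lt0n size_poly_eq0.
have lc0 : P`_(Ordinal lt0) != 0 by rewrite /= -lead_coefE lead_coef_eq0.
have [i0 Pi0 max] := arg_maxP (P := fun i : 'I_(size P) => P`_i != 0)
  (fun i : 'I_(size P) => mlead P`_i) lc0.
pose M := mlead P`_i0; pose c i := (P`_i)@_M; exists (\poly_(i < size P) c i).
split; first exact: size_poly.
  apply: contraNneq Pi0 => p0; rewrite -mleadc_eq0 -[X in X == 0]/(c i0).
  by have := coef_poly (size P) c i0; rewrite p0 coef0 ltn_ord => <-.
have evM0 : ev 'X_[M] != 0 by rewrite ev_eq0 mpolyX_neq0.
have -> : (map_poly kappa (\poly_(i < size P) c i)).[u] =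
    - \sum_(i < size P) u ^+ i * (ev (P`_i - c i *: 'X_[M]) / ev 'X_[M]).
  rewrite (horner_coef_wide _ (leq_trans (size_poly _ _) (size_poly _ _))).
  under [in RHS]eq_bigr do rewrite rmorphB /= mmapZ mulrBl mulfK // mulrBr mulrA.
  rewrite sumrB opprB -mulr_suml.
  under [X in _ = _ - X / _]eq_bigr do rewrite mulrC -coef_map.
  rewrite -(horner_coef_wide _ (size_poly _ _)) Pu mul0r subr0.
  by apply: eq_bigr => i _; rewrite coef_map coef_poly ltn_ord mulrC.
apply/(max_idealN vO)/(max_ideal_sum vO) => i _; apply: (max_idealM vO).
  by apply: subringX; case: vO.
apply: ltO; exists (P`_i - c i *: 'X_[M]), 'X_[M]; split; rewrite ?mpolyX_neq0 //.
apply: lead_le_lt; rewrite mleadXm; last first.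
  by rewrite mcoeffB mcoeffZ mcoeffX eqxx mulr1 subrr.
apply: le_trans (mleadB_le _ _) _; rewrite leUx; apply/andP; split.
  by have [->|n0] := eqVneq P`_i 0; [rewrite mlead0 le0x|apply: max].
by apply: le_trans (mleadZ_le _ _) _; rewrite mleadXm.
Qed.

Lemma monomial_neq0 (b : 'I_d -> nat) : monomial z b != 0.
Proof. by rewrite monomialE ev_eq0 mpolyX_neq0. Qed.

Definition split_algebraic u := exists P : {poly {mpoly k[d]}},
  [/\ P != 0, (map_poly ev P).[u] = 0 &
      forall p : {poly k}, (size p <= size P)%N -> splits p].

Theorem monomial_valuation : (forall u, split_algebraic u) -> exists O,
  [/\ valuation_ring O, coefficient_field kappa O & distinct_values O (monomial z)].
Proof.
move=> alg; have [O [vO leO ltO']] := chevalley frac_proper.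
have ltO v : frac_lt v -> max_ideal O v.
  by have [->|v0] := eqVneq v 0; [left|right; apply: ltO'].
have cO c : O (kappa c) by apply/leO/frac_le_const.
exists O; split=> //.
  split=> // u Ou; have [P [P0 Pu spl]] := alg u.
  have [p [sp p0]] := algebraic_residue_relation vO ltO P0 Pu Ou.
  apply: splits_root_prime (spl p sp) p0 => [c|v w]; last exact: max_ideal_prime.
  by case=> [/eqP|]; [rewrite fmorph_eq0 => /eqP|rewrite -fmorphV].
split=> [|b b' bb']; first exact: monomial_neq0.
apply: contrapT => ne; case: (frac_lt_monomial ne) => /ltO.
  by move/max_ideal_not_val_eq; apply=> //; apply: monomial_neq0.
move/max_ideal_not_val_eq; apply; [exact: monomial_neq0..|exact: val_eq_sym].
Qed.

End Valuation.

Section Growth.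
Variables (k F : fieldType) (kappa : {rmorphism k -> F}) (d : nat) (z : 'I_d -> F).
Implicit Types (p q : {mpoly k[d]}) (u v w : F).
Local Notation ev := (mmap kappa z).

Lemma msizeM_leq p q (s t : nat) : (msize p <= s.+1)%N -> (msize q <= t.+1)%N ->
  (msize (p * q) <= (s + t).+1)%N.
Proof.
have [->|p0] := eqVneq p 0; first by rewrite mul0r msize0.
have [->|q0] := eqVneq q 0; first by rewrite mulr0 msize0.
rewrite msizeM // => h1 h2; have := leq_add h1 h2.
by rewrite addSn addnS; case: (_ + _)%N.
Qed.

Definition bounded_module (T : finType) (e : T -> F) (s : nat) v :=
  exists2 M : T -> {mpoly k[d]}, (forall a, msize (M a) <= s.+1)%N &
    v = \sum_a ev (M a) * e a.

Lemma bounded_moduleW (T : finType) (e : T -> F) (s t : nat) v : (s <= t)%N ->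
  bounded_module e s v -> bounded_module e t v.
Proof. by move=> st [M Ms ->]; exists M => // a; apply: leq_trans (Ms a) _. Qed.

Lemma gen_module_bounded (T : finType) (e : T -> F) v :
  gen_module ev e v -> exists s, bounded_module e s v.
Proof.
move=> [M ->]; exists (\max_a msize (M a)), M => // a.
by rewrite ltnW // ltnS; apply: leq_bigmax.
Qed.

Lemma bounded_moduleM (T : finType) (e : T -> F) v (s t : nat) u :
  (forall a, bounded_module e s (v * e a)) -> bounded_module e t u ->
  bounded_module e (t + s) (v * u).
Proof.
move=> hv [M Mt ->].
have /choice [N NP] : forall a, exists N : T -> {mpoly k[d]},
    (forall b, msize (N b) <= s.+1)%N /\ v * e a = \sum_b ev (N b) * e b.
  by move=> a; have [N] := hv a; exists N.
exists (fun b => \sum_a M a * N a b).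
  move=> b; apply: leq_trans (msize_sum _ _ _) _.
  apply/bigmax_leqP => a _; apply: msizeM_leq; [exact: Mt|by case: (NP a)].
rewrite mulr_sumr.
under eq_bigr => a _ do [rewrite mulrCA (proj2 (NP a)) mulr_sumr].
rewrite exchange_big; apply: eq_bigr => b _; rewrite rmorph_sum mulr_suml.
by apply: eq_bigr => a _; rewrite rmorphM mulrA.
Qed.

Lemma bounded_module_prod (T : finType) (e : T -> F) (q : F) (s E : nat) (vs l : seq F) :
  bounded_module e s 1 -> {in vs, forall v a, bounded_module e E (q * v * e a)} ->
  {subset l <= vs} -> bounded_module e (s + E * size l) (q ^+ size l * \prod_(v <- l) v).
Proof.
move=> e1 eE; elim: l => [|v l IH] lvs; first by rewrite big_nil mulr1 expr0 muln0 addn0.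
rewrite big_cons exprS mulrACA /= mulnSr addnA; apply: bounded_moduleM.
  by apply/eE/lvs/mem_head.
by apply: IH => w wl; apply: lvs; rewrite inE wl orbT.
Qed.

Lemma card_bmultinom (s : nat) : (#|{: 'X_{1..d < s.+1}}| <= s.+1 ^ d)%N.
Proof.
have -> : (s.+1 ^ d = #|{ffun 'I_d -> 'I_s.+1}|)%N by rewrite card_ffun !card_ord.
apply: (@leq_card _ _ (fun m : 'X_{1..d < s.+1} => [ffun i => inord (m i)])).
move=> m m' /ffunP e; apply/val_inj/mnmP => i.
have le (x : 'X_{1..d < s.+1}) : (bmnm x i < s.+1)%N.
  by apply: leq_ltn_trans (bmdeg x); rewrite mdegE (bigD1 i) //= leq_addr.
by have := congr1 (@nat_of_ord _) (e i); rewrite !ffunE !inordK.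
Qed.

Lemma bounded_module_monomials (T : finType) (e : T -> F) s v : bounded_module e s v ->
  exists c : 'X_{1..d < s.+1} * T -> k, v = \sum_x kappa (c x) * (ev 'X_[bmnm x.1] * e x.2).
Proof.
move=> [M Ms ->]; exists (fun x => (M x.2)@_(bmnm x.1)).
rewrite -(pair_bigA _ (fun m a => kappa (M a)@_(bmnm m) * (ev 'X_[m] * e a))) /=.
rewrite exchange_big; apply: eq_bigr => a _.
rewrite {1}(mpolywE (Ms a)) rmorph_sum mulr_suml; apply: eq_bigr => m _.
by rewrite /= mmapZ mulrA.
Qed.

Hypothesis indep : alg_indep kappa z.

Lemma algebraic_bounded_module (vs : seq F) : {in vs, forall v, algebraic ev v} ->
  exists (T : finType) (e : T -> F) q s E, [/\ q != 0, bounded_module e s 1 &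
    {in vs, forall v a, bounded_module e E (ev q * v * e a)}].
Proof.
move=> /(algebraic_gen_module indep) [T [e [q [q0 e1 eM]]]].
have [s e1s] := gen_module_bounded e1.
have [||E EP] := @nat_bound _
    (fun x m => bounded_module e m (ev q * x.1 * e x.2)) [seq (v, a) | v <- vs, a <- enum T].
- by move=> x m n; apply: bounded_moduleW.
- by move=> _ /allpairsP [[v a] /= [vvs _ ->]]; apply/gen_module_bounded/eM.
exists T, e, q, s, E; split=> // v vvs a; apply: (EP (v, a)).
by apply/allpairsP; exists (v, a); rewrite mem_enum.
Qed.

Theorem algebraic_growth_le (D : algType k) (j : {rmorphism D -> F}) : injective j ->
  (forall c (u : D), j (c *: u) = kappa c * j u) -> (forall u : D, algebraic ev (j u)) ->
  growth_le D d.
Proof.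
move=> j_inj jZ alg us; pose vs := 1 :: map j us.
have [|T [e [q [s [E [q0 e1 eE]]]]]] := @algebraic_bounded_module vs.
  by move=> v; rewrite inE => /predU1P [->|/mapP [u _ ->]] //; rewrite -(rmorph1 j).
have evq n : ev q ^+ n != 0 by rewrite expf_neq0 // raddf_eq0.
exists ((s + E).+1 ^ d * #|T|)%N => N; pose S := (s + E * N)%N.
apply: (@leq_trans #|{: 'X_{1..d < S.+1} * T}|); last first.
  rewrite card_prod mulnAC leq_mul2r; apply/orP; right.
  apply: leq_trans (card_bmultinom _) _; rewrite -expnMn; apply: leq_expn_base.
  by rewrite /S; nia.
have [b [fb <- bs _]] := span_dim_basis (words_upto us N); rewrite -[size b]card_ord.
pose g (x : 'X_{1..d < S.+1} * T) := ev 'X_[bmnm x.1] * e x.2 / ev q ^+ N.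
suff bE (i : 'I_(size b)) : exists c, j b`_i = \sum_x kappa (c x) * g x.
  exact: (@steinitz_semilinear k D F F^o kappa j _ _ (fun i : 'I_(size b) => b`_i) g).
have /words_uptoP [l [sl lus ->]] := bs _ (mem_nth 0 (ltn_ord i)).
pose l' := map j l ++ nseq (N - size l) 1.
have sl' : size l' = N by rewrite size_cat size_map size_nseq subnKC.
have [|c cE] := @bounded_module_monomials _ _ _ _ (bounded_module_prod (l := l') e1 eE _).
  move=> v; rewrite mem_cat inE mem_nseq => /orP [/mapP [u ul ->]|/andP [_ ->//]].
  by rewrite map_f ?orbT // lus.
rewrite sl' in c cE; exists c; apply: (mulfI (evq N)).
have -> : j (\prod_(v <- l) v) = \prod_(v <- l') v.
  by rewrite rmorph_prod big_cat big_map big_nseq iter_mulr_1 expr1n /= mulr1.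
rewrite cE mulr_sumr; apply: eq_bigr => x _.
by rewrite [RHS]mulrCA /g [ev q ^+ N * _]mulrC divfK.
Qed.

End Growth.

Section TranscendenceBasis.
Local Notation widen := (widen_ord (leqnSn _)).
Variables (k F : fieldType) (kappa : {rmorphism k -> F}).

Lemma insert_at_widen (T : Type) n (u : T) (f : 'I_n -> T) i :
  insert_at ord_max u f (widen i) = f i.
Proof.
have -> : widen i = lift ord_max i by apply: ord_inj; rewrite lift_max.
by rewrite /insert_at liftK.
Qed.

Lemma muni_inj (d : nat) : injective (@muni d k).
Proof.
apply: raddf_inj => p p0; apply/mpolyP => m; rewrite mcoeff0.
pose res (m : 'X_{1..d.+1}) := [multinom (m (widen i)) | i < d].
have := congr1 (fun P : {poly {mpoly k[d]}} => P`_(m ord_max)@_(res m)) p0.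
rewrite /= muniE coef_sum raddf_sum coef0 mcoeff0 /= => <-.
have E m' : (p@_m' *: 'X_[res m'] *: 'X^(m' ord_max) : {poly {mpoly k[d]}})`_(m ord_max)@_(res m)
    = p@_m' * (m' == m)%:R.
  rewrite coefZ coefXn; case: (eqVneq m' m) => [->|ne].
    by rewrite eqxx mulr1 mcoeffZ mcoeffX eqxx.
  rewrite mulr0; case: eqP => [e|_]; last by rewrite mulr0 mcoeff0.
  rewrite mulr1 mcoeffZ mcoeffX; case: eqP => [e'|_]; last by rewrite mulr0.
  case/eqP: ne; apply/mnmP => i; case: (unliftP ord_max i) => [l ->|->//].
  have -> : lift ord_max l = widen l by apply: ord_inj; rewrite lift_max.
  by have := congr1 (fun m : 'X_{1..d} => m l) e'; rewrite !mnmE.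
under eq_bigr do rewrite E.
have [mp|mp] := boolP (m \in msupp p).
  rewrite (bigD1_seq m) ?msupp_uniq //= eqxx mulr1 big1 ?addr0 // => i /negbTE ->.
  by rewrite mulr0.
rewrite (memN_msupp_eq0 mp) big_seq big1 // => i ip; case: eqP => [e|]; rewrite ?mulr0 //.
by rewrite -e ip in mp.
Qed.

Lemma muni_eval (d : nat) (z : 'I_d -> F) g (p : {mpoly k[d.+1]}) :
  (map_poly (mmap kappa z) (muni p)).[g] = mmap kappa (insert_at ord_max g z) p.
Proof.
rewrite muniE rmorph_sum horner_sum; apply: eq_bigr => m _ /=.
rewrite map_polyZ map_polyXn hornerZ hornerXn /= mmapZ mmapX -mulrA; congr (_ * _).
rewrite /mmap1 big_ord_recr /=; congr (_ * _); last by rewrite /insert_at unlift_none.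
by apply: eq_bigr => i _; rewrite mnmE insert_at_widen.
Qed.

Lemma alg_indep_inj (d : nat) (z : 'I_d -> F) : alg_indep kappa z -> injective z.
Proof.
move=> ind i l e; have /ind : mmap kappa z 'X_i = mmap kappa z 'X_l.
  by rewrite !mmapX !mmap1U.
move=> /(congr1 (@mlead _ _)); rewrite !mleadXm => /(congr1 (fun m : 'X_{1..d} => m i)).
by rewrite !mnm1E eqxx; case: eqP.
Qed.

Lemma alg_indep0 (z : 'I_0 -> F) : alg_indep kappa z.
Proof.
apply: raddf_inj => p; rewrite (_ : p = (p@_0)%:MP).
  by rewrite /= mmapC => /eqP; rewrite fmorph_eq0 => /eqP ->; rewrite mpolyC0.
apply/mpolyP => m; rewrite mcoeffC; have -> : m = 0%MM by apply/mnmP => -[].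
by rewrite eqxx mulr1.
Qed.

Lemma alg_indep_insert (d : nat) (z : 'I_d -> F) g :
  alg_indep kappa z -> ~ algebraic (mmap kappa z) g ->
  alg_indep kappa (insert_at ord_max g z).
Proof.
move=> ind nalg; apply: raddf_inj => p p0; apply: muni_inj; rewrite raddf0.
by apply: contrapT => /eqP nz; apply: nalg; exists (muni p); rewrite ?muni_eval.
Qed.

Theorem transcendence_basis (gs : seq F) : exists (d : nat) (z : 'I_d -> F),
  [/\ alg_indep kappa z, forall i, z i \in gs &
      {in gs, forall g, algebraic (mmap kappa z) g}].
Proof.
pose Q d := `[< exists z : 'I_d -> F, alg_indep kappa z /\ forall i, z i \in gs >].
have Q0 : exists d, Q d.
  by exists 0%N; apply/asboolP; exists (fun=> 0); split=> [|[]//]; apply: alg_indep0.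
have bnd d : Q d -> (d <= size gs)%N.
  move=> /asboolP [z [ind zgs]]; rewrite -(size_enum_ord d) -(size_map z).
  apply: uniq_leq_size; first by rewrite (map_inj_uniq (alg_indep_inj ind)) enum_uniq.
  by move=> _ /mapP [i _ ->].
case: (ex_maxnP Q0 bnd) => d /asboolP [z [ind zgs]] max.
exists d, z; split=> // g ggs; apply: contrapT => /(alg_indep_insert ind) indg.
suff /max : Q d.+1 by rewrite ltnn.
apply/asboolP; exists (insert_at ord_max g z); split=> // i.
by rewrite /insert_at; case: unlift => /=.
Qed.

End TranscendenceBasis.
End AlgebraicIndependence.

(** * Linear endomorphisms as an algebra *)

Section Endomorphisms.
Variables (k : fieldType) (V : lmodType k) (v0 : V).

(* The nonzero vector makes the algebra of endomorphisms a nontrivial ring. *)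
Record endo (nz : v0 != 0) := Endo { endo_fun :> V -> V; endo_linear : linear endo_fun }.

Variable nz : v0 != 0.
Notation E := (endo nz).
Implicit Types f g h : E.

Lemma endoP f g : f =1 g -> f = g.
Proof.
case: f g => [f fl] [g gl] /= /funext e; move: fl gl; rewrite e => fl gl.
by congr Endo; apply: Prop_irrelevance.
Qed.

HB.instance Definition _ := gen_eqMixin E.
HB.instance Definition _ := gen_choiceMixin E.

HB.instance Definition _ f := GRing.isLinear.Build k V V *:%R f (endo_linear f).

Definition endo_add f g : E.
Proof.
by exists (fun v => f v + g v) => c u v; rewrite !endo_linear scalerDr addrACA.
Defined.
Definition endo_opp f : E.
Proof. by exists (fun v => - f v) => c u v; rewrite endo_linear opprD scalerN. Defined.
Definition endo_zero : E.
Proof. by exists (fun=> 0) => c u v; rewrite scaler0 addr0. Defined.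
Definition endo_one : E.
Proof. by exists id. Defined.
Definition endo_mul f g : E.
Proof. by exists (fun v => f (g v)) => c u v; rewrite !endo_linear. Defined.
Definition endo_scale (c : k) f : E.
Proof.
by exists (fun v => c *: f v) => c' u v; rewrite endo_linear scalerDr !scalerA mulrC.
Defined.

Lemma endo_addA : associative endo_add.
Proof. by move=> f g h; apply: endoP => v /=; rewrite addrA. Qed.
Lemma endo_addC : commutative endo_add.
Proof. by move=> f g; apply: endoP => v /=; rewrite addrC. Qed.
Lemma endo_add0 : left_id endo_zero endo_add.
Proof. by move=> f; apply: endoP => v /=; rewrite add0r. Qed.
Lemma endo_addN : left_inverse endo_zero endo_opp endo_add.
Proof. by move=> f; apply: endoP => v /=; rewrite addNr. Qed.
HB.instance Definition _ := GRing.isZmodule.Build E endo_addA endo_addC endo_add0 endo_addN.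

Lemma endo_mulA : associative endo_mul.
Proof. by move=> f g h; apply: endoP. Qed.
Lemma endo_mul1 : left_id endo_one endo_mul.
Proof. by move=> f; apply: endoP. Qed.
Lemma endo_mulr1 : right_id endo_one endo_mul.
Proof. by move=> f; apply: endoP. Qed.
Lemma endo_mulDl : left_distributive endo_mul endo_add.
Proof. by move=> f g h; apply: endoP. Qed.
Lemma endo_mulDr : right_distributive endo_mul endo_add.
Proof. by move=> f g h; apply: endoP => v /=; rewrite raddfD. Qed.
Lemma endo_one_neq0 : endo_one != 0.
Proof. by apply: contra_neq nz => /(congr1 (fun f : E => f v0)). Qed.
HB.instance Definition _ := GRing.Zmodule_isNzRing.Build E endo_mulA endo_mul1 endo_mulr1
  endo_mulDl endo_mulDr endo_one_neq0.

Lemma endo_scaleA c c' f : endo_scale c (endo_scale c' f) = endo_scale (c * c') f.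
Proof. by apply: endoP => v /=; rewrite scalerA. Qed.
Lemma endo_scale1 : left_id 1 endo_scale.
Proof. by move=> f; apply: endoP => v /=; rewrite scale1r. Qed.
Lemma endo_scaleDr : right_distributive endo_scale +%R.
Proof. by move=> c f g; apply: endoP => v /=; rewrite scalerDr. Qed.
Lemma endo_scaleDl f : {morph endo_scale^~ f : c c' / c + c'}.
Proof. by move=> c c'; apply: endoP => v /=; rewrite scalerDl. Qed.
HB.instance Definition _ := GRing.Zmodule_isLmodule.Build k E endo_scaleA endo_scale1
  endo_scaleDr endo_scaleDl.

Lemma endo_scaleAl c f g : c *: (f * g) = (c *: f) * g.
Proof. exact: endoP. Qed.
HB.instance Definition _ := GRing.Lmodule_isLalgebra.Build k E endo_scaleAl.
Lemma endo_scaleAr c f g : c *: (f * g) = f * (c *: g).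
Proof. by apply: endoP => v /=; rewrite linearZ. Qed.
HB.instance Definition _ := GRing.Lalgebra_isAlgebra.Build k E endo_scaleAr.

Lemma endo_expE f n v : (f ^+ n) v = iter n f v.
Proof. by elim: n v => [|n IH] v; rewrite ?exprS //= -IH. Qed.

End Endomorphisms.

(** * Generalized Weyl algebras *)

Section GWAInduction.
Variables (k : fieldType) (A : algType k) (S : A -> Prop).
Hypothesis sS : subspace S.
Hypothesis S1 : S 1.
Hypothesis SM : forall u v, S u -> S v -> S (u * v).

Definition subalg_pred : {pred A} := fun u => `[< S u >].

Lemma subalg_pred_closed : subalg_closed subalg_pred.
Proof.
split; first exact/asboolP.
- by move=> c u v /asboolP Su /asboolP Sv; apply/asboolP; case: sS => _; apply.
- by move=> u v /asboolP Su /asboolP Sv; apply/asboolP/SM.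
Qed.

HB.instance Definition _ := GRing.isSubalgClosed.Build k A subalg_pred subalg_pred_closed.

Record subalg := SubAlg { subalg_val :> A; _ : subalg_val \in subalg_pred }.
HB.instance Definition _ := [isSub for subalg_val].
HB.instance Definition _ := [Choice of subalg by <:].
HB.instance Definition _ := [SubChoice_isSubAlgebra of subalg by <:].

Lemma GWA_ind (D : algType k) (sigma : D -> D) (a : D) (iota : {lrmorphism D -> A}) (x y : A) :
  is_GWA sigma a iota x y -> (forall d, S (iota d)) -> S x -> S y -> forall u, S u.
Proof.
move=> [rel univ] Si Sx Sy.
pose in_sub (u : A) (Su : S u) : subalg := SubAlg (asboolT Su : u \in subalg_pred).
have [f fE] : exists f : {lrmorphism D -> subalg}, f =1 (fun d => in_sub _ (Si d)).
  apply: lrmorphism_of; last split.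
  - by move=> c u v; apply: val_inj; rewrite /= linearP.
  - by apply: val_inj; rewrite /= rmorph1.
  - by move=> u v; apply: val_inj; rewrite /= rmorphM.
have relf : GWA_relations sigma a f (in_sub _ Sx) (in_sub _ Sy).
  case: rel => r1 r2 r3 r4; split=> [d|e||]; apply: val_inj; rewrite /= !fE /=.
  - exact: r1.
  - exact: r2.
  - exact: r3.
  - exact: r4.
have [g [gi gx gy _]] := univ _ _ _ _ relf.
have [h [_ _ _ hE]] := univ _ _ _ _ rel.
move=> u; have -> : u = val (g u); last by case: (g u) => w /= /asboolP.
have [g' g'E] : exists g' : {lrmorphism A -> A}, g' =1 (fun u => val (g u)).
  by apply: lrmorphism_of => [c v w|]; last split=> [|v w]; rewrite ?linearP ?rmorph1 ?rmorphM.
have -> : val (g u) = h u.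
  by rewrite -g'E; apply: hE => [d||]; rewrite g'E ?gi ?gx ?gy ?fE.
by have /= <- := hE idfun.
Qed.

End GWAInduction.

Lemma inverse_automorphism (k : fieldType) (D : algType k) (sigma : {lrmorphism D -> D}) :
  is_alg_automorphism sigma ->
  exists tau : {lrmorphism D -> D}, cancel sigma tau /\ cancel tau sigma.
Proof.
case=> tau sK tK; have [|t tE] := @lrmorphism_of k D D tau (can2_linear sK tK).
  exact: can2_monoid_morphism sK tK.
by exists t; split=> d; rewrite tE.
Qed.

Section DegreeFiltration.
Variables (k : fieldType) (D A : algType k) (iota : {lrmorphism D -> A}).
Implicit Types (S : D -> Prop) (x y u : A).

Definition degree_le x y S (g : nat) u := exists c c' : nat -> D,
  [/\ forall i, S (c i), forall i, S (c' i) &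
      u = \sum_(i < g.+1) iota (c i) * x ^+ i + \sum_(i < g.+1) iota (c' i) * y ^+ i].

Lemma degree_le_sym x y S g u : degree_le x y S g u -> degree_le y x S g u.
Proof. by move=> [c [c' [Sc Sc' ->]]]; exists c', c; rewrite addrC. Qed.

Lemma degree_le_subspace x y S g : subspace S -> subspace (degree_le x y S g).
Proof.
move=> [S0 SL]; split.
  exists (fun=> 0), (fun=> 0); split=> //.
  by rewrite !big1 ?addr0 // => i _; rewrite raddf0 mul0r.
move=> c _ _ [e [e' [Se Se' ->]]] [f [f' [Sf Sf' ->]]].
exists (fun i => c *: e i + f i), (fun i => c *: e' i + f' i); split; auto.
rewrite scalerDr addrACA !scaler_sumr -!big_split /=.
by apply: eq_bigr => i _; rewrite !linearP !mulrDl !scalerAl.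
Qed.

Lemma degree_le_x x y S g i d : subspace S -> S d -> (i <= g)%N ->
  degree_le x y S g (iota d * x ^+ i).
Proof.
move=> [S0 _] Sd ig; exists (fun l => if l == i then d else 0), (fun=> 0); split=> //.
  by move=> l; case: eqP.
rewrite [X in _ + X]big1 ?addr0; last by move=> l _; rewrite raddf0 mul0r.
rewrite (bigD1 (Ordinal (ig : (i < g.+1)%N))) //= eqxx big1 ?addr0 // => l ne.
by rewrite -val_eqE /= in ne; rewrite (negbTE ne) raddf0 mul0r.
Qed.

Lemma degree_le_y x y S g i d : subspace S -> S d -> (i <= g)%N ->
  degree_le x y S g (iota d * y ^+ i).
Proof. by move=> sS Sd ig; apply/degree_le_sym/degree_le_x. Qed.

Lemma degree_le_ind x y S g (T : A -> Prop) u : subspace T ->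
  (forall d i, S d -> (i <= g)%N -> T (iota d * x ^+ i)) ->
  (forall d i, S d -> (i <= g)%N -> T (iota d * y ^+ i)) -> degree_le x y S g u -> T u.
Proof.
move=> sT Tx Ty [c [c' [Sc Sc' ->]]]; apply: subspaceD => //.
  by apply: subspace_sum => // i _; apply: Tx; rewrite // -ltnS.
by apply: subspace_sum => // i _; apply: Ty; rewrite // -ltnS.
Qed.

Lemma degree_leW x y S S' g g' u : subspace S' -> (forall d, S d -> S' d) ->
  (g <= g')%N -> degree_le x y S g u -> degree_le x y S' g' u.
Proof.
move=> sS' SS gg; apply: degree_le_ind; first exact: degree_le_subspace.
  by move=> d i Sd ig; apply: degree_le_x; [|apply: SS|apply: leq_trans gg].
by move=> d i Sd ig; apply: degree_le_y; [|apply: SS|apply: leq_trans gg].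
Qed.

Definition has_normal_form x y u := exists g, degree_le x y (fun=> True) g u.

Let subspaceT : subspace (fun _ : D => True). Proof. by []. Qed.

Lemma has_normal_form_sym x y u : has_normal_form x y u -> has_normal_form y x u.
Proof. by case=> g /degree_le_sym; exists g. Qed.

Lemma has_normal_form_subspace x y : subspace (has_normal_form x y).
Proof.
split; first by exists 0%N; case: (degree_le_subspace x y 0 subspaceT).
move=> c v w [g gv] [g' gw]; exists (maxn g g').
case: (degree_le_subspace x y (maxn g g') subspaceT) => _; apply.
  by apply: degree_leW gv; rewrite ?leq_maxl.
by apply: degree_leW gw; rewrite ?leq_maxr.
Qed.

Lemma has_normal_form_x x y d i : has_normal_form x y (iota d * x ^+ i).
Proof. by exists i; apply: degree_le_x. Qed.

Lemma has_normal_form_y x y d i : has_normal_form x y (iota d * y ^+ i).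
Proof. exact/has_normal_form_sym/has_normal_form_x. Qed.

Lemma has_normal_form_preim x y (f : A -> A) u : linear f ->
  (forall d i, has_normal_form x y (f (iota d * x ^+ i))) ->
  (forall d i, has_normal_form x y (f (iota d * y ^+ i))) ->
  has_normal_form x y u -> has_normal_form x y (f u).
Proof.
move=> fL fx fy [g]; apply: (degree_le_ind (T := fun u => has_normal_form x y (f u))) => //.
exact/subspace_preim/has_normal_form_subspace.
Qed.

End DegreeFiltration.

Section GWASymmetry.
Variables (k : fieldType) (D : algType k) (sigma tau : {lrmorphism D -> D}) (a : D).
Hypotheses (sK : cancel sigma tau) (tK : cancel tau sigma).

Lemma GWA_relations_sym (B : algType k) (f : D -> B) (X Y : B) :
  GWA_relations sigma a f X Y -> GWA_relations tau (sigma a) f Y X.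
Proof.
case=> r1 r2 r3 r4; split=> [d|e||]; rewrite ?sK //; first by rewrite -{1}(tK d) r2.
by rewrite r1 tK.
Qed.

End GWASymmetry.

Section GWA.
Variables (k : fieldType) (D A : algType k) (sigma tau : {lrmorphism D -> D}) (a : D).
Variables (iota : {lrmorphism D -> A}) (x y : A).
Hypotheses (sK : cancel sigma tau) (tK : cancel tau sigma).
Hypothesis gwa : is_GWA sigma a iota x y.

Lemma GWA_sym : is_GWA tau (sigma a) iota y x.
Proof.
case: gwa => rel univ; split; first exact: (GWA_relations_sym sK tK rel).
move=> C f X Y /(GWA_relations_sym tK sK); rewrite sK => /univ [g [gi gx gy gE]].
by exists g; split=> // g' gi' gx' gy'; apply: gE.
Qed.

Lemma GWA_xd d i : x ^+ i * iota d = iota (iter i sigma d) * x ^+ i.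
Proof.
case: gwa => [[r1 _ _ _] _]; elim: i => [|i IH]; first by rewrite expr0 mul1r mulr1.
by rewrite exprS -mulrA IH mulrA r1 -mulrA.
Qed.

Lemma has_normal_form_mulx u : has_normal_form iota x y u -> has_normal_form iota x y (x * u).
Proof.
case: gwa => [[r1 _ _ r4] _].
apply: has_normal_form_preim; first exact/linear_mull/(linearP idfun).
- by move=> d i; rewrite mulrA r1 -mulrA -exprS; apply: has_normal_form_x.
move=> d [|i]; rewrite mulrA r1 -mulrA.
  by rewrite mulr1 -[x]expr1; apply: has_normal_form_x.
by rewrite exprS [x * _]mulrA r4 mulrA -rmorphM; apply: has_normal_form_y.
Qed.

End GWA.

Section GWANormalForm.
Variables (k : fieldType) (D A : algType k) (sigma tau : {lrmorphism D -> D}) (a : D).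
Variables (iota : {lrmorphism D -> A}) (x y : A).
Hypotheses (sK : cancel sigma tau) (tK : cancel tau sigma).
Hypothesis gwa : is_GWA sigma a iota x y.

Lemma GWA_yd d i : y ^+ i * iota d = iota (iter i tau d) * y ^+ i.
Proof. exact: (GWA_xd (GWA_sym sK tK gwa)). Qed.

Lemma GWA_normal_form u : has_normal_form iota x y u.
Proof.
have sN := has_normal_form_subspace iota x y.
suff all : forall u v, has_normal_form iota x y v -> has_normal_form iota x y (u * v).
  rewrite -[u]mulr1; apply: all.
  by have := has_normal_form_x iota x y 1 0; rewrite rmorph1 mulr1.
apply: (GWA_ind _ _ _ gwa).
- split=> [v _|c v w hv hw s Ns]; first by rewrite mul0r; case: sN.
  by rewrite mulrDl -scalerAl; case: sN => _; apply; auto.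
- by move=> v; rewrite mul1r.
- by move=> v w hv hw s Ns; rewrite -mulrA; auto.
- move=> d v; apply: (has_normal_form_preim (f := fun v => iota d * v)).
  + exact/linear_mull/(linearP idfun).
  + by move=> e i; rewrite mulrA -rmorphM; apply: has_normal_form_x.
  + by move=> e i; rewrite mulrA -rmorphM; apply: has_normal_form_y.
- by move=> v; apply: (has_normal_form_mulx gwa).
- move=> v /has_normal_form_sym /(has_normal_form_mulx (GWA_sym sK tK gwa)).
  exact: has_normal_form_sym.
Qed.

Hypothesis ca : central a.

(* The skew Laurent polynomials D[X, X^-1; sigma], with [x] and [y] acting as [X] and
   [a X^-1], act on the functions on a set with a shift. *)
Lemma GWA_shift_representation (T : Type) (t0 : T) (up dn : T -> T) :
    cancel up dn -> cancel dn up ->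
  exists (nz : ((fun=> 1) : T -> D) != 0) (g : {lrmorphism A -> endo nz}),
    (forall d (f : T -> D), g (iota d) f = fun t => d * f t) /\
    (forall f : T -> D, g x f = fun t => sigma (f (dn t))).
Proof.
move=> upK dnK; have nz : ((fun=> 1) : T -> D) != 0.
  by apply/eqP => /(congr1 (fun f : T -> D => f t0)) /eqP; rewrite oner_eq0.
have fE (c : k) (f g : T -> D) t : (c *: f + g) t = c *: f t + g t by [].
have linD d : linear (fun (f : T -> D) (t : T) => d * f t).
  by move=> c f g; apply/funext => t; rewrite !fE mulrDr -scalerAr.
have linX : linear (fun (f : T -> D) (t : T) => sigma (f (dn t))).
  by move=> c f g; apply/funext => t; rewrite !fE linearP.
have linY : linear (fun (f : T -> D) (t : T) => a * tau (f (up t))).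
  by move=> c f g; apply/funext => t; rewrite !fE linearP mulrDr -scalerAr.
have [phi phiE] : exists phi : {lrmorphism D -> endo nz}, phi =1 fun d => Endo nz (linD d).
  apply: lrmorphism_of => [c u v|]; last split=> [|u v]; apply: endoP => f; apply/funext => t /=.
  - by rewrite fE mulrDl -scalerAl.
  - by rewrite mul1r.
  - by rewrite mulrA.
have rel : GWA_relations sigma a phi (Endo nz linX) (Endo nz linY).
  split=> [d|e||]; apply: endoP => f; apply/funext => t /=; rewrite ?phiE /=.
  - by rewrite rmorphM.
  - by rewrite rmorphM /= sK !mulrA ca.
  - by rewrite upK sK.
  - by rewrite rmorphM /= tK dnK.
have [g [gi gx _ _]] := (let: conj _ univ := gwa in univ) _ _ _ _ rel.
by exists nz, g; split=> [d f|f]; rewrite ?gi ?gx ?phiE.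
Qed.

Lemma GWA_x_coefficient : exists cf : nat -> {linear A -> D},
  forall n m d, cf n (iota d * x ^+ m) = if n == m then d else 0.
Proof.
have [nz [g [gi gx]]] := GWA_shift_representation (0 : int) (addrK 1) (subrK 1).
pose delta (i : int) : D := (i == 0)%:R.
have cfL (n : nat) : linear (fun u => g u delta n) by move=> c u v; rewrite linearP.
exists (fun n : nat => HB.pack_for {linear A -> D} (fun u => g u delta n)
  (GRing.isLinear.Build k A D *:%R _ (cfL n))).
move=> n m d /=; rewrite rmorphM rmorphXn /= gi endo_expE.
have -> : iter m (g x) delta = fun i : int => (i == m)%:R.
  elim: m => [|m IH] //=; rewrite IH gx; apply/funext => i; rewrite rmorph_nat.
  by congr (_%:R); rewrite subr_eq addrC -intS.
by rewrite eqz_nat; case: eqP; rewrite ?mulr1 ?mulr0.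
Qed.

Lemma GWA_indep (J : finType) (f : J -> D) (s L : nat) : indep_family f ->
  indep_family (fun i : J * 'I_L => iota (f i.1) * x ^+ (s + i.2)).
Proof.
have [cf cfE] := GWA_x_coefficient.
move=> ind c c0 [i l]; have := ind (fun i => c (i, l)); apply.
rewrite -[RHS](raddf0 (cf (s + l)%N)) -[in RHS]c0 raddf_sum /=.
rewrite [RHS](eq_bigr (fun p =>
  c (p.1, p.2) *: cf (s + l)%N (iota (f p.1) * x ^+ (s + p.2)))); last first.
  by case=> i' l' _; rewrite linearZ.
rewrite -(pair_bigA _ (fun i m => c (i, m) *: cf (s + l)%N (iota (f i) * x ^+ (s + m)))).
apply: eq_bigr => i' _ /=; rewrite (bigD1 l) //= cfE eqxx big1 ?addr0 // => m ne.
by rewrite cfE eqn_add2l eq_sym val_eqE (negbTE ne) scaler0.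
Qed.

End GWANormalForm.

(** * Growth over a stable subspace *)

Section DegreeMultiplication.
Variables (k : fieldType) (D A : algType k) (sigma : {lrmorphism D -> D}) (a : D).
Variables (iota : {lrmorphism D -> A}) (x y : A) (us : seq D).
Hypothesis gwa : is_GWA sigma a iota x y.
Hypothesis us_sa : in_span us (sigma a).
Hypothesis us_stable : forall u, in_span us u -> in_span us (sigma u).
Local Notation S n := (word_span us n).
Local Notation BG n g := (degree_le iota x y (S n) g).

Let sS n : subspace (S n). Proof. exact: word_span_subspace. Qed.
Let sB n g : subspace (BG n g). Proof. exact: degree_le_subspace. Qed.

Lemma word_span_iter n i u : S n u -> S n (iter i sigma u).
Proof. by move=> Su; elim: i => //= i IH; apply: word_span_stable. Qed.

Lemma degree_leMl n m g d u : S n d -> BG m g u -> BG (n + m) g (iota d * u).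
Proof.
move=> Sd; apply: (degree_le_ind (T := fun u => BG (n + m) g (iota d * u))).
- exact/subspace_preim/sB/linear_mull/(linearP idfun).
- by move=> e i Se ig; rewrite mulrA -rmorphM; apply: degree_le_x => //; apply: word_spanM.
- by move=> e i Se ig; rewrite mulrA -rmorphM; apply: degree_le_y => //; apply: word_spanM.
Qed.

Lemma degree_le_xX g i : (i <= g)%N -> BG 0 g (x ^+ i).
Proof.
by move=> ig; rewrite -[_ ^+ _]mul1r -(rmorph1 iota); apply: degree_le_x (word_span1 _ _) ig.
Qed.

Lemma degree_le_yX g i : (i <= g)%N -> BG 0 g (y ^+ i).
Proof.
by move=> ig; rewrite -[_ ^+ _]mul1r -(rmorph1 iota); apply: degree_le_y (word_span1 _ _) ig.
Qed.

Lemma degree_le_xy i l : BG i (i + l) (x ^+ i * y ^+ l).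
Proof.
have S0 n w : S 0 w -> S n w by apply: word_span_mono.
elim: i l => [|i IH] [|l].
- by rewrite mulr1; apply: degree_le_xX.
- by rewrite expr0 mul1r; apply: degree_le_yX.
- by rewrite mulr1 addn0; apply: (degree_leW (sS _) (S0 _) _ (degree_le_xX (leqnn _))).
have [[_ _ _ xy] _] := gwa.
rewrite exprSr exprS -mulrA [x * _]mulrA xy mulrA (GWA_xd gwa) -mulrA -add1n.
apply: degree_leMl; first exact/word_span_iter/word_span_gen.
by apply: degree_leW (IH l) => //; lia.
Qed.

Lemma degree_le_xMl n h g i d v : in_span us d -> (i <= h)%N -> BG n g v ->
  BG (h.+1 + n) (h + g) (iota d * x ^+ i * v).
Proof.
move=> /word_span_gen d1 ih; set N := (_ + n)%N.
have SN m : (m <= N)%N -> forall w, S m w -> S N w by move=> mN w; apply: word_span_mono.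
apply: (degree_le_ind (T := fun v => BG N (h + g) (iota d * x ^+ i * v))).
- exact/subspace_preim/sB/linear_mull/(linearP idfun).
- move=> e l Se lg.
  rewrite -mulrA [x ^+ i * _]mulrA (GWA_xd gwa) -mulrA -exprD mulrA -rmorphM.
  apply: degree_le_x; rewrite ?leq_add //; apply: (SN (1 + n)%N); first by rewrite /N; lia.
  exact/word_spanM/word_span_iter.
- move=> e l Se lg.
  rewrite -mulrA [x ^+ i * _]mulrA (GWA_xd gwa) -mulrA mulrA -rmorphM.
  have := degree_leMl (word_spanM d1 (word_span_iter i Se)) (degree_le_xy i l).
  by apply: degree_leW => //; [apply: SN; rewrite /N; lia|rewrite leq_add].
Qed.

End DegreeMultiplication.

Section StableSubspace.
Variables (k : fieldType) (D A : algType k) (sigma tau : {lrmorphism D -> D}) (a : D).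
Variables (iota : {lrmorphism D -> A}) (x y : A) (us : seq D).
Hypotheses (sK : cancel sigma tau) (tK : cancel tau sigma).
Hypothesis gwa : is_GWA sigma a iota x y.
Hypothesis us_a : in_span us a.
Hypothesis us_stable : forall u, in_span us u -> in_span us (sigma u).
Hypothesis us_stableV : forall u, in_span us u -> in_span us (tau u).
Local Notation S n := (word_span us n).
Local Notation BG n g := (degree_le iota x y (S n) g).

Lemma degree_leM n h g u v : degree_le iota x y (in_span us) h u -> BG n g v ->
  BG (h.+1 + n) (h + g) (u * v).
Proof.
move=> hu gv; apply: (degree_le_ind (T := fun u => BG _ (h + g) (u * v))) hu.
- apply: subspace_preim; first exact/linear_mulr/(linearP idfun).
  exact/degree_le_subspace/word_span_subspace.
- by move=> d i ud ih; apply: (degree_le_xMl gwa) => //; apply: us_stable.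
move=> d i ud ih; apply: degree_le_sym.
apply: (degree_le_xMl (GWA_sym sK tK gwa)) => //; first by rewrite sK.
exact: degree_le_sym.
Qed.

Lemma degree_le_prod h l : {in l, forall v, degree_le iota x y (in_span us) h v} ->
  BG (h.+1 * size l) (h * size l) (\prod_(v <- l) v).
Proof.
elim: l => [|w l IH] hl.
  rewrite big_nil !muln0 -[1](expr0 x); exact: degree_le_xX.
rewrite big_cons /= !mulnS; apply: degree_leM; first by apply/hl/mem_head.
by apply: IH => t tl; apply: hl; rewrite inE tl orbT.
Qed.

Lemma degree_le_spanning_list n g : exists2 L : seq A,
  size L = (g.+1.*2 * span_dim (words_upto us n))%N & forall u, BG n g u -> in_span L u.
Proof.
have [b [_ <- _ sb]] := span_dim_basis (words_upto us n).
pose L z := [seq iota d * z ^+ i | d <- b, i <- seq.iota 0 g.+1].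
exists (L x ++ L y); first by rewrite size_cat !size_allpairs size_iota addnn mulnC -doubleMl.
have LP (z : A) d i : S n d -> (i <= g)%N -> in_span (L z) (iota d * z ^+ i).
  move=> Sd ig; apply: (in_span_preim (f := fun d => iota d * z ^+ i) _ _ _ (in_span_trans sb Sd)).
  - exact/linear_mulr/linearP.
  - exact: in_span_subspace.
  by move=> w wb; apply/in_span_mem/allpairsP; exists (w, i); rewrite mem_iota add0n.
move=> u; apply: degree_le_ind; first exact: in_span_subspace.
  by move=> d i Sd ig; apply: in_span_sub (LP x d i Sd ig) => v vL; rewrite mem_cat vL.
by move=> d i Sd ig; apply: in_span_sub (LP y d i Sd ig) => v vL; rewrite mem_cat vL orbT.
Qed.

Lemma span_dim_words_le (vs : seq A) h n :
  {in vs, forall v, degree_le iota x y (in_span us) h v} ->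
  (span_dim (words_upto vs n) <= (h * n).+1.*2 * span_dim (words_upto us (h.+1 * n)))%N.
Proof.
move=> hvs; have [L <- LP] := degree_le_spanning_list (h.+1 * n) (h * n).
apply: span_dim_le => v /words_uptoP [l [sl lvs ->]]; apply: LP.
apply: degree_leW (degree_le_prod (sub_in1 lvs hvs)); rewrite ?leq_mul2l ?sl ?orbT //.
  exact: word_span_subspace.
by move=> w; apply: word_span_mono; rewrite leq_mul2l sl orbT.
Qed.

End StableSubspace.

Section GWAGrowth.
Variables (k : fieldType) (D A : algType k) (sigma : {lrmorphism D -> D}) (a : D).
Variables (iota : {lrmorphism D -> A}) (x y : A).
Hypothesis bij : is_alg_automorphism sigma.
Hypothesis gwa : is_GWA sigma a iota x y.

Lemma degree_le_in_span g u : degree_le iota x y (fun=> True) g u ->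
  exists cs : seq D, degree_le iota x y (in_span cs) g u.
Proof.
case=> [c [c' [_ _ ->]]]; pose values (e : nat -> D) := codom (fun i : 'I_g.+1 => e i).
have valuesP (e : nat -> D) (i : 'I_g.+1) : e i \in values e by apply: codom_f.
pose cs := values c ++ values c'; exists cs.
have sC := in_span_subspace cs; have sB := degree_le_subspace iota x y g sC.
apply: subspaceD => //; apply: subspace_sum => // i _.
  by apply: degree_le_x; rewrite -1?ltnS //; apply: in_span_mem; rewrite mem_cat valuesP.
by apply: degree_le_y; rewrite -1?ltnS //; apply: in_span_mem; rewrite mem_cat valuesP orbT.
Qed.

Lemma exists_common_degree (vs : seq A) : exists h (cs : seq D),
  {in vs, forall v, degree_le iota x y (in_span cs) h v}.
Proof.
have [tau [sK tK]] := inverse_automorphism bij.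
have [|v _|[h cs] hvs] := directed_bound
  (P := fun v (b : nat * seq D) => degree_le iota x y (in_span b.2) b.1 v) (0%N, [::]) (s := vs).
- move=> [g cs] [g' cs']; exists (maxn g g', cs ++ cs') => v.
  have sC := in_span_subspace (cs ++ cs').
  by case; apply: degree_leW; rewrite ?leq_maxl ?leq_maxr // => d;
    apply: in_span_sub => w wcs; rewrite mem_cat wcs ?orbT.
- have [g /degree_le_in_span [cs gv]] := GWA_normal_form sK tK gwa v.
  by exists (g, cs).
by exists h, cs.
Qed.

Lemma GWA_growth_le e : locally_algebraic sigma -> growth_le D e -> growth_le A e.+1.
Proof.
move=> la gD vs; have [tau [sK tK]] := inverse_automorphism bij.
have [h [cs hcs]] := exists_common_degree vs.
have [us [csU [stable stableV]]] := la (a :: cs).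
have hvs : {in vs, forall v, degree_le iota x y (in_span us) h v}.
  move=> v /hcs; apply: degree_leW => //; first exact: in_span_subspace.
  by move=> d; apply: in_span_trans => w wcs; apply: csU; rewrite inE wcs orbT.
have us_a : in_span us a by apply: csU; rewrite mem_head.
have us_tau u : in_span us u -> in_span us (tau u).
  by move=> /stableV [u' [u'us <-]]; rewrite sK.
have [C CP] := gD us; exists (h.+1.*2 * (C * h.+1 ^ e))%N => n.
apply: leq_trans (span_dim_words_le sK tK gwa us_a stable us_tau n hvs) _.
rewrite -!doubleMl leq_double expnS.
apply: leq_trans (leq_mul (leqnn _) (CP _)) _.
have -> : (h.+1 * (C * h.+1 ^ e) * (n.+1 * n.+1 ^ e) = h.+1 * n.+1 * (C * (h.+1 * n.+1) ^ e))%N.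
  by rewrite expnMn; ring.
apply: leq_mul; first by nia.
by rewrite leq_mul2l leq_expn_base ?orbT //; nia.
Qed.

End GWAGrowth.

(** * Orbits *)

Section Orbits.
Variables (k : fieldType) (V : lmodType k) (f : {linear V -> V}).
Implicit Types (vs : seq V) (u v : V).

Definition orbit_list vs (n : nat) := [seq iter i f v | i <- iota 0 n, v <- vs].

Lemma orbit_listP vs n u : reflect
  (exists i v, [/\ (i < n)%N, v \in vs & u = iter i f v]) (u \in orbit_list vs n).
Proof.
apply: (iffP allpairsP) => [[[i v] /= [ilt vvs ->]]|[i [v [ilt vvs ->]]]].
  by exists i, v; rewrite mem_iota add0n in ilt.
by exists (i, v); rewrite mem_iota add0n.
Qed.

Lemma orbit_span_stable vs n :
  {in vs, forall v, in_span (orbit_list vs n) (iter n f v)} ->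
  forall u, in_span (orbit_list vs n) u -> in_span (orbit_list vs n) (f u).
Proof.
move=> vsn u; apply: in_span_preim; [exact: linearP|exact: in_span_subspace|].
move=> _ /orbit_listP [i [v [ilt vvs ->]]]; rewrite -iterS.
move: ilt; rewrite leq_eqVlt => /predU1P [->|ilt]; first exact: vsn.
by apply/in_span_mem/orbit_listP; exists i.+1, v.
Qed.

Lemma mem_orbit_list vs n v : (0 < n)%N -> v \in vs -> v \in orbit_list vs n.
Proof. by move=> n0 vvs; apply/orbit_listP; exists 0%N, v. Qed.

End Orbits.

Section LocallyAlgebraic.
Variables (k : fieldType) (D : algType k) (sigma : {lrmorphism D -> D}).

Lemma locally_algebraicP : injective sigma -> locally_algebraic sigma <->
  forall vs : seq D, exists us : seq D, {in vs, forall v, in_span us v} /\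
    forall u, in_span us u -> in_span us (sigma u).
Proof.
move=> inj; split=> la vs; have [us [vsU st]] := la vs; exists us; split=> //.
  by case: st.
by split=> // u /(stable_span_surj inj st) [u' u'us <-]; exists u'.
Qed.

Lemma not_locally_algebraic_orbit : injective sigma -> ~ locally_algebraic sigma ->
  exists vs : seq D, forall n,
    exists s, [/\ lin_free s, size s = n & {subset s <= orbit_list sigma vs n}].
Proof.
move=> inj; rewrite locally_algebraicP // => /existsNP [vs nvs].
exists vs; pose orb n := orbit_list sigma vs n.
have new n : exists2 v, v \in vs & ~ in_span (orb n) (iter n sigma v).
  apply: contrapT => none; have vsn : {in vs, forall v, in_span (orb n) (iter n sigma v)}.
    by move=> v vvs; apply: contrapT => nv; apply: none; exists v.
  apply: nvs; exists (orb n); split; last exact: orbit_span_stable.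
  by case: n vsn {none} => // n _ v vvs; apply/in_span_mem/mem_orbit_list.
elim=> [|n [s [fs sz sub]]]; first by exists [::]; split=> //; apply: lin_free_nil.
have [v vvs nv] := new n; exists (iter n sigma v :: s); split.
- by apply/lin_free_cons; split=> // /(in_span_sub sub).
- by rewrite /= sz.
move=> u; rewrite inE => /predU1P [->|/sub /orbit_listP [i [w [ilt wvs ->]]]].
  by apply/orbit_listP; exists n, v.
by apply/orbit_listP; exists i, w; split=> //; apply: ltnW.
Qed.

Lemma finite_order_locally_algebraic :
  injective sigma -> finite_order sigma -> locally_algebraic sigma.
Proof.
move=> inj [m [m_gt0 sm]]; apply/(locally_algebraicP inj) => vs.
exists (orbit_list sigma vs m); split; first by move=> v vvs; apply/in_span_mem/mem_orbit_list.
by apply: orbit_span_stable => v vvs; rewrite sm; apply/in_span_mem/mem_orbit_list.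
Qed.

End LocallyAlgebraic.

(** * Families of elements with distinct values *)

Lemma exchange_coefficients_inj (q q' b b' s s' h : nat) : (s < h)%N -> (s' < h)%N ->
  (b' + h < b)%N \/ (b + h < b')%N ->
  (q * b' + q' * b + s = q' * b' + q * b + s')%N -> q = q'.
Proof.
have absurd (p p' c c' t t' : nat) : (t' < h)%N -> (c' + h < c)%N -> (p < p')%N ->
    (p * c' + p' * c + t = p' * c' + p * c + t')%N -> False.
  move=> th /subnK <- /subnK <-.
  set e := (c - _)%N; set f := (p' - _)%N => E.
  have : (h <= f.+1 * (e + h).+1)%N by nia.
  by nia.
move=> sh s'h [] lt E; case: (ltngtP q q') => // qq.
- by case: (absurd q q' b b' s s').
- by case: (absurd q' q b b' s' s) => //; rewrite E.
- by case: (absurd q q' b' b s' s) => //; lia.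
- by case: (absurd q' q b' b s s') => //; lia.
Qed.

Section MonomialValues.
Variables (F : fieldType) (O : F -> Prop) (d : nat) (z : 'I_d -> F).
Hypothesis vO : valuation_ring O.
Hypothesis zO : distinct_values O (monomial z).
Local Notation M := (monomial z).
Implicit Types u v w : F.

Let mon_neq0 b : M b != 0. Proof. by case: zO. Qed.
Let mon_inj b b' : val_eq O (M b) (M b') -> b = b'. Proof. by case: zO => _; apply. Qed.

(* The values of [u] and [v] agree modulo the group of values of monomials. *)
Definition commensurable u v := exists b b', val_eq O (u * M b) (v * M b').

Lemma commensurable_refl u : u != 0 -> commensurable u u.
Proof.
by move=> u0; exists (fun=> 0%N), (fun=> 0%N); apply: (val_eq_refl vO); rewrite mulf_neq0.
Qed.

Lemma commensurable_sym u v : commensurable u v -> commensurable v u.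
Proof. by move=> [b [b' s]]; exists b', b; apply: val_eq_sym. Qed.

Lemma commensurable_trans v u w : v != 0 ->
  commensurable u v -> commensurable v w -> commensurable u w.
Proof.
move=> v0 [b [b' s]] [c [c' s']]; exists (fun i => b i + c i)%N, (fun i => b' i + c' i)%N.
rewrite !monomialD; apply: (val_eq_trans vO (v := v * M b' * M c)).
- by rewrite !mulf_neq0.
- by rewrite mulrA; apply: (val_eqMr vO).
- by rewrite mulrAC [M b' * _]mulrC mulrA; apply: (val_eqMr vO).
Qed.

Lemma distinct_values_box m :
  distinct_values O (fun b : {ffun 'I_d -> 'I_m} => M (fun t => b t)).
Proof.
split=> // b b' /mon_inj e; apply/ffunP => t; apply: val_inj.
exact: (congr1 (fun c : 'I_d -> nat => c t) e).
Qed.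

Lemma distinct_values_transversal (T : Type) (g : T -> F) m : (forall i, g i != 0) ->
  (forall i l, commensurable (g i) (g l) -> i = l) ->
  distinct_values O (fun x : T * {ffun 'I_d -> 'I_m} => g x.1 * M (fun t => x.2 t)).
Proof.
move=> g0 g_inj; have [_ box_inj] := distinct_values_box m.
split=> [[i b]|[i b] [l c] /= s]; first by rewrite mulf_neq0.
have il : i = l by apply: g_inj; exists (fun t => b t : nat), (fun t => c t : nat).
rewrite -il mulrC [X in val_eq _ _ X]mulrC in s *.
by rewrite (box_inj _ _ (val_eq_cancelr (g0 i) s)).
Qed.

(* The bounded exponent vectors [b i - b' i] and the classes [r i] determine the value of
   [g i], so few classes leave some unbounded exponent. *)
Lemma exists_far_exponent n (g : 'I_n -> F) (r : 'I_n -> 'I_n) (h : nat) :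
  distinct_values O g -> (forall i, commensurable (g i) (g (r i))) ->
  (h * h.*2.+1 ^ d <= n)%N -> (#|codom r| < h)%N -> exists i b b' t,
    val_eq O (g i * M b) (g (r i) * M b') /\ ((b' t + h < b t)%N \/ (b t + h < b' t)%N).
Proof.
move=> [g0 g_inj] gr hn rh; have /choice [b /choice [b' bP]] := gr.
apply: contrapT => near.
have bd i t : (b i t <= b' i t + h)%N /\ (b' i t <= b i t + h)%N.
  split; rewrite leqNgt; apply/negP => lt; apply: near; exists i, (b i), (b' i), t.
    by split=> //; left.
  by split=> //; right.
pose phi i : {i | i \in codom r} * {ffun 'I_d -> 'I_(h.*2.+1)} :=
  (exist _ (r i) (codom_f r i), [ffun t => inord (b i t + h - b' i t)]).
have /leq_card : injective phi.
  move=> i l [] ril /ffunP e; apply: g_inj.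
  have bb' : (fun t => b i t + b' l t)%N = (fun t => b l t + b' i t)%N.
    apply/funext => t; have := congr1 (@nat_of_ord _) (e t).
    have [b1 b2] := bd i t; have [b3 b4] := bd l t.
    by rewrite !ffunE !inordK ?ltnS; lia.
  apply: (val_eq_cancelr (mulf_neq0 (mon_neq0 (b i)) (mon_neq0 (b' l)))).
  rewrite -[in X in val_eq _ _ X]monomialD bb' monomialD !mulrA.
  apply: (val_eq_trans vO (v := g (r i) * M (b' i) * M (b' l))); first by rewrite !mulf_neq0.
    exact: (val_eqMr vO).
  by rewrite ril mulrAC; apply: (val_eqMr vO) => //; apply: val_eq_sym.
rewrite card_prod card_sig card_ffun !card_ord => le.
have : (n < h * h.*2.+1 ^ d)%N by apply: leq_ltn_trans le _; rewrite ltn_mul2r rh expn_gt0.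
by rewrite ltnNge hn.
Qed.

Definition set_exponent (t : 'I_d) (s : nat) (b : 'I_d -> nat) (i : 'I_d) : nat :=
  if i == t then s else b i.

Lemma distinct_values_powers u w (b b' : 'I_d -> nat) t h m : u != 0 -> w != 0 ->
  val_eq O (u * M b) (w * M b') -> (b' t + h < b t)%N \/ (b t + h < b' t)%N ->
  distinct_values O (fun x : 'I_h * {ffun 'I_d -> 'I_m} =>
    u ^+ x.2 t * w ^+ (m - x.2 t) * M (set_exponent t x.1 (fun i => x.2 i))).
Proof.
move=> u0 w0 uw far; pose J := ('I_h * {ffun 'I_d -> 'I_m})%type.
pose e (x : J) := set_exponent t x.1 (fun i => x.2 i).
pose g (x : J) := u ^+ x.2 t * w ^+ (m - x.2 t) * M (e x).
have g0 x : g x != 0 by rewrite !mulf_neq0 // expf_neq0.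
have reduce x q : val_eq O (g x * M b ^+ (x.2 t + q))
    (w ^+ m * M (fun i => x.2 t * b' i + q * b i + e x i)%N).
  rewrite !monomialD !monomialMn exprD /g; set c := M (e x).
  have -> : w ^+ m = w ^+ x.2 t * w ^+ (m - x.2 t).
    by rewrite -exprD subnKC // ltnW.
  have r0 : w ^+ (m - x.2 t) * M b ^+ q * c != 0 by rewrite !mulf_neq0 ?expf_neq0 ?mon_neq0.
  have := val_eqMr vO r0 (val_eqX vO (x.2 t) uw); rewrite !exprMn.
  by congr val_eq; ring.
split=> // x x' s; have E : (fun i => x.2 t * b' i + x'.2 t * b i + e x i)%N =
    (fun i => x'.2 t * b' i + x.2 t * b i + e x' i)%N.
  apply: mon_inj; apply: (val_eq_cancelr (expf_neq0 m w0)).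
  rewrite mulrC [X in val_eq _ _ X]mulrC.
  have nz y q : g y * M b ^+ q != 0 by rewrite mulf_neq0 ?expf_neq0.
  apply: (val_eq_trans vO (nz x _) (val_eq_sym (reduce x (x'.2 t)))).
  apply: (val_eq_trans vO (nz x' (x'.2 t + x.2 t)%N)); last exact: reduce.
  by rewrite [(x'.2 t + _)%N]addnC; apply: (val_eqMr vO); rewrite ?expf_neq0.
have /= Et := congr1 (fun c : 'I_d -> nat => c t) E; rewrite /e /set_exponent eqxx in Et.
have qq := exchange_coefficients_inj (ltn_ord x.1) (ltn_ord x'.1) far Et.
case: x x' qq E Et {s} => [s c] [s' c'] /= qq E Et; congr (_, _).
  by apply: val_inj => /=; rewrite qq in Et; lia.
apply/ffunP => i; apply: val_inj; have [->|it] := eqVneq i t; first exact: qq.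
have := congr1 (fun c : 'I_d -> nat => c i) E.
by rewrite /e /set_exponent /= (negbTE it) qq => /addnI.
Qed.

End MonomialValues.

(** * Coordinate frames *)

Record frame (k : fieldType) (D : algType k) (d : nat) := Frame {
  frame_field : fieldType;
  frame_const : {rmorphism k -> frame_field};
  frame_emb : {rmorphism D -> frame_field};
  frame_var : 'I_d -> D;
  frame_val : frame_field -> Prop;
  frame_inj : injective frame_emb;
  frame_scale : forall c u, frame_emb (c *: u) = frame_const c * frame_emb u;
  frame_valuation : valuation_ring frame_val;
  frame_coefficient : coefficient_field frame_const frame_val;
  frame_monomial : distinct_values frame_val (monomial (fun i => frame_emb (frame_var i))) }.

Arguments frame_emb {k D d} fr : rename.
Arguments frame_var {k D d} fr _ : rename.
Arguments frame_val {k D d} fr _ : rename.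
Arguments frame_inj {k D d} fr [x1 x2] _ : rename.
Arguments frame_scale {k D d} fr c u : rename.
Arguments frame_valuation {k D d} fr : rename.
Arguments frame_coefficient {k D d} fr : rename.
Arguments frame_monomial {k D d} fr : rename.

Section Frame.
Variables (k : fieldType) (D : algType k) (d : nat) (fr : frame D d).
Local Notation j := (frame_emb fr).
Local Notation z := (frame_var fr).
Local Notation O := (frame_val fr).
Local Notation M := (monomial (fun i => j (z i))).
Implicit Types (u v w : D).

Let vO : valuation_ring O. Proof. exact: frame_valuation. Qed.
Let zO : distinct_values O M. Proof. exact: frame_monomial. Qed.

Lemma frame_comm u v : u * v = v * u.
Proof. by apply: (@frame_inj _ _ _ fr); rewrite !rmorphM mulrC. Qed.

Lemma frame_indep (J : finType) (f : J -> D) :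
  distinct_values O (fun i => j (f i)) -> indep_family f.
Proof.
exact: (distinct_values_indep vO (frame_coefficient fr) (frame_scale fr)).
Qed.

Definition var_monomial (b : 'I_d -> nat) : D := \prod_(i < d) z i ^+ b i.

Lemma emb_var_monomial b : j (var_monomial b) = M b.
Proof. by rewrite rmorph_prod; apply: eq_bigr => i _; rewrite rmorphXn. Qed.

Lemma var_monomial_box_indep m :
  indep_family (fun b : {ffun 'I_d -> 'I_m} => var_monomial (fun i => b i)).
Proof.
apply: frame_indep; have [nz inj] := distinct_values_box zO m.
by split=> [b|b b']; rewrite !emb_var_monomial //; apply: inj.
Qed.

Lemma var_monomial_word (B : algType k) (f : {rmorphism D -> B}) (W : seq B) m b :
  (forall i, f (z i) \in W) -> (forall i, b i <= m)%N ->
  word_span W (d * m) (f (var_monomial b)).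
Proof.
move=> zW bm; have -> : (d * m = \sum_(i < d) m)%N by rewrite sum_nat_const card_ord.
rewrite rmorph_prod /=; elim/big_rec2: _ => [|i s u _ IH]; first exact: word_span1.
apply: word_spanM => //; rewrite rmorphXn /=; apply: (word_span_mono (bm i)).
exact: word_span_memX.
Qed.

Lemma frame_growth_ge : exists W : seq D, forall m,
  (m ^ d <= span_dim (words_upto W (d.+1 * m)))%N.
Proof.
exists (codom z) => m.
have -> : (m ^ d = #|{ffun 'I_d -> 'I_m}|)%N by rewrite card_ffun !card_ord.
apply: indep_family_span_dim (@var_monomial_box_indep m) _ => b.
apply: (@word_span_mono _ _ _ (d * m)); first by rewrite leq_mul2r leqnSn orbT.
by apply: (@var_monomial_word D idfun) => i; [apply: codom_f|apply: ltnW].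
Qed.

Section Spread.
Variables (n : nat) (f : 'I_n -> D) (h m : nat).
Hypothesis f_values : distinct_values O (fun i => j (f i)).
Hypothesis h_le_m : (h <= m)%N.

Definition bounded_product (e : D) := exists (l : seq D) (b : 'I_d -> nat),
  [/\ {subset l <= codom f}, (size l <= m)%N, forall i, (b i <= m)%N &
      e = var_monomial b * \prod_(u <- l) u].

Definition has_spread := exists (J : finType) (e : J -> D), [/\ (h * m ^ d <= #|J|)%N,
  forall i, bounded_product (e i) & distinct_values O (fun i => j (e i))].

Let f0 i : j (f i) != 0. Proof. by case: f_values. Qed.

Local Notation comm i l :=
  (commensurable O (fun t => j (z t)) (j (f i)) (j (f l))).

Let representative i := odflt i [pick l | `[< comm i l >]].

Let representativeP i : comm i (representative i).
Proof.
rewrite /representative; case: pickP => [l /asboolP //|_] /=.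
exact: (commensurable_refl vO zO).
Qed.

Let representative_eq i l : comm i l -> representative i = representative l.
Proof.
move=> il; rewrite /representative.
have e : (fun q => `[< comm i q >]) =1 (fun q => `[< comm l q >]).
  have trans := commensurable_trans vO zO (f0 _).
  by move=> q; apply/asboolP/asboolP; apply: trans; [apply: commensurable_sym|].
rewrite (eq_pick e); case: pickP => // /(_ l) /asboolP [].
exact: (commensurable_refl vO zO).
Qed.

Lemma spread_many_classes : (0 < h)%N -> (h <= #|codom representative|)%N -> has_spread.
Proof.
move=> h_gt0 hr; pose T := {i : 'I_n | i \in codom representative}.
exists (T * {ffun 'I_d -> 'I_m})%type, (fun x : T * {ffun 'I_d -> 'I_m} =>
  f (val x.1) * var_monomial (fun t => x.2 t)); split.
- by rewrite card_prod card_sig card_ffun !card_ord leq_mul2r hr orbT.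
- move=> [i b] /=; exists [:: f (sval i)], (fun t => nat_of_ord (b t)); split=> //=.
  + by move=> u; rewrite inE => /eqP ->; apply: codom_f.
  + exact: leq_trans h_le_m.
  + by move=> t; apply: ltnW.
  + by rewrite big_seq1 frame_comm.
have [|nz inj] := distinct_values_transversal zO m
  (fun i : T => f0 (val i)).
  have rK (q : T) : representative (val q) = val q.
    case: q => q /= /codomP [q0 qE]; rewrite [in RHS]qE; apply/esym/representative_eq.
    by rewrite qE.
  by move=> i l /representative_eq; rewrite !rK => /val_inj.
by split=> [x|x x'] /=; rewrite !rmorphM !emb_var_monomial; [apply: nz|apply: inj].
Qed.

Lemma spread_few_classes : (h * h.*2.+1 ^ d <= n)%N -> (#|codom representative| < h)%N ->
  has_spread.
Proof.
move=> hn rh; have [i [b [b' [t [bb' far]]]]] := exists_far_exponent vO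
  zO f_values representativeP hn rh.
set l := representative i in bb'.
exists ('I_h * {ffun 'I_d -> 'I_m})%type, (fun x : 'I_h * {ffun 'I_d -> 'I_m} =>
  f i ^+ x.2 t * f l ^+ (m - x.2 t) * var_monomial (set_exponent t x.1 (fun q => x.2 q))).
split; first by rewrite card_prod card_ffun !card_ord.
- move=> x; exists (nseq (x.2 t) (f i) ++ nseq (m - x.2 t) (f l)).
  exists (set_exponent t x.1 (fun q => x.2 q)); split.
  + by move=> v; rewrite mem_cat !mem_nseq => /orP [] /andP [_ /eqP ->]; apply: codom_f.
  + by rewrite size_cat !size_nseq subnKC // ltnW.
  + move=> q; rewrite /set_exponent; case: eqP => _; last exact: ltnW.
    by apply: leq_trans h_le_m; apply: ltnW.
  + by rewrite frame_comm big_cat !big_nseq !iter_mulr_1.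
have [nz inj] := distinct_values_powers vO zO m
  (f0 i) (f0 l) bb' far.
by split=> [x|x x'] /=; rewrite !rmorphM !rmorphXn !emb_var_monomial; [apply: nz|apply: inj].
Qed.

Theorem spread : (0 < h)%N -> (h * h.*2.+1 ^ d <= n)%N -> has_spread.
Proof.
move=> h_gt0 hn; have [many|few] := leqP h #|codom representative|.
  exact: spread_many_classes.
exact: spread_few_classes.
Qed.

End Spread.
End Frame.

(** * Lower bounds for the growth of a generalized Weyl algebra *)

Section OrbitWords.
Variables (k : fieldType) (D A : algType k) (sigma : {lrmorphism D -> D}).
Variables (iota : {lrmorphism D -> A}) (x : A).
Hypothesis xd : forall d, x * iota d = iota (sigma d) * x.
Variables (F : comNzRingType) (j : {rmorphism D -> F}).
Hypothesis j_inj : injective j.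
Variables (vs : seq D) (W : seq A).
Hypothesis xW : x \in W.
Hypothesis vsW : {in vs, forall v, iota v \in W}.

Lemma prod_word l :
  {subset l <= vs} -> word_span W (size l) (iota (\prod_(v <- l) v)).
Proof.
move=> lvs; rewrite rmorph_prod /= -(big_map iota xpredT id).
apply: word_span_prod; last by rewrite size_map.
by move=> _ /mapP [v vl ->]; apply/vsW/lvs.
Qed.

(* Commuting the factors with a zero shift to the front leaves a word in which every
   remaining shift can be lowered by one letter [x]. *)
Lemma shifted_prod_word n (p : seq (nat * D)) e :
  {in p, forall q, (q.1 <= n)%N /\ q.2 \in vs} ->
  j e = \prod_(q <- p) j (iter q.1 sigma q.2) ->
  word_span W (n + size p) (iota e * x ^+ n).
Proof.
elim: n p e => [|n IH] p e hp je.
  have -> : e = \prod_(v <- [seq q.2 | q <- p]) v.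
    apply: j_inj; rewrite rmorph_prod big_map je !big_seq; apply: eq_bigr => q /hp [].
    by rewrite leqn0 => /eqP ->.
  rewrite expr0 mulr1 add0n -(size_map snd); apply: prod_word.
  by move=> _ /mapP [q /hp [_ qvs] ->].
pose e0 := \prod_(v <- [seq q.2 | q <- p & q.1 == 0%N]) v.
pose p1 := [seq (q.1.-1, q.2) | q <- p & q.1 != 0%N].
pose e1 := \prod_(q <- p1) iter q.1 sigma q.2.
have -> : e = e0 * sigma e1.
  apply: j_inj; rewrite je rmorphM (bigID (fun q => q.1 == 0%N)) /=; congr (_ * _).
    by rewrite rmorph_prod big_map big_filter; apply: eq_bigr => q /eqP ->.
  by rewrite !rmorph_prod big_map big_filter; apply: eq_bigr => -[[|i] v].
rewrite rmorphM exprS -mulrA [iota (sigma _) * _]mulrA -xd.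
have -> : (n.+1 + size p = size [seq q.2 | q <- p & q.1 == 0%N] + (1 + (n + size p1)))%N.
  rewrite !size_map -[in LHS](count_predC (fun q => q.1 == 0%N) p) !size_filter.
  exact: addnCA.
apply: word_spanM.
  by apply: prod_word => v /mapP [q]; rewrite mem_filter => /andP [_ /hp [_ qvs]] ->.
rewrite -mulrA; apply: word_spanM; first exact: word_span_mem.
apply: IH; last by rewrite rmorph_prod.
move=> t /mapP [q]; rewrite mem_filter => /andP [q0 /hp [qn qvs]] -> /=; split=> //.
by rewrite -ltnS prednK // lt0n.
Qed.

Lemma orbit_span_prod_word n (l : seq D) (p : seq (nat * D)) e :
  {in p, forall q, (q.1 <= n)%N /\ q.2 \in vs} ->
  {in l, forall u, in_span (orbit_list sigma vs n) u} ->
  j e = \prod_(u <- l) j u * \prod_(q <- p) j (iter q.1 sigma q.2) ->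
  word_span W (n + (size l + size p)) (iota e * x ^+ n).
Proof.
elim: l p e => [|u l IH] p e hp hl je.
  by apply: shifted_prod_word; rewrite // je big_nil mul1r.
pose e' := \prod_(u <- l) u * \prod_(q <- p) iter q.1 sigma q.2.
have -> : e = u * e'.
  by apply: j_inj; rewrite je big_cons !rmorphM !rmorph_prod mulrA.
set N := (n + _)%N.
apply: (in_span_preim (f := fun u => iota (u * e') * x ^+ n)) (hl u (mem_head _ _)).
- by apply: linear_mulr => c v w; rewrite mulrDl -scalerAl linearP.
- exact: word_span_subspace.
move=> _ /orbit_listP [i [v [ilt vvs ->]]].
have -> : N = (n + (size l + size ((i, v) :: p)))%N by rewrite /N /= addSnnS.
apply: IH.
- move=> q; rewrite inE => /predU1P [->|/hp//]; split=> //; exact: ltnW.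
- by move=> w wl; apply: hl; rewrite inE wl orbT.
- by rewrite !rmorphM !rmorph_prod big_cons /= mulrCA.
Qed.

End OrbitWords.

Section FrameGWAGrowth.
Variables (k : fieldType) (D A : algType k) (d : nat) (fr : frame D d).
Variables (sigma : {lrmorphism D -> D}) (a : D) (iota : {lrmorphism D -> A}) (x y : A).
Hypothesis bij : is_alg_automorphism sigma.
Hypothesis ca : central a.
Hypothesis gwa : is_GWA sigma a iota x y.
Local Notation z := (frame_var fr).

Let x_monomials_indep (J : finType) (f : J -> D) (s L : nat) : indep_family f ->
  indep_family (fun i : J * 'I_L => iota (f i.1) * x ^+ (s + i.2)).
Proof. by have [tau [sK tK]] := inverse_automorphism bij; apply: (GWA_indep sK tK gwa ca). Qed.

Lemma GWA_growth_ge : exists W : seq A, forall m,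
  (m ^ d.+1 <= span_dim (words_upto W (d.+1 * m)))%N.
Proof.
exists (x :: codom (fun i => iota (z i))) => m.
have -> : (m ^ d.+1 = #|{: {ffun 'I_d -> 'I_m} * 'I_m}|)%N.
  by rewrite card_prod card_ffun !card_ord expnSr.
have ind := x_monomials_indep (s := 0) (L := m) (@var_monomial_box_indep _ _ _ fr m).
apply: (indep_family_span_dim ind) => -[b l] /=; rewrite mulSn addnC; apply: word_spanM.
  apply: var_monomial_word => i; last exact: ltnW.
  by rewrite inE; apply/orP; right; apply: codom_f.
apply: (@word_span_mono _ _ _ l); first exact: ltnW.
by apply: word_span_memX; rewrite mem_head.
Qed.

(* Among this many elements of distinct values, [h] are pairwise incommensurable or two
   differ by a monomial with an exponent larger than [h]. *)
Definition spread_size (h : nat) := (h * h.*2.+1 ^ d)%N.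

Lemma leq_spread_size h : (h <= spread_size h)%N.
Proof. by rewrite leq_pmulr // expn_gt0. Qed.

Theorem GWA_growth_not_locally_algebraic : ~ locally_algebraic sigma -> exists W : seq A,
  forall h, (0 < h)%N -> (h * spread_size h ^ d.+1 <=
    span_dim (words_upto W ((d + 3) * spread_size h)))%N.
Proof.
move=> nla; have [vs vsP] := not_locally_algebraic_orbit (bij_inj bij) nla.
pose W := x :: [seq iota v | v <- vs] ++ codom (fun i => iota (z i)).
have zW i : iota (z i) \in W by rewrite inE mem_cat (codom_f (fun i => iota (z i))) !orbT.
have vsW : {in vs, forall v, iota v \in W}.
  by move=> v vvs; rewrite inE mem_cat map_f // orbT.
have xW : x \in W by rewrite mem_head.
exists W => h h0; set n := spread_size h; have [s [fs sz sub]] := vsP n.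
have [f fU f_values] := exists_distinct_values (frame_valuation fr) (frame_coefficient fr)
  (frame_scale fr) (@frame_inj _ _ _ fr) (in_span_subspace (orbit_list sigma vs n)) fs
  (fun u us => in_span_mem (sub u us)) sz.
have [J [e [cJ eP e_values]]] := spread f_values (leq_spread_size h) h0 (leqnn n).
rewrite expnS mulnCA mulnC; apply: (@leq_trans (#|J| * n)); first by rewrite leq_mul2r cJ orbT.
have -> : (#|J| * n = #|{: J * 'I_n}|)%N by rewrite card_prod card_ord.
apply: (indep_family_span_dim (x_monomials_indep (s := n) (frame_indep e_values))) => -[i l] /=.
have [q [b [qf sq bn ->]]] := eP i.
have -> : ((d + 3) * n = d * n + ((n + (n + 0)) + n))%N by lia.
rewrite rmorphM -mulrA exprD; apply: word_spanM; first exact: var_monomial_word.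
rewrite mulrA; apply: word_spanM; last first.
  by apply: (@word_span_mono _ _ _ l); [apply: ltnW|apply: word_span_memX].
apply: (@word_span_mono _ _ _ (n + (size q + 0))); first by rewrite leq_add2l leq_add2r.
have [[xd _ _ _] _] := gwa.
apply: (orbit_span_prod_word xd (@frame_inj _ _ _ fr) xW vsW (p := [::])) => //.
  by move=> u /qf /codomP [t ->]; apply: fU.
by rewrite rmorph_prod big_nil mulr1.
Qed.

End FrameGWAGrowth.

(** * Locally algebraic automorphisms of fields *)

Definition finite_orbit (k : fieldType) (V : lmodType k) (f : V -> V) (u : V) :=
  exists us : seq V, forall i, in_span us (iter i f u).

Definition periodic (T : Type) (f : T -> T) (u : T) := exists2 m, (0 < m)%N & iter m f u = u.

Definition root_of_unity (R : nzRingType) (x : R) := exists n, x ^+ n.+1 = 1.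

Section PeriodicVectors.
Variables (k : fieldType) (V : lmodType k) (v0 : V) (nz : v0 != 0) (f : endo nz).
Implicit Types (p q : {poly k}) (u v w : V).

Local Notation act := (horner_alg f).

Lemma horner_endoM p q u : act (p * q) u = act p (act q u).
Proof. by rewrite rmorphM. Qed.

Lemma horner_endo_XnsubC n c u : act ('X^n - c%:P) u = iter n f u - c *: u.
Proof. by rewrite rmorphB rmorphXn /= horner_algX horner_algC -endo_expE. Qed.

Lemma horner_endo_poly n (c : nat -> k) u :
  act (\poly_(i < n) c i) u = \sum_(i < n) c i *: iter i f u.
Proof.
rewrite poly_def rmorph_sum /=.
have -> (g : 'I_n -> endo nz) : (\sum_i g i) u = \sum_i g i u.
  by elim/big_rec2: _ => //= i v h _ <-.
by apply: eq_bigr => i _; rewrite linearZ rmorphXn /= horner_algX -endo_expE.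
Qed.

Lemma finite_orbit_annihilator u : finite_orbit f u -> exists2 p, p != 0 & act p u = 0.
Proof.
move=> [us orb]; pose n := (size us).+1; apply: contrapT => nann.
have : indep_family (fun i : 'I_n => iter i f u).
  move=> c c0 i; have [c' c'E] := ext_ord c; rewrite -c'E; pose p := \poly_(i < n) c' i.
  have p0 : p = 0.
    apply: contrapT => /eqP p0; apply: nann; exists p => //; rewrite horner_endo_poly -[RHS]c0.
    by apply: eq_bigr => l _; rewrite c'E.
  by have := coef_poly n c' i; rewrite -/p p0 coef0 ltn_ord.
by move/indep_family_size_le => /(_ us (fun i => orb i)); rewrite card_ord ltnn.
Qed.

Lemma annihilator_roots_of_unity (r : seq k) u :
  (forall v x, v != 0 -> f v = x *: v -> root_of_unity x) ->
  act (\prod_(x <- r) ('X - x%:P)) u = 0 ->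
  exists2 r', {in r', forall x, root_of_unity x} & act (\prod_(x <- r') ('X - x%:P)) u = 0.
Proof.
move=> eigen; elim: r u => [|x r IH] u; first by exists [::].
rewrite big_cons mulrC horner_endoM => /IH [r' ur']; rewrite -horner_endoM mulrC.
have [ux|nux] := pselect (root_of_unity x) => xr'.
  by exists (x :: r'); rewrite ?big_cons // => y; rewrite inE => /predU1P [->|/ur'].
exists r' => //; apply/eqP; apply: contra_notT nux => /eigen; apply.
move: xr'; rewrite horner_endoM -['X]expr1 horner_endo_XnsubC => /eqP; rewrite subr_eq0 => /eqP.
exact.
Qed.

Lemma roots_of_unity_dvdp (r : seq k) : {in r, forall x, root_of_unity x} ->
  exists2 m, (0 < m)%N & \prod_(x <- r) ('X - x%:P) %| ('X^m - 1) ^+ size r.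
Proof.
move=> ur; have [|m rm] := directed_bound (P := fun x n => x ^+ n.+1 = 1) 0%N _ ur.
  move=> m n; exists (m.+1 * n.+1).-1 => x; rewrite prednK //.
  by case=> [xm|xn]; [rewrite exprM xm|rewrite mulnC exprM xn]; rewrite expr1n.
exists m.+1 => //; elim: r {ur} rm => [|x r IH] rm; first by rewrite big_nil dvd1p.
rewrite big_cons /= [_ ^+ (size r).+1]exprS dvdp_mul //; last first.
  by apply: IH => y yr; apply: rm; rewrite inE yr orbT.
by rewrite dvdp_XsubCl /root !hornerE rm ?mem_head // subrr.
Qed.

Lemma unipotent_periodic_pchar m n (q : nat) u : q \in [pchar k] -> (0 < m)%N ->
  act (('X^m - 1) ^+ n) u = 0 -> periodic f u.
Proof.
move=> qch m0 u0; have q_pr := pcharf_prime qch.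
exists (m * q ^ n)%N; first by rewrite muln_gt0 m0 expn_gt0 prime_gt0.
have qnat : [pchar {poly k}].-nat (q ^ n)%N.
  rewrite (eq_pnat _ (pcharf_eq (_ : q \in [pchar {poly k}]))) ?pnatX ?pnat_id //.
  by rewrite pchar_poly.
have qE : ('X^m - 1) ^+ (q ^ n) = 'X^(m * q ^ n) - 1%:P :> {poly k}.
  by rewrite exprDn_pchar // exprNn_pchar // expr1n exprM.
apply/eqP; rewrite -subr_eq0 -{2}[u]scale1r -horner_endo_XnsubC -qE.
have /subnK <- : (n <= q ^ n)%N by rewrite ltnW // ltn_expl // prime_gt1.
by rewrite exprD horner_endoM u0 raddf0.
Qed.

Lemma unipotent_periodic_pchar0 m n u : (0 < m)%N ->
  (forall v w, v != 0 -> iter m f v = v -> iter m f w = w + v -> False) ->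
  act (('X^m - 1) ^+ n) u = 0 -> periodic f u.
Proof.
move=> m0 njordan; have actT v : act ('X^m - 1) v = iter m f v - v.
  by rewrite -polyC1 horner_endo_XnsubC scale1r.
elim: n => [|[|n] IH]; first by rewrite expr0 rmorph1 /= => ->; exists 1%N; rewrite ?raddf0.
  by rewrite expr1 actT => /eqP; rewrite subr_eq0 => /eqP mu; exists m.
move=> u0; apply: IH; apply/eqP; apply/negPn/negP => v_neq0.
apply: (njordan _ (act (('X^m - 1) ^+ n) u) v_neq0).
  by apply/eqP; rewrite -subr_eq0 -actT -horner_endoM -exprS u0.
by rewrite exprS horner_endoM actT [RHS]addrC subrK.
Qed.

(* The eigenvalues of [f] at [u] are roots of unity, so a power of [f] is unipotent at
   [u]; without Jordan blocks it fixes [u]. *)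
Theorem finite_orbit_periodic u : (forall p, splits p) ->
  (forall v x, v != 0 -> f v = x *: v -> root_of_unity x) ->
  ((forall n, (0 < n)%N -> n%:R != 0 :> k) -> forall m v w,
    v != 0 -> iter m f v = v -> iter m f w = w + v -> False) ->
  finite_orbit f u -> periodic f u.
Proof.
move=> spl eigen njordan /finite_orbit_annihilator [p p0 pu]; have [r pE] := spl p.
have [|r' ur' r'u] := annihilator_roots_of_unity (r := r) (u := u) eigen.
  move: pu; rewrite pE linearZ => /eqP; rewrite scaler_eq0 lead_coef_eq0 (negbTE p0).
  exact: eqP.
have [m m0 /dvdpP [t tE]] := roots_of_unity_dvdp ur'.
have Tu : act (('X^m - 1) ^+ size r') u = 0 by rewrite tE horner_endoM r'u raddf0.
have [[q qch]|ch0] := pselect (exists q : nat, q \in [pchar k]).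
  exact: unipotent_periodic_pchar qch m0 Tu.
apply: unipotent_periodic_pchar0 m0 _ Tu => v w.
by apply: njordan => n n0; apply: contra_notN ch0 => /(natf0_pchar n0).
Qed.

End PeriodicVectors.

Section SimpleFractions.
Variables (k F : fieldType) (kappa : {rmorphism k -> F}).
Hypothesis spl : forall p : {poly k}, splits p.

Lemma not_const_transcendental e (p : {poly k}) : (forall c, e <> kappa c) -> p != 0 ->
  (map_poly kappa p).[e] != 0.
Proof.
move=> ne p0; apply/eqP => pe0.
have [c|v w /eqP|c /eqP] := splits_root_prime (P := fun v => v = 0) _ _ (spl p) p0 pe0.
- by move/eqP; rewrite fmorph_eq0 => /eqP.
- by rewrite mulf_eq0 => /orP [] /eqP; [left|right].
- by rewrite subr_eq0 => /eqP /ne.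
Qed.

Lemma simple_fractions_indep e n (b c : 'I_n -> k) : (forall c, e <> kappa c) ->
  injective c -> \sum_i kappa (b i) / (e - kappa (c i)) = 0 -> forall i, b i = 0.
Proof.
move=> ne c_inj b0 i0; apply/eqP; apply: contraT => bi0.
have ec l : e - kappa (c l) != 0 by rewrite subr_eq0; apply/eqP.
pose p := \sum_i b i *: \prod_(l | l != i) ('X - (c l)%:P).
have p0 : p != 0.
  apply: contraNneq bi0 => p0; have := congr1 (fun q : {poly k} => q.[c i0]) p0.
  rewrite horner0 horner_sum (bigD1 i0) //= [X in _ + X = _]big1 => [|i ne0].
    rewrite addr0 hornerZ horner_prod => /eqP; rewrite mulf_eq0 => /orP [//|].
    move/prodf_eq0 => [l li0]; rewrite hornerXsubC subr_eq0 => /eqP /c_inj e'.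
    by rewrite e' eqxx in li0.
  rewrite hornerZ horner_prod (bigD1 i0) ?(eq_sym i0) //=.
  by rewrite hornerXsubC subrr mul0r mulr0.
case/negP: (not_const_transcendental ne p0); apply/eqP.
rewrite rmorph_sum horner_sum /=.
transitivity ((\prod_l (e - kappa (c l))) * \sum_i kappa (b i) / (e - kappa (c i))).
  rewrite mulr_sumr; apply: eq_bigr => i _.
  rewrite map_polyZ hornerZ rmorph_prod horner_prod [X in _ = X * _](bigD1 i) //=.
  rewrite [RHS]mulrC mulrA divfK //; congr (_ * _); apply: eq_bigr => l _.
  by rewrite rmorphB /= map_polyX map_polyC /= hornerXsubC.
by rewrite b0 mulr0.
Qed.

End SimpleFractions.

Section FieldOfAlgebra.
Variables (k : fieldType) (D : algType k).

Definition field_of (fD : is_field D) : Type := D.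
Variable fD : is_field D.

HB.instance Definition _ := GRing.Algebra.copy (field_of fD) D.
Lemma field_of_mulC : commutative (@GRing.mul (field_of fD)).
Proof. by case: fD. Qed.
HB.instance Definition _ := GRing.PzRing_hasCommutativeMul.Build (field_of fD) field_of_mulC.

Lemma field_of_inv_ex (u : field_of fD) :
  exists v : field_of fD, (u != 0 -> v * u = 1) /\ (u = 0 -> v = 0).
Proof.
have [u0|u0] := eqVneq u 0; first by exists 0.
have [v uv] := proj2 fD u u0; exists v; split=> [_|e]; first by rewrite field_of_mulC.
by case/eqP: u0.
Qed.

Definition field_of_inv (u : field_of fD) := projT1 (cid (field_of_inv_ex u)).
Lemma field_of_mulV u : u != 0 -> field_of_inv u * u = 1.
Proof. by rewrite /field_of_inv; case: cid => v /= [h h0] /h. Qed.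
Lemma field_of_inv0 : field_of_inv 0 = 0.
Proof. by rewrite /field_of_inv; case: cid => v /= [h h0]; apply: h0. Qed.
HB.instance Definition _ :=
  GRing.ComNzRing_isField.Build (field_of fD) field_of_mulV field_of_inv0.

End FieldOfAlgebra.

Section FieldAutomorphism.
Variables (k : fieldType) (D : algType k) (fD : is_field D).
Local Notation F := (field_of fD).
Variable s : {lrmorphism F -> F}.
Hypothesis spl : forall p : {poly k}, splits p.
Hypothesis s_orbit : forall u : F, finite_orbit s u.
Implicit Types (e u v w : F).

Lemma simple_fractions_not_in_span (us : seq F) e (c : nat -> k) :
  (forall b : k, e <> b%:A) -> injective c -> ~ (forall i, in_span us (e - (c i)%:A)^-1).
Proof.
move=> ne c_inj sp; pose n := (size us).+1.
have ind : indep_family (fun i : 'I_n => (e - (c i)%:A)^-1).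
  move=> b b0; apply: (@simple_fractions_indep k F (in_alg F) spl e n b (fun i : 'I_n => c i) ne).
    by move=> i l /c_inj; apply: val_inj.
  by rewrite -[RHS]b0; apply: eq_bigr => i _; rewrite mulr_algl.
by have := indep_family_size_le ind (fun i => sp i); rewrite card_ord ltnn.
Qed.

Lemma eigenvalue_root_of_unity e (x : k) : e != 0 -> s e = x *: e -> root_of_unity x.
Proof.
move=> e0 se; have [[c ec]|nc] := pselect (exists c : k, e = c%:A).
  have ss : s e = e by rewrite ec linearZ /= rmorph1.
  exists 0%N; apply/eqP; rewrite expr1 -subr_eq0; move/eqP: se.
  by rewrite ss -{1}[e]scale1r -subr_eq0 -scalerBl scaler_eq0 (negbTE e0) orbF -opprB oppr_eq0.
apply: contrapT => nx; have x0 : x != 0.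
  by apply: contraNneq e0 => x0; rewrite -(fmorph_eq0 s) /= se x0 scale0r.
have x_inj : injective (fun i => (x ^+ i)^-1).
  apply: injective_of_ltn => i l il /invr_inj xil; apply: nx; exists (l - i).-1.
  rewrite prednK ?subn_gt0 //; apply: (mulfI (expf_neq0 i x0)).
  by rewrite -exprD subnKC ?mulr1 // ltnW.
have [us orb] := s_orbit (e - 1)^-1.
apply: (simple_fractions_not_in_span (us := us) (e := e) _ x_inj) => [c ec|i].
  by apply: nc; exists c.
have xi0 : x ^+ i != 0 by rewrite expf_neq0.
have sei : iter i s e = x ^+ i *: e.
  by elim: (i) => [|i' IH]; rewrite ?scale1r //= IH linearZ /= se scalerA -exprSr.
have <- : x ^+ i *: iter i s (e - 1)^-1 = (e - (x ^+ i)^-1%:A)^-1.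
  have iter_e1 : iter i s (e - 1) = x ^+ i *: (e - (x ^+ i)^-1%:A).
    by rewrite rmorphB rmorph1 /= sei scalerBr scalerA divff // scale1r.
  rewrite fmorphV /= iter_e1 -[X in _ *: X^-1]mulr_algl invfM -(fmorphV (in_alg F)) /=.
  by rewrite mulr_algl scalerA divff // scale1r.
exact: subspaceZ (in_span_subspace us) (orb i).
Qed.

Lemma no_translation t m : (forall n, (0 < n)%N -> n%:R != 0 :> k) -> iter m s t <> t + 1.
Proof.
move=> ch tm; have [us orb] := s_orbit t^-1.
apply: (simple_fractions_not_in_span (us := us) (e := t) (c := fun i => - i%:R)) => [c tc||i].
- move: tm; rewrite tc linearZ rmorph1 /= => /eqP; rewrite addrC -subr_eq subrr.
  by rewrite eq_sym oner_eq0.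
- apply: injective_of_ltn => i l il /oppr_inj il_eq.
  have /negP := ch (l - i)%N (ltac:(lia)); apply.
  by rewrite natrB ?(ltnW il) // il_eq subrr.
have -> : t - (- i%:R : k)%:A = iter (i * m) s t; last first.
  by have := orb (i * m)%N; rewrite fmorphV.
rewrite scaleNr opprK scaler_nat; elim: i => [|i IH]; first by rewrite addr0.
by rewrite mulSn iterD -IH rmorphD rmorph_nat /= tm -addrA -mulrS.
Qed.

Lemma field_automorphism_periodic u : periodic s u.
Proof.
have nz : 1 != 0 :> F := oner_neq0 F.
apply: (@finite_orbit_periodic k F 1 nz (Endo nz (linearP s))) => //.
  exact: eigenvalue_root_of_unity.
move=> ch m v w v0 sv sw; case: (@no_translation (w / v) m ch).
by rewrite rmorphM fmorphV /= [iter m s v]sv [iter m s w]sw mulrDl divff.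
Qed.

End FieldAutomorphism.

Lemma finite_order_fg (k : fieldType) (D : algType k) (sigma : {lrmorphism D -> D}) :
  is_field D -> fg_field_over_k D -> (forall u, periodic sigma u) -> finite_order sigma.
Proof.
move=> fD [gs gsP] per; have iter_fix m n u : iter m sigma u = u -> iter (m * n) sigma u = u.
  by move=> mu; elim: n => [|n IH]; rewrite ?muln0 // mulnS iterD IH.
have [||m gsm] := directed_bound (P := fun u n => iter n.+1 sigma u = u) 0%N (s := gs).
- move=> m n; exists (m.+1 * n.+1).-1 => u; rewrite prednK //.
  by case=> [/iter_fix //|]; rewrite mulnC => /iter_fix.
- by move=> u _; have [n n0 nu] := per u; exists n.-1; rewrite prednK.
have [s sE] : exists s : {lrmorphism D -> D}, s =1 iter m.+1 sigma.
  by exists (iter m.+1 sigma : {lrmorphism D -> D}).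
exists m.+1; split=> // d; rewrite -sE.
apply: (gsP (fun u => s u = u)) => [|g /gsm]; last by rewrite sE.
split=> [c|u v su sv|u v su sv|u e su ue].
- by rewrite linearZ rmorph1.
- by rewrite rmorphD /= su sv.
- by rewrite rmorphM /= su sv.
have use : u * s e = 1 by rewrite -[u in u * _]su -rmorphM ue rmorph1.
by case: fD => mulC _; rewrite -[s e]mul1r -ue [u * e]mulC -mulrA use mulr1.
Qed.

Theorem locally_algebraic_finite_order (k : fieldType) (D : algType k)
    (sigma : {lrmorphism D -> D}) : (forall p : {poly k}, splits p) ->
  is_field D -> fg_field_over_k D -> locally_algebraic sigma -> finite_order sigma.
Proof.
move=> spl fD fg la; apply: finite_order_fg => // u.
apply: (@field_automorphism_periodic k D fD sigma spl) => v.
have [us [vU [st _]]] := la [:: v]; exists us.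
by elim=> [|i IH] /=; [apply: vU; rewrite mem_head|apply: st].
Qed.

(** * Simplicity *)

Section Simplicity.
Variables (k : fieldType) (D A : algType k) (sigma tau : {lrmorphism D -> D}) (a : D).
Variables (iota : {lrmorphism D -> A}) (x y : A).
Hypotheses (sK : cancel sigma tau) (tK : cancel tau sigma).
Hypothesis gwa : is_GWA sigma a iota x y.

(* D itself is a module, with x acting as sigma; x^m - 1 annihilates it. *)
Lemma finite_order_not_simple : central a -> finite_order sigma -> ~ simple_algebra A.
Proof.
move=> ca [m [m_gt0 sm]] [_ simple].
have [nz [g [_ gx]]] := GWA_shift_representation sK tK gwa ca tt (up := id) (dn := id)
  (fun=> erefl) (fun=> erefl).
have ker_ideal : two_sided_ideal (fun u => g u = 0).
  split=> [|u v gu gv|r u gu]; first exact: rmorph0.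
  - by rewrite rmorphD /= gu gv addr0.
  - by rewrite !rmorphM /= gu mulr0 mul0r.
case: (simple _ ker_ideal) => [inj|/(_ 1)]; last by apply/eqP; rewrite rmorph1 oner_eq0.
have xm : x ^+ m = 1.
  apply/eqP; rewrite -subr_eq0; apply/eqP/inj; rewrite rmorphB rmorphXn rmorph1 /=.
  apply/eqP; rewrite subr_eq0; apply/eqP/endoP => f; apply/funext => t.
  have gxi i : iter i (g x) f = fun t => iter i sigma (f t).
    by elim: i => //= i ->; rewrite gx.
  by rewrite endo_expE gxi sm.
have [cf cfE] := GWA_x_coefficient sK tK gwa ca.
have := cfE m m 1; have := cfE m 0%N 1.
rewrite eqxx xm expr0 !rmorph1 !mul1r => ->.
by rewrite gtn_eqF // => /eqP; rewrite eq_sym oner_eq0.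
Qed.

Hypothesis fD : is_field D.
Hypothesis a0 : a != 0.

Let mulDC : forall d e : D, d * e = e * d. Proof. by case: fD. Qed.

Let iota_inv d : d != 0 -> exists e, iota e * iota d = 1.
Proof. by case: fD => _ V /V [e de]; exists e; rewrite -rmorphM mulDC de rmorph1. Qed.

Definition x_poly n (c : nat -> D) : A := \sum_(i < n) iota (c i) * x ^+ i.

Lemma x_poly_subspace n : subspace (fun u => exists c, u = x_poly n c).
Proof.
split; first by exists (fun=> 0); rewrite [RHS]big1 // => i _; rewrite raddf0 mul0r.
move=> c _ _ [e ->] [f ->]; exists (fun i => c *: e i + f i).
rewrite scaler_sumr -big_split; apply: eq_bigr => i _.
by rewrite linearP mulrDl scalerAl.
Qed.

Lemma x_poly_monomial n i d : (i < n)%N -> exists c, iota d * x ^+ i = x_poly n c.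
Proof.
move=> ilt; exists (fun l => if l == i then d else 0).
rewrite [RHS](bigD1 (Ordinal ilt)) //= eqxx big1 ?addr0 // => l ne.
by rewrite -val_eqE /= in ne; rewrite (negbTE ne) raddf0 mul0r.
Qed.

Lemma yx_cancel i l : (i <= l)%N -> exists d, y ^+ i * x ^+ l = iota d * x ^+ (l - i).
Proof.
elim: i l => [|i IH] [|l] //; try by exists 1; rewrite rmorph1 !mul1r.
rewrite ltnS => /IH [d de]; case: gwa => [[_ _ yx _] _].
exists (iter i tau a * d); rewrite exprSr exprS -mulrA [y * _]mulrA yx mulrA.
by rewrite (GWA_yd sK tK gwa) -mulrA de mulrA -rmorphM.
Qed.

Lemma x_regular u n : u * x ^+ n = 0 -> u = 0.
Proof.
have sa0 : sigma a != 0 by rewrite raddf_eq0 //; apply: can_inj sK.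
have [e ea] := iota_inv sa0; rewrite -rmorphM mulDC rmorphM /= in ea.
have x1 v : v * x = 0 -> v = 0.
  move=> vx; case: gwa => [[_ _ _ xy] _].
  by rewrite -[v]mulr1 -ea -xy !mulrA vx !mul0r.
elim: n => [|n IH]; first by rewrite expr0 mulr1.
by rewrite exprSr mulrA => /x1 /IH.
Qed.

Lemma exists_x_multiple_x_poly u : exists n c, u * x ^+ n = x_poly n.*2.+1 c.
Proof.
have [g ug] := GWA_normal_form sK tK gwa u; exists g.
apply: (degree_le_ind (T := fun u => exists c, u * x ^+ g = x_poly g.*2.+1 c)) ug.
- apply: (subspace_preim (f := fun u => u * x ^+ g) _ (x_poly_subspace _)).
  exact/linear_mulr/(linearP idfun).
- move=> d i _ ig; rewrite -mulrA -exprD; apply: x_poly_monomial.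
  by rewrite ltnS -addnn leq_add2r.
- move=> d i _ ig; rewrite -mulrA; have [e ->] := yx_cancel ig.
  by rewrite mulrA -rmorphM; apply: x_poly_monomial; lia.
Qed.

Section Ideal.
Variable I : A -> Prop.
Hypothesis idI : two_sided_ideal I.

Let I_mull r u : I u -> I (r * u). Proof. by case: idI => _ _ /(_ r u) + Iu; case. Qed.
Let I_mulr r u : I u -> I (u * r). Proof. by case: idI => _ _ /(_ r u) + Iu; case. Qed.

(* The ideal also contains [sigma^n(e) u - u e], where the leading terms cancel. *)
Lemma ideal_x_poly_cancel n (c : nat -> D) e : I (x_poly n.+1 c) ->
  I (x_poly n (fun i => (iter n sigma e - iter i sigma e) * c i)).
Proof.
move=> Ic; have term i : iota ((iter n sigma e - iter i sigma e) * c i) * x ^+ i =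
    iota (iter n sigma e) * (iota (c i) * x ^+ i) - iota (c i) * x ^+ i * iota e.
  rewrite -[_ * iota e]mulrA (GWA_xd gwa) !mulrA -!rmorphM -mulrBl -rmorphB.
  by rewrite mulrBl [c i * _]mulDC.
have -> : x_poly n (fun i => (iter n sigma e - iter i sigma e) * c i) =
    iota (iter n sigma e) * x_poly n.+1 c - x_poly n.+1 c * iota e.
  rewrite [x_poly n.+1 c]/x_poly mulr_sumr mulr_suml -sumrB big_ord_recr /= -term subrr.
  by rewrite mul0r raddf0 mul0r addr0; apply: eq_bigr => i _; rewrite term.
case: idI => _ ID _; apply: ID; first exact: I_mull.
by rewrite -mulN1r; apply/I_mull/I_mulr.
Qed.

Lemma ideal_x_power u : ~ finite_order sigma -> I u -> u != 0 -> exists n, I (x ^+ n).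
Proof.
move=> inf Iu u0; pose Q n := `[< exists c, (exists2 i, (i < n)%N & c i != 0) /\ I (x_poly n c) >].
have exQ : exists n, Q n.
  have [g [c uc]] := exists_x_multiple_x_poly u.
  exists g.*2.+1; apply/asboolP; exists c; split; last by rewrite -uc; apply: I_mulr.
  apply: contrapT => nc; case/eqP: u0; apply: (@x_regular _ g); rewrite uc [LHS]big1 // => i _.
  have -> : c i = 0; last by rewrite raddf0 mul0r.
  by apply/eqP; apply: contraT => ci; case: nc; exists (i : nat).
case: (ex_minnP exQ) => -[|n] /asboolP [c [[i ilt ci] Ic]] minn //.
have c0 l : (l < n)%N -> c l = 0.
  move=> ln; apply/eqP; apply: contraT => cl; case: inf; exists (n - l)%N.
  split=> [|e]; first by rewrite subn_gt0.
  have : (iter n sigma e - iter l sigma e) * c l = 0.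
    apply/eqP; apply: contraT => nel; suff /minn : Q n by rewrite ltnn.
    apply/asboolP; exists (fun i => (iter n sigma e - iter i sigma e) * c i).
    by split; [exists l|apply: ideal_x_poly_cancel].
  have [f fc] : exists f, c l * f = 1 by case: fD => _; apply.
  move/(congr1 (fun w => w * f)); rewrite -mulrA fc mulr1 mul0r => /eqP.
  rewrite subr_eq0 -{1}(subnKC (ltnW ln)) iterD => /eqP.
  by apply: (can_inj (g := iter l tau)) => w; elim: (l) => //= l' IH; rewrite -iterS iterSr sK.
have cn : c n != 0.
  by move: ilt ci; rewrite ltnS leq_eqVlt => /predU1P [->//|/c0 ->]; rewrite eqxx.
exists n; have [e ec] := iota_inv cn.
have := I_mull (iota e) Ic; rewrite /x_poly big_ord_recr /= big1 ?add0r => [|l _]; last first.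
  by rewrite c0 // raddf0 mul0r.
by rewrite mulrA ec mul1r.
Qed.

Lemma ideal_x_power_full n : I (x ^+ n) -> forall u, I u.
Proof.
have [e ea] := iota_inv a0; have [[_ _ yx _] _] := gwa.
elim: n => [|n IH] Ixn; first by move=> u; rewrite -[u]mulr1; apply: I_mull.
apply: IH; have := I_mull (iota e * y) Ixn.
by rewrite exprS -mulrA [y * _]mulrA yx mulrA ea mul1r.
Qed.

End Ideal.

Lemma infinite_order_simple : ~ finite_order sigma -> simple_algebra A.
Proof.
move=> inf; split=> [|I idI]; first exact: oner_neq0.
have [[u [Iu /eqP u0]]|nI] := pselect (exists u, I u /\ u <> 0); last first.
  by left=> u Iu; apply: contrapT => u0; apply: nI; exists u.
by right; have [n] := ideal_x_power idI inf Iu u0; apply: ideal_x_power_full.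
Qed.

End Simplicity.

(** * Existence of frames *)

Module FrameConstruction.
Import mpoly AlgebraicIndependence.

Lemma frame_of_transcendence_basis (k : fieldType) (D : algType k) (F : fieldType)
    (kappa : {rmorphism k -> F}) (j : {rmorphism D -> F}) (d : nat) (z : 'I_d -> D) :
  injective j -> (forall c u, j (c *: u) = kappa c * j u) ->
  alg_indep kappa (fun i => j (z i)) ->
  (forall u, split_algebraic kappa (fun i => j (z i)) u) ->
  inhabited (frame D d) /\ growth_le D d.
Proof.
move=> j_inj jZ ind alg; have [O [vO cO zO]] := monomial_valuation ind alg.
split; first exact: (inhabits (Frame j_inj jZ vO cO zO)).
by apply: (algebraic_growth_le ind j_inj jZ) => u; have [P [P0 Pu _]] := alg (j u); exists P.
Qed.

Lemma frame_between (k : fieldType) (n : nat) (D : algType k) :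
  between_poly_and_fractions n D -> inhabited (frame D n) /\ growth_le D n.
Proof.
move=> [j [j_inj jZ jP]].
pose kappa : {rmorphism k -> MP.Qn k n} := @tofrac _ \o @mpolyC n k.
have /choice [z zE] : forall i : 'I_n, exists d : D, j d = tofrac ('X_i : {mpoly k[n]}).
  by move=> i; apply: jP.
have evE p : mmap kappa (fun i => j (z i)) p = tofrac p.
  rewrite [in RHS](mpolyE p) rmorph_sum; apply: eq_bigr => m _ /=.
  rewrite -mul_mpolyC tofracM; congr (_ * _).
  rewrite mpolyXE_id rmorph_prod; apply: eq_bigr => i _.
  by rewrite zE /= tofracXn.
have ind : alg_indep kappa (fun i => j (z i)).
  by move=> p q; rewrite !evE => /eqP; rewrite tofrac_eq => /eqP.
apply: (frame_of_transcendence_basis (kappa := kappa) j_inj jZ ind) => u.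
have [p [q [q0 ->]]] := fractionP u; exists (q *: 'X - p%:P).
have sz : size (q *: 'X - p%:P) = 2%N.
  by rewrite size_polyDl size_scale ?size_polyX // size_polyN (leq_ltn_trans (size_polyC_leq1 _)).
split; [by rewrite -size_poly_eq0 sz| |by move=> r; rewrite sz; apply: splits_size2].
rewrite rmorphB /= map_polyZ map_polyX map_polyC /= hornerD hornerN hornerZ hornerX hornerC.
by rewrite !evE mulrC divfK ?subrr // tofrac_eq0.
Qed.

Lemma frame_field (k : fieldType) (D : algType k) : (forall p : {poly k}, splits p) ->
  is_field D -> fg_field_over_k D -> exists d, inhabited (frame D d) /\ growth_le D d.
Proof.
move=> spl fD [gs gsP]; pose F : fieldType := field_of fD.
pose kappa : {rmorphism k -> F} := in_alg (field_of fD).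
have [d [z [ind _ alg]]] := transcendence_basis kappa (gs : seq F).
have algF (u : F) : algebraic (mmap kappa z) u.
  apply: (gsP (algebraic (mmap kappa z))) => //; split=> [c|v w|v w|v e av ve].
  - by have := algebraic_const (mmap kappa z) c%:MP; rewrite /= mmapC.
  - exact: algebraicD.
  - exact: algebraicM.
  have v0 : (v : F) != 0.
    by apply/eqP => v0; move/eqP: ve; rewrite v0 mul0r eq_sym oner_eq0.
  have -> : e = (v : F)^-1 by apply: (mulfI v0); rewrite [LHS]ve divff.
  exact: algebraicV.
exists d; apply: (@frame_of_transcendence_basis k D F kappa idfun d z) => //.
  by move=> c u; rewrite mulr_algl.
by move=> u; have [P P0 Pu] := algF u; exists P; split.
Qed.

End FrameConstruction.

(* Imported only here: the notations of the analysis library clash with those of [mpoly]. *)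
From mathcomp Require Import all_classical all_reals all_analysis Rstruct.
From mathcomp Require Import lra.

(** * Gelfand-Kirillov dimension from polynomial bounds *)

Section LogarithmicGrowth.
Variable R : realType.
Implicit Types (f : nat -> \bar R) (l : \bar R).

Lemma limn_esup_le_eventually f l :
  (exists N, forall n, (N <= n)%N -> (f n <= l)%E) -> (limn_esup f <= l)%E.
Proof.
move=> [N fN]; apply: (@le_trans _ _ (ereal_sup (f @` [set n | (N <= n)%N])%classic)).
  by apply: ereal_inf_lbound; exists [set n | (N <= n)%N]%classic => //; exact: nbhs_infty_ge.
by apply: ge_ereal_sup => _ [n /= Nn <-]; apply: fN.
Qed.

Lemma limn_esup_ge_frequently f l :
  (forall N, exists2 n, (N <= n)%N & (l <= f n)%E) -> (l <= limn_esup f)%E.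
Proof.
move=> fN; apply: le_ereal_inf_tmp => _ [V [N _ NV] <-].
have [n Nn ln] := fN N; apply: le_trans ln _; apply: ereal_sup_ubound.
by exists n => //; apply: NV.
Qed.

Lemma ln_nat_unbounded (T : R) : exists N, forall n, (N <= n)%N -> T <= ln n%:R.
Proof.
exists (Num.truncn (expR T)).+1 => n Nn; rewrite -[T]expRK ler_ln ?posrE ?expR_gt0 //.
  by apply: le_trans (ltW (truncnS_gt _)) _; rewrite ler_nat.
by rewrite ltr0n; apply: leq_trans Nn.
Qed.

Lemma ln_nat_ge0 (n : nat) : 0 <= ln n%:R :> R.
Proof.
by case: n => [|n]; [rewrite ln0|rewrite ln_ge0 // ler1n].
Qed.

Lemma ler_ln_nat (m n : nat) : (m <= n)%N -> ln m%:R <= ln n%:R :> R.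
Proof.
case: m => [|m] mn; first by rewrite [ln 0%:R]ln0 ?ln_nat_ge0.
by rewrite ler_ln ?posrE ?ltr0n // ?ler_nat //; apply: leq_trans mn.
Qed.

Lemma ln_natM (m n : nat) : (0 < m)%N -> (0 < n)%N -> ln (m * n)%:R = ln m%:R + ln n%:R :> R.
Proof. by move=> m0 n0; rewrite natrM lnM // posrE ltr0n. Qed.

Lemma ln_natX (m e : nat) : (0 < m)%N -> ln (m ^ e)%:R = e%:R * ln m%:R :> R.
Proof. by move=> m0; rewrite natrX lnXn ?ltr0n // mulr_natl. Qed.

End LogarithmicGrowth.

Section GKdim.
Variables (k : fieldType) (B : algType k).
Local Notation R := Rdefinitions.R.

Lemma GKdim_le e : growth_le B e -> (GKdim B <= e%:R%:E)%E.
Proof.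
move=> gr; apply: ge_ereal_sup => _ [vs _ <-].
have [C CP] := gr vs.
apply/lee_addgt0Pr => eps eps0; apply: limn_esup_le_eventually.
pose err : R := ln C.+1%:R + e%:R * ln 2%:R.
have [N NP] := ln_nat_unbounded (Num.max 1 (err / eps)).
exists (maxn N 1) => n; rewrite geq_max => /andP [Nn n1].
have := NP n Nn; rewrite ge_max => /andP [ln1 ln_err].
have ln0 : 0 < ln n%:R :> R by apply: lt_le_trans ln1.
rewrite /GK_growth lee_fin ler_pdivrMr //.
have dim_le : (span_dim (words_upto vs n) <= C.+1 * (2 * n) ^ e)%N.
  by apply: leq_trans (CP n) _; apply: leq_mul => //; apply: leq_expn_base; lia.
apply: le_trans (ler_ln_nat _ dim_le) _.
rewrite ln_natM ?expn_gt0 ?muln_gt0 ?n1 // ln_natX ?muln_gt0 // ln_natM //.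
have : err <= ln n%:R * eps by rewrite -ler_pdivrMr.
rewrite /err; lra.
Qed.

Lemma GKdim_ge (vs : seq B) (C c p q : nat) : (0 < C)%N -> (0 < c)%N -> (0 < q)%N ->
  (forall N, exists2 m, (N <= m)%N &
    (m ^ p <= C * span_dim (words_upto vs (c * m)) ^ q)%N) ->
  ((p%:R / q%:R)%:E <= GKdim B)%E.
Proof.
move=> C0 c0 q0 fr; apply: (@le_trans _ _ (limn_esup (GK_growth vs))); last first.
  by apply: ereal_sup_ubound; exists vs.
apply/lee_subgt0Pr => eps eps0; apply: limn_esup_ge_frequently => N.
have q0R : 0 < q%:R :> R by rewrite ltr0n.
pose err : R := ln C%:R + p%:R * ln c%:R.
have [N' N'P] := ln_nat_unbounded (Num.max 1 (err / (q%:R * eps))).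
have [m] := fr (maxn (maxn N N') 1); rewrite !geq_max -andbA => /and3P [Nm N'm m0] mp.
exists (c * m)%N; first by apply: leq_trans Nm _; rewrite leq_pmull.
have := N'P m N'm; rewrite ge_max => /andP [ln1 ln_err].
have lnm0 : 0 < ln m%:R :> R by apply: lt_le_trans ln1.
have lnc0 : 0 <= ln c%:R :> R by apply: ln_nat_ge0.
have lncm : ln (c * m)%:R = ln c%:R + ln m%:R :> R by rewrite ln_natM.
rewrite /GK_growth -EFinD lee_fin ler_pdivlMr; last by rewrite lncm; lra.
set S := span_dim _ in mp *.
have S0 : (0 < S)%N.
  rewrite lt0n; apply/eqP => S0; move: mp; rewrite S0 exp0n // muln0 leqn0.
  by rewrite expn_eq0 -[m]prednK.
have log_mp : p%:R * ln m%:R <= ln C%:R + q%:R * ln S%:R :> R.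
  have := ler_ln_nat R mp; rewrite ln_natX // ln_natM ?expn_gt0 ?S0 //.
  by rewrite ln_natX.
have errP : err <= ln m%:R * (q%:R * eps) by rewrite -ler_pdivrMr // mulr_gt0.
rewrite lncm -(ler_pM2l q0R) mulrA mulrBr mulrCA divff ?mulr1; last by rewrite gt_eqF.
have : 0 <= q%:R * eps * ln c%:R by rewrite !mulr_ge0 ?(ltW q0R) ?(ltW eps0).
by rewrite /err in errP; nra.
Qed.

Lemma GKdim_ge_nat (vs : seq B) (c e : nat) : (0 < c)%N ->
  (forall m, (m ^ e <= span_dim (words_upto vs (c * m)))%N) -> (e%:R%:E <= GKdim B)%E.
Proof.
move=> c0 vsP; have -> : e%:R%:E = (e%:R / 1%:R)%:E :> \bar R by rewrite divr1.
by apply: (@GKdim_ge vs 1 c) => // N; exists N; rewrite // mul1n expn1.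
Qed.

End GKdim.

Section FrameGKdim.
Variables (k : fieldType) (D A : algType k) (d : nat) (fr : frame D d).
Variables (sigma : {lrmorphism D -> D}) (a : D) (iota : {lrmorphism D -> A}) (x y : A).
Hypothesis D_growth : growth_le D d.
Hypothesis bij : is_alg_automorphism sigma.
Hypothesis ca : central a.
Hypothesis gwa : is_GWA sigma a iota x y.

Lemma frame_GKdim : GKdim D = d%:R%:E.
Proof.
apply/eqP; rewrite eq_le (GKdim_le D_growth) /=.
by have [W WP] := frame_growth_ge fr; apply: (GKdim_ge_nat _ WP).
Qed.

Lemma frame_GKdim_GWA_ge : (d.+1%:R%:E <= GKdim A)%E.
Proof. by have [W WP] := GWA_growth_ge fr bij ca gwa; apply: (GKdim_ge_nat _ WP). Qed.

(* With n = h (2h+1)^d <= 3^d h^(d+1), the bound h n^(d+1) <= dim W_((d+3)n) has exponent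
   d + 1 + 1/(d+1) in n. *)
Lemma frame_GKdim_GWA_gt : ~ locally_algebraic sigma -> (d.+1%:R%:E < GKdim A)%E.
Proof.
move=> nla; have [W WP] := GWA_growth_not_locally_algebraic fr bij ca gwa nla.
apply: (@lt_le_trans _ _ ((d.+1 ^ 2).+1%:R / d.+1%:R)%:E).
  by rewrite lte_fin ltr_pdivlMr ?ltr0n // -natrM ltr_nat; lia.
apply: (@GKdim_ge _ _ W (3 ^ d) (d + 3)) => //; rewrite ?expn_gt0 ?addn3 //.
move=> N; exists (spread_size d N.+1); first exact: leq_trans (leqnSn _) (leq_spread_size _ _).
set n := spread_size d N.+1; set S := span_dim _.
have dim_ge : (N.+1 * n ^ d.+1 <= S)%N by rewrite /S -addn3; apply: WP.
have n_le : (n <= 3 ^ d * N.+1 ^ d.+1)%N.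
  by rewrite expnS mulnCA -expnMn leq_mul2l leq_expn_base ?orbT //; lia.
rewrite expnS; apply: leq_trans (leq_mul n_le (leqnn _)) _.
rewrite -mulnA leq_mul2l; apply/orP; right.
by rewrite -mulnn expnM -expnMn leq_expn_base.
Qed.

Theorem frame_GKdim_GWA : GKdim A = (GKdim D + 1)%E <-> locally_algebraic sigma.
Proof.
rewrite frame_GKdim -EFinD natr1; split=> [GKA|la].
  by apply: contrapT => /frame_GKdim_GWA_gt; rewrite GKA ltxx.
apply/eqP; rewrite eq_le frame_GKdim_GWA_ge andbT; apply: GKdim_le.
exact: (GWA_growth_le bij gwa la D_growth).
Qed.

End FrameGKdim.

Theorem theorem0p1 :
  (* (1) P_n <= D <= Q_n : (a) <-> (b) *)
  (forall (k : fieldType) (n : nat) (D : algType k) (sigma : {lrmorphism D -> D})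
      (a : D) (A : algType k) (iota : {lrmorphism D -> A}) (x y : A),
    is_alg_automorphism sigma -> central a -> is_GWA sigma a iota x y ->
    between_poly_and_fractions n D ->
    (GKdim A = (GKdim D + 1)%E <-> locally_algebraic sigma)) /\
  (* (2) k algebraically closed, D a finitely generated field extension of k, a <> 0 :
     (a), (b), (c), (d) are equivalent *)
  (forall (k : closedFieldType) (D : algType k) (sigma : {lrmorphism D -> D})
      (a : D) (A : algType k) (iota : {lrmorphism D -> A}) (x y : A),
    is_alg_automorphism sigma -> central a -> is_GWA sigma a iota x y ->
    is_field D -> fg_field_over_k D -> a != 0 ->
    [<-> GKdim A = (GKdim D + 1)%E;
         locally_algebraic sigma;
         finite_order sigma;
         ~ simple_algebra A]).
Proof.
split=> [k n D sigma a A iota x y bij ca gwa|k D sigma a A iota x y bij ca gwa fD fg a0].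
  move=> /FrameConstruction.frame_between [[fr] D_growth].
  exact: (frame_GKdim_GWA fr D_growth bij ca gwa).
have spl (p : {poly k}) : splits p.
  by have [r rE] := closed_field_poly_normal p; exists r.
have [d [[fr] D_growth]] := FrameConstruction.frame_field spl fD fg.
have GK_la := frame_GKdim_GWA fr D_growth bij ca gwa.
have [tau [sK tK]] := inverse_automorphism bij.
tfae.
- by move/GK_la.
- exact: locally_algebraic_finite_order.
- exact: (finite_order_not_simple sK tK gwa ca).
- move=> nsimple; apply/GK_la/finite_order_locally_algebraic; first exact: bij_inj bij.
  by apply: contrapT => inf; apply/nsimple/(infinite_order_simple sK tK gwa fD a0 inf).
Qed.
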